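(* For any prime $g \geq 5$, any real number $k\ge 1$ and any $\varepsilon>0$, \[ \sum_{0<d<X} h_g(-d)^k \ll \begin{cases} X^{1+ k\left( \frac{g-2}{2g+2} \right) + \varepsilon} & \text{if } 1 \leq k \leq \frac{g^2-1}{2g-1},\\ X^{1 +k\left( \frac{g-1}{2g} \right) - \left( \frac{g-1}{2g} \right) + \varepsilon} & \text{if } \frac{g^2-1}{2g-1} \leq k \leq g+1,\\ X^{\frac{k}{2}+\varepsilon}& \text{if } k\ge g+1, \end{cases}\] for all $X\ge 2$, where the sum runs over square-free integers $d$ with $0<d<X$.
   Context: For a square-free positive integer $d$ and an odd prime $g$, $h_g(-d)$ denotes the number of ideal classes in the class group of $\mathbb{Q}(\sqrt{-d})$ whose $g$-th power is the principal class. Implied constants may depend on $\varepsilon$, $g$ and $k$. *)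

(* Defs.v *)
From HB Require Import structures.
From mathcomp Require Import all_boot all_order all_algebra all_field finmap.
From mathcomp Require Import all_classical all_reals all_analysis.

Set Implicit Arguments.
Unset Strict Implicit.
Unset Printing Implicit Defensive.

Import Order.TTheory GRing.Theory Num.Theory.

Local Open Scope classical_set_scope.
Local Open Scope ring_scope.

Definition squarefree (n : nat) : Prop :=
  forall m : nat, (m ^ 2 %| n)%N -> m = 1%N.

(* The field Q(sqrt(-d)), as a subset of the algebraic complex numbers. *)
Definition imag_quad_field (d : nat) : set algC :=
  [set x | exists a b : rat, x = ratr a + ratr b * sqrtC (- d%:R)].

Definition ring_of_integers (d : nat) : set algC :=
  [set x | imag_quad_field d x /\ x \in Aint].

(* Nonzero fractional ideals of the ring of integers of Q(sqrt(-d)). *)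
Definition fractional_ideal (d : nat) (I : set algC) : Prop :=
  [/\ I `<=` imag_quad_field d,
      exists2 x, I x & x != 0,
      forall x y, I x -> I y -> I (x + y),
      forall c x, ring_of_integers d c -> I x -> I (c * x)
    & exists2 c, ring_of_integers d c /\ c != 0 &
        forall x, I x -> ring_of_integers d (c * x)].

Definition ideal_mul (I J : set algC) : set algC :=
  [set x | exists2 s : seq (algC * algC),
     (forall p, p \in s -> I p.1 /\ J p.2) & x = \sum_(p <- s) p.1 * p.2].

Definition ideal_scale (a : algC) (I : set algC) : set algC :=
  [set a * x | x in I].

(* The class of I is its coset modulo the nonzero principal fractional
   ideals. *)
Definition ideal_class (d : nat) (I : set algC) : set (set algC) :=
  [set ideal_scale a I | a in [set a | imag_quad_field d a /\ a != 0]].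

Definition class_group (d : nat) : set (set (set algC)) :=
  [set ideal_class d I | I in [set I | fractional_ideal d I]].

Definition principal_class (d : nat) : set (set algC) :=
  ideal_class d (ring_of_integers d).

(* Product of cosets, taken elementwise. *)
Definition class_mul (C D : set (set algC)) : set (set algC) :=
  [set ideal_mul I J | I in C & J in D].

Definition class_pow (d : nat) (C : set (set algC)) (n : nat) :
    set (set algC) :=
  iter n (class_mul C) (principal_class d).

(* class_torsion g d is h_g(-d).  The set counted is finite, since the class
   group is. *)
Definition class_torsion (g d : nat) : nat :=
  #|` fset_set [set C | class_group d C /\
                        class_pow d C g = principal_class d] |.

Definition torsion_moment (R : realType) (g : nat) (k X : R) : R :=
  \sum_(d \in [set d : nat | [/\ (0 < d)%N, squarefree d & d%:R < X]])
    (class_torsion g d)%:R `^ k.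

(* Main.v *)
Require Import Defs.
From HB Require Import structures.
From mathcomp Require Import all_boot all_order all_algebra all_field finmap.
From mathcomp Require Import cyclic zify ring lra.
From mathcomp Require Import all_classical all_reals all_analysis.

Set Implicit Arguments.
Unset Strict Implicit.
Unset Printing Implicit Defensive.

Import Order.TTheory GRing.Theory Num.Theory.

Local Open Scope ring_scope.

(* Fix the class group Cl of Q(sqrt(-d)) with d of size D, and let Q be a set of
   primes p <= Z splitting in the field, with a prime ideal P_p above each.  By
   Cauchy-Schwarz applied to the map (C, p) |-> C [P_p] from Cl[g] x Q to Cl,
   h_g |Q|^2 <= |Cl| (|Q| + N), where N counts the pairs p <> q with
   [P_p]^g = [P_q]^g; each of these gives a solution of 4 (p q)^g = x^2 + d y^2
   with y prime to p q.  Reduction theory gives |Cl| << D^(1/2 + eps), and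
   counting x modulo y^2 gives
     sum_d N << Z^2 (Z^g D^(-1/2) + D^(1/2)) D^eps.
   If Z is a fixed power of D, then all but D^eps values of d have about Z split
   primes up to Z: otherwise the m-th moment of sum_p (-d/p) would be too large
   for the dual large sieve, in which the off-diagonal terms are sums of the
   periodic character n |-> (d d'/n), by reciprocity.  Since N > Z for at most
   Z^(-1) sum_d N values of d, taking Z = D^z with z on a fine grid up to
   3 / (2 g + 2) and summing over dyadic D bounds every moment. *)

(** * Quadratic reciprocity *)

Definition signs : seq int := [:: 0; 1; -1].

Lemma signsM : {in signs &, forall a b, a * b \in signs}.
Proof. by move=> a b; rewrite !inE => /or3P[] /eqP-> /or3P[] /eqP->. Qed.

Lemma exprN1_signs n : (-1) ^+ n \in signs.
Proof. by rewrite -signr_odd; case: odd. Qed.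

Definition legendre (p : nat) (a : int) : int :=
  if (a%:~R : 'F_p) == 0 then 0 else
  if (a%:~R : 'F_p) ^+ p./2 == 1 then 1 else -1.

Lemma legendre_signs p a : legendre p a \in signs.
Proof. by rewrite /legendre; case: ifP => // _; case: ifP. Qed.

Lemma odd_prime_half p : prime p -> odd p -> p = (p./2 + p./2).+1 /\ (0 < p./2)%N.
Proof. move=> /prime_gt1; lia. Qed.

Section OddPrime.
Variable p : nat.
Hypotheses (p_prime : prime p) (p_odd : odd p).

Let p_half : p = (p./2 + p./2).+1.
Proof. by have [] := odd_prime_half p_prime p_odd. Qed.

Let half_gt0 : (0 < p./2)%N.
Proof. by have [] := odd_prime_half p_prime p_odd. Qed.

Lemma Fp_intr_eq0 (a : int) : ((a%:~R : 'F_p) == 0) = (p %| a)%Z.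
Proof. by rewrite (dvdz_pcharf (pchar_Fp p_prime)). Qed.

Lemma Fp_natr_eq0 n : ((n%:R : 'F_p) == 0) = (p %| n)%N.
Proof. by rewrite (dvdn_pcharf (pchar_Fp p_prime)). Qed.

Lemma Fp_eqmod (a b : int) : (a = b %[mod p])%Z <-> (a%:~R : 'F_p) = b%:~R.
Proof.
have -> : (a%:~R = b%:~R :> 'F_p) <-> ((a - b)%:~R == 0 :> 'F_p).
  by rewrite intrB subr_eq0; split=> [->|/eqP].
by rewrite Fp_intr_eq0 -eqz_mod_dvd; split=> /eqP.
Qed.

Lemma Fp_fermat (x : 'F_p) : x != 0 -> x ^+ (p./2 + p./2) = 1.
Proof.
move=> x0; apply: (mulfI x0); rewrite mulr1 -exprS -p_half.
by have := expf_card x; rewrite card_Fp.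
Qed.

Lemma Fp_half_power (x : 'F_p) : x != 0 -> x ^+ p./2 = 1 \/ x ^+ p./2 = -1.
Proof.
move=> /Fp_fermat; rewrite addnn -muln2 exprM => /eqP; rewrite sqrf_eq1.
by case/orP => /eqP; [left|right].
Qed.

Lemma Fp_generator :
  exists2 z : 'F_p, z ^+ p./2 = -1 & forall x, x != 0 -> exists k, x = z ^+ k.
Proof.
have [z _ z_prim] : exists2 z : 'F_p, z \in rem 0 (enum 'F_p) & (p./2 + p./2).-primitive_root z.
  apply/hasP/has_prim_root; rewrite ?rem_uniq ?enum_uniq ?addn_gt0 ?half_gt0 //.
    apply/allP => x; rewrite mem_rem_uniq ?enum_uniq // inE => /andP[x0 _].
    by rewrite unity_rootE Fp_fermat.
  by rewrite size_rem ?mem_enum // -cardE card_Fp //; lia.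
exists z => [|x /Fp_fermat]; last by case/(prim_rootP z_prim) => k ->; exists k.
have z0 : z != 0 by rewrite (prim_root_eq0 z_prim); lia.
case: (Fp_half_power z0) => // /eqP; rewrite -(prim_order_dvd z_prim).
by move=> /(dvdn_leq half_gt0); lia.
Qed.

Lemma legendre_Fp a : ((legendre p a)%:~R : 'F_p) = a%:~R ^+ p./2.
Proof.
rewrite /legendre; case: eqP => [->|/eqP a0]; first by rewrite expr0n eqn0Ngt half_gt0.
by case: eqP => [->//|]; case: (Fp_half_power a0) => ->.
Qed.

Lemma signs_Fp_inj : {in signs &, injective (fun a : int => a%:~R : 'F_p)}.
Proof.
move=> a b sa sb /Fp_eqmod /eqP; rewrite eqz_mod_dvd dvdzE => ab.
have : (`|a - b| <= 2)%N by move: sa sb; rewrite !inE => /or3P[] /eqP-> /or3P[] /eqP->.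
case: (posnP `|a - b|) => [|ab0]; first by clear; lia.
by have := dvdn_leq ab0 ab; rewrite absz_nat; lia.
Qed.

Lemma legendreM a b : legendre p (a * b) = legendre p a * legendre p b.
Proof.
apply: signs_Fp_inj; rewrite ?signsM ?legendre_signs //=.
by rewrite intrM !legendre_Fp intrM exprMn.
Qed.

Lemma legendre_mod a b : (a = b %[mod p])%Z -> legendre p a = legendre p b.
Proof. by move/Fp_eqmod=> e; rewrite /legendre e. Qed.

Lemma legendre1 : legendre p 1 = 1.
Proof. by rewrite /legendre oner_eq0 expr1n eqxx. Qed.

Lemma legendre_eq0 a : (legendre p a == 0) = (p %| a)%Z.
Proof. by rewrite /legendre Fp_intr_eq0; case: ifP => //; case: ifP. Qed.

Lemma legendreN1 : legendre p (-1) = (-1) ^+ p./2.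
Proof.
apply: signs_Fp_inj; rewrite ?legendre_signs ?exprN1_signs //=.
by rewrite legendre_Fp rmorphXn.
Qed.

Lemma legendre_nonresidue : exists a : nat, legendre p a = -1.
Proof.
have [z zh _] := Fp_generator; exists z.
by apply: signs_Fp_inj; rewrite ?legendre_signs //= legendre_Fp -[_%:~R]/(_%:R) natr_Zp.
Qed.

Lemma legendre1_square a : legendre p a = 1 -> exists b : nat, (p %| b%:Z ^+ 2 - a)%Z.
Proof.
move=> la; have [z zh gen] := Fp_generator.
have a0 : (a%:~R : 'F_p) != 0 by rewrite Fp_intr_eq0 -legendre_eq0 la.
have [k ak] := gen _ a0; exists (z ^+ k./2 : 'F_p).
rewrite -Fp_intr_eq0 rmorphB rmorphXn /= -[X in X ^+ 2]/(_%:R) natr_Zp subr_eq0 -exprM ak.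
suff -> : (k./2 * 2 = k)%N by [].
have := legendre_Fp a; rewrite la ak -exprM mulnC exprM zh -signr_odd.
case k_odd : (odd k) => N1; last by rewrite muln2 even_halfK ?k_odd.
by have := @signs_Fp_inj 1 (-1) isT isT N1.
Qed.
End OddPrime.

Lemma modn_mul_inj a M : coprime a M ->
  {in [pred i | i < M]%N &, injective (fun i => (a * i) %% M)%N}.
Proof.
move=> co i j; rewrite !inE => iM jM.
wlog ij : i j iM jM / (i <= j)%N => [W|].
  by case: (leqP i j) => [ij|/ltnW ji] e; [exact: W|symmetry; exact: W].
move=> /esym/eqP; rewrite eqn_mod_dvd ?leq_mul2l ?ij ?orbT // -mulnBr.
rewrite Gauss_dvdr 1?coprime_sym //; case: (posnP (j - i)) => [|j_i /(dvdn_leq j_i)]; lia.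
Qed.

Section GaussLemma.
Variables (p a : nat).
Hypotheses (p_prime : prime p) (p_odd : odd p) (p_ndvd_a : ~~ (p %| a)%N).
Let h := p./2.
Let residue j := ((a * j) %% p)%N.
Let fold j := if (residue j <= h)%N then residue j else (p - residue j)%N.

Let p_half : p = (h + h).+1.
Proof. by have [] := odd_prime_half p_prime p_odd. Qed.

Let fold_range j : (0 < j <= h)%N -> (0 < fold j <= h)%N.
Proof.
move=> /andP[j0 jh]; have res_lt : (residue j < p)%N by rewrite ltn_mod prime_gt0.
have res_gt0 : (0 < residue j)%N.
  rewrite lt0n -/(dvdn p (a * j)) Euclid_dvdM // (negPf p_ndvd_a) /=.
  by apply/negP => /(dvdn_leq j0); lia.
by rewrite /fold; case: ifP; lia.
Qed.

Let fold_inj : {in [pred j | 0 < j <= h]%N &, injective fold}.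
Proof.
move=> i j /andP[_ ih] /andP[_ jh] eq_fold.
have res_lt k : (residue k < p)%N by rewrite ltn_mod prime_gt0.
have [eq_res|eq_sum] : residue i = residue j \/ (residue i + residue j = p)%N.
- by move: eq_fold (res_lt i) (res_lt j); rewrite /fold; case: ifP => ?; case: ifP => ? ?; lia.
- have co : coprime a p by rewrite coprime_sym prime_coprime.
  by apply: (modn_mul_inj co) => //; rewrite inE; lia.
have : (p %| a * (i + j))%N by rewrite mulnDr /dvdn -modnDm -/(residue i) -/(residue j) eq_sum modnn.
by rewrite Euclid_dvdM // (negPf p_ndvd_a) => /dvdn_leq; lia.
Qed.

Let fold_perm : perm_eq (map fold (index_iota 1 h.+1)) (index_iota 1 h.+1).
Proof.
have fold_uniq : uniq (map fold (index_iota 1 h.+1)).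
  rewrite map_inj_in_uniq ?iota_uniq // => i j; rewrite !mem_index_iota !ltnS.
  exact: fold_inj.
have fold_sub : {subset map fold (index_iota 1 h.+1) <= index_iota 1 h.+1}.
  by move=> x /mapP[j]; rewrite mem_index_iota ltnS => /fold_range + ->; rewrite mem_index_iota.
by apply: uniq_perm; rewrite ?iota_uniq //; have [] := uniq_min_size fold_uniq fold_sub; rewrite ?size_map.
Qed.

Let Fp_fold j : ((a * j)%N%:R : 'F_p) = (-1) ^+ (residue j + fold j) * (fold j)%:R.
Proof.
have res_le : (residue j <= p)%N by rewrite ltnW // ltn_mod prime_gt0.
rewrite -(Fp_nat_mod p_prime) -/(residue j) /fold; case: ifP => _.
  by rewrite addnn -signr_odd odd_double mul1r.
by rewrite subnKC // -signr_odd p_odd expr1 natrB // pchar_Fp_0 // sub0r mulN1r opprK.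
Qed.

Let odd_sum_fold :
  odd (\sum_(1 <= j < h.+1) (residue j + fold j)) =
  odd (a.+1 * 'C(h.+1, 2) + \sum_(1 <= j < h.+1) (a * j) %/ p).
Proof.
have sumE : (\sum_(1 <= j < h.+1) j = 'C(h.+1, 2))%N by rewrite -bin2_sum [RHS]big_ltn.
have sum_fold : (\sum_(1 <= j < h.+1) fold j = 'C(h.+1, 2))%N.
  by rewrite -sumE -[RHS](perm_big _ fold_perm) /= big_map.
have sum_div : (a * 'C(h.+1, 2) = p * (\sum_(1 <= j < h.+1) (a * j) %/ p) + \sum_(1 <= j < h.+1) residue j)%N.
  rewrite -sumE !big_distrr /= -big_split /=; apply: eq_bigr => j _.
  by rewrite {1}(divn_eq (a * j) p) mulnC.
move: 'C(h.+1, 2) sum_fold sum_div {sumE} => c sum_fold sum_div.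
rewrite big_split /= sum_fold mulSn !oddD sum_div oddD (oddM p) p_odd /=.
by case: odd; case: odd; case: odd.
Qed.

(* Gauss's lemma, with the number of sign changes read off modulo 2. *)
Lemma legendre_gauss :
  legendre p a = (-1) ^+ (a.+1 * 'C(h.+1, 2) + \sum_(1 <= j < h.+1) (a * j) %/ p)%N.
Proof.
apply: (signs_Fp_inj p_prime); rewrite ?legendre_signs ?exprN1_signs //= legendre_Fp // rmorphXn /=.
rewrite -[X in _ = X ^+ _]/(-1 : 'F_p) -signr_odd -odd_sum_fold signr_odd.
set F := \prod_(1 <= j < h.+1) (j%:R : 'F_p).
have F0 : F != 0.
  rewrite prodf_seq_neq0; apply/allP => j; rewrite mem_index_iota => /andP[j0 jh] /=.
  by rewrite Fp_natr_eq0 //; apply/negP => /(dvdn_leq j0); lia.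
apply: (mulIf F0); transitivity (\prod_(1 <= j < h.+1) ((a * j)%N%:R : 'F_p)).
  under eq_bigr do rewrite natrM.
  by rewrite big_split /= prodr_const_nat subn1.
under eq_bigr do rewrite Fp_fold.
rewrite big_split /= -expr_sum; congr (_ * _).
by rewrite /F -[RHS](perm_big _ fold_perm) /= big_map.
Qed.

Lemma legendre_gauss_odd : odd a ->
  legendre p a = (-1) ^+ (\sum_(1 <= j < h.+1) (a * j) %/ p)%N.
Proof. by move=> a_odd; rewrite legendre_gauss exprD -signr_odd oddM oddS a_odd mul1r. Qed.
End GaussLemma.

Lemma legendre2 p : prime p -> odd p -> legendre p 2 = (-1) ^+ 'C(p./2.+1, 2).
Proof.
move=> p_prime p_odd; have [_ half_gt0] := odd_prime_half p_prime p_odd.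
rewrite (legendre_gauss p_prime p_odd (a := 2)); last by apply/negP => /dvdn_leq; lia.
rewrite [X in (_ + X)%N]big1_seq => [|j]; last first.
  by rewrite mem_index_iota => /andP[_ ?]; rewrite divn_small //; lia.
by rewrite addn0 -signr_odd oddM /= signr_odd.
Qed.

Lemma sum_leq_count m n : (m <= n)%N -> (\sum_(1 <= j < n.+1) (j <= m) = m)%N.
Proof.
move=> mn; transitivity (\sum_(1 <= j < m.+1) 1)%N; last by rewrite sum_nat_const_nat subn1 muln1.
by rewrite [RHS](big_nat_widen _ _ n.+1) // [RHS]big_mkcond; apply: eq_bigr => j _; rewrite ltnS; case: leqP.
Qed.

Lemma mul_neq_half p q i j : prime p -> prime q -> p != q -> (0 < i <= q./2)%N ->
  (j * q != i * p)%N.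
Proof.
move=> p_prime q_prime pq /andP[i0 iq]; apply/eqP => e; have : (q %| i * p)%N by rewrite -e dvdn_mull.
rewrite Euclid_dvdM // (dvdn_prime2 q_prime p_prime) eq_sym (negPf pq) orbF => /(dvdn_leq i0).
by have := prime_gt1 q_prime; lia.
Qed.

Lemma divn_lattice_count p q i : prime p -> odd p -> prime q -> odd q -> p != q ->
  (0 < i <= q./2)%N -> ((p * i) %/ q = \sum_(1 <= j < (p./2).+1) (j * q < i * p))%N.
Proof.
move=> p_prime p_odd q_prime q_odd pq iq; have q_gt0 := prime_gt0 q_prime.
have le_half : ((p * i) %/ q <= p./2)%N by rewrite -ltnS ltn_divLR //; nia.
rewrite -[LHS](sum_leq_count le_half); apply: eq_big_nat => j _.
by rewrite leq_divRL // leq_eqVlt (mulnC p) (negPf (mul_neq_half j p_prime q_prime pq iq)).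
Qed.

(* Eisenstein: the two sums of quotients in Gauss's lemma count the lattice
   points of the rectangle (p / 2) x (q / 2) below and above its diagonal. *)
Lemma sum_divn_reciprocity p q : prime p -> odd p -> prime q -> odd q -> p != q ->
  (\sum_(1 <= j < (p./2).+1) (q * j) %/ p + \sum_(1 <= i < (q./2).+1) (p * i) %/ q = p./2 * q./2)%N.
Proof.
move=> p_prime p_odd q_prime q_odd pq; have qp : q != p by rewrite eq_sym.
under eq_big_nat => j jp do rewrite divn_lattice_count //.
rewrite exchange_big /= -big_split /=.
transitivity (\sum_(1 <= i < (q./2).+1) p./2)%N; last by rewrite sum_nat_const_nat subn1 mulnC.
apply: eq_big_nat => i iq.
rewrite divn_lattice_count // -big_split /=.
transitivity (\sum_(1 <= j < (p./2).+1) 1)%N; last by rewrite sum_nat_const_nat subn1 muln1.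
apply: eq_bigr => j _; have := mul_neq_half j p_prime q_prime pq iq.
by case: ltngtP.
Qed.

Lemma quadratic_reciprocity p q : prime p -> odd p -> prime q -> odd q -> p != q ->
  legendre p q = legendre q p * (-1) ^+ (p./2 * q./2).
Proof.
move=> p_prime p_odd q_prime q_odd pq; have qp : q != p by rewrite eq_sym.
rewrite !legendre_gauss_odd ?dvdn_prime2 // -(sum_divn_reciprocity p_prime p_odd q_prime q_odd pq).
by rewrite exprD mulrCA -expr2 sqrr_sign mulr1.
Qed.

(** * The quadratic characters n |-> (-d/n) *)

Lemma modn_eq_dvd k M m n : (k %| M)%N -> m = n %[mod M] -> m = n %[mod k].
Proof. by move=> kM mn; rewrite -(modn_dvdm m kM) mn modn_dvdm. Qed.

Definition chi4 (n : nat) : int := [:: 0; 1; 0; -1]`_(n %% 4).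

Definition chi8 (n : nat) : int := [:: 0; 1; 0; -1; 0; -1; 0; 1]`_(n %% 8).

Lemma chi4M m n : chi4 (m * n) = chi4 m * chi4 n.
Proof.
rewrite /chi4 -modnMm; move: (m %% 4)%N (n %% 4)%N (ltn_pmod m (isT : 0 < 4)%N) (ltn_pmod n (isT : 0 < 4)%N).
by do 4?[case=> //]; do 4?[case=> //].
Qed.

Lemma chi8M m n : chi8 (m * n) = chi8 m * chi8 n.
Proof.
rewrite /chi8 -modnMm; move: (m %% 8)%N (n %% 8)%N (ltn_pmod m (isT : 0 < 8)%N) (ltn_pmod n (isT : 0 < 8)%N).
by do 8?[case=> //]; do 8?[case=> //].
Qed.

Lemma chi4_signs n : chi4 n \in signs.
Proof. by rewrite /chi4; move: (n %% 4)%N (ltn_pmod n (isT : 0 < 4)%N); do 4?[case=> //]. Qed.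

Lemma chi8_signs n : chi8 n \in signs.
Proof. by rewrite /chi8; move: (n %% 8)%N (ltn_pmod n (isT : 0 < 8)%N); do 8?[case=> //]. Qed.

Lemma chi4_odd n : odd n -> chi4 n = (-1) ^+ n./2.
Proof.
move=> n_odd; rewrite /chi4 -signr_odd.
have [[-> ->]|[-> ->]] : (n %% 4)%N = 1%N /\ odd n./2 = false \/ (n %% 4)%N = 3%N /\ odd n./2 by lia.
- by [].
- by [].
Qed.

Lemma legendre2_chi8 p : prime p -> odd p -> legendre p 2 = chi8 p.
Proof.
move=> p_prime p_odd; rewrite legendre2 // /chi8 -signr_odd bin2 /= {p_prime}.
have : odd (p %% 8) by lia.
have -> : p./2 = (4 * (p %/ 8) + (p %% 8)./2)%N by lia.
move: (p %/ 8)%N (p %% 8)%N (ltn_pmod p (isT : 0 < 8)%N) => k r.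
case: r => [|[|[|[|[|[|[|[|r]]]]]]]] //= _ _; set binom := (_ * _)./2.
- by have -> : odd binom = false by nia.
- by have -> : odd binom by nia.
- by have -> : odd binom by nia.
- by have -> : odd binom = false by nia.
Qed.

(* For a squarefree d, [quad_char d n] is the Jacobi symbol (-d/n) already
   rewritten by reciprocity, so that its period 8 d is visible and the content
   lies in its value at primes. *)
Definition twisted_legendre (q n : nat) : int :=
  if q == 2%N then chi8 n else legendre q n * chi4 n ^+ q./2.

Definition quad_char (d n : nat) : int := chi4 n * \prod_(q <- primes d) twisted_legendre q n.

Lemma twisted_legendre_signs q n : twisted_legendre q n \in signs.
Proof.
rewrite /twisted_legendre; case: ifP => _; first exact: chi8_signs.
by apply: signsM (legendre_signs _ _) _; elim: q./2 => // k IH; rewrite exprS signsM ?chi4_signs.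
Qed.

Lemma twisted_legendreM q m n : prime q ->
  twisted_legendre q (m * n) = twisted_legendre q m * twisted_legendre q n.
Proof.
move=> q_prime; rewrite /twisted_legendre; case: (even_prime q_prime) => [->|q_odd].
  by rewrite chi8M.
by case: eqP => _; rewrite ?chi8M // PoszM legendreM // chi4M exprMn; ring.
Qed.

Lemma twisted_legendre1 q : twisted_legendre q 1 = 1.
Proof. by rewrite /twisted_legendre; case: ifP => // _; rewrite legendre1 // expr1n. Qed.

Lemma quad_charM d m n : quad_char d (m * n) = quad_char d m * quad_char d n.
Proof.
rewrite /quad_char chi4M mulrACA -big_split /=; congr (_ * _); apply: eq_big_seq => q.
by rewrite mem_primes => /andP[q_prime _]; apply: twisted_legendreM.
Qed.

Lemma quad_char1 d : quad_char d 1 = 1.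
Proof.
by rewrite /quad_char mul1r big1 // => q _; apply: twisted_legendre1.
Qed.

Lemma quad_char_signs d n : quad_char d n \in signs.
Proof.
apply: signsM (chi4_signs n) _; apply: (big_ind (fun x => x \in signs)) => // [|q _].
  exact: signsM.
exact: twisted_legendre_signs.
Qed.

Definition conductor (q : nat) : nat := if q == 2%N then 8%N else q.

Lemma twisted_legendre_mod q m n : prime q -> m = n %[mod 4] -> m = n %[mod conductor q] ->
  twisted_legendre q m = twisted_legendre q n.
Proof.
move=> q_prime; rewrite /conductor /twisted_legendre /chi4 => ->.
case: ifP => _ mn; first by rewrite /chi8 mn.
by congr (_ * _); apply: legendre_mod => //; rewrite !modz_nat mn.
Qed.

Lemma quad_char_mod d m n : m = n %[mod 8 * d] -> quad_char d m = quad_char d n.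
Proof.
move=> mn; have mn4 : m = n %[mod 4] by apply: modn_eq_dvd mn; rewrite dvdn_mulr.
rewrite /quad_char; congr (_ * _); first by rewrite /chi4 mn4.
apply: eq_big_seq => q; rewrite mem_primes => /and3P[q_prime _ qd].
apply: twisted_legendre_mod => //; apply: modn_eq_dvd mn; rewrite /conductor.
by case: ifP => _; [rewrite dvdn_mulr|rewrite dvdn_mull].
Qed.

Lemma squarefree_gt0 d : squarefree d -> (0 < d)%N.
Proof. by case: d => // /(_ 2%N (dvdn0 _)). Qed.

Lemma squarefree_prod_primes d : squarefree d -> d = (\prod_(q <- primes d) q)%N.
Proof.
move=> sqf; have d_gt0 := squarefree_gt0 sqf; rewrite {1}(prod_prime_decomp d_gt0) prime_decompE big_map /=.
apply: eq_big_seq => q qd; have log_gt0 : (0 < logn q d)%N by rewrite logn_gt0.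
suff : (logn q d <= 1)%N by case: (logn q d) log_gt0 => [|[|]].
rewrite leqNgt; apply/negP => log_gt1; move: qd; rewrite mem_primes => /andP[q_prime _].
have q1 : q = 1%N by apply: sqf; rewrite pfactor_dvdn.
by rewrite q1 in q_prime.
Qed.

Lemma squarefree_eq_primes d e : squarefree d -> squarefree e -> primes d =i primes e -> d = e.
Proof.
move=> sqd sqe de; rewrite (squarefree_prod_primes sqd) (squarefree_prod_primes sqe).
by apply: perm_big; apply: uniq_perm; rewrite ?primes_uniq.
Qed.

Lemma quad_char_prime d p : squarefree d -> prime p -> odd p ->
  quad_char d p = legendre p (- d%:Z).
Proof.
move=> sqf p_prime p_odd; rewrite -mulN1r legendreM // legendreN1 // /quad_char chi4_odd //.
congr (_ * _); rewrite {2}(squarefree_prod_primes sqf) (big_morph _ PoszM (erefl 1%:Z)).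
rewrite (big_morph (legendre p) (legendreM p_prime p_odd) (legendre1 p)).
apply: eq_big_seq => q; rewrite mem_primes => /andP[q_prime _].
rewrite /twisted_legendre chi4_odd // -exprM; case: eqP => [->|/eqP q2].
  by rewrite legendre2_chi8.
have q_odd : odd q by case: (even_prime q_prime) q2 => [->|].
case: (eqVneq p q) => [<-|pq]; last by rewrite (quadratic_reciprocity p_prime p_odd q_prime q_odd pq).
by have /eqP -> : legendre p p == 0; rewrite ?legendre_eq0 ?mul0r.
Qed.

(* p splits in Q(sqrt(-d)), b being a square root of -d modulo p. *)
Definition splits_with (d p b : nat) : Prop :=
  [/\ prime p, odd p, ~~ (p %| d)%N & (p %| b ^ 2 + d)%N].

Lemma quad_char_splits d p : squarefree d -> prime p -> odd p -> quad_char d p = 1 ->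
  exists b, splits_with d p b.
Proof.
move=> sqf p_prime p_odd; rewrite quad_char_prime // => dp1.
have p_d : ~~ (p %| - d%:Z)%Z by rewrite -legendre_eq0 // dp1.
have [b] := legendre1_square p_prime p_odd dp1.
by rewrite dvdzE abszN in p_d; rewrite opprK dvdzE => p_b2d; exists b.
Qed.

Lemma splits_with_coprime d p b : splits_with d p b -> coprime p (2 * b).
Proof.
case=> p_prime p_odd p_d p_b2d; rewrite prime_coprime // Euclid_dvdM // negb_or.
rewrite dvdn_prime2 //; apply/andP; split; first by apply: contraL p_odd => /eqP ->.
by apply: contra p_d => p_b; rewrite -(dvdn_addr _ (_ : p %| b ^ 2)%N) // dvdn_exp.
Qed.

Lemma quad_char_ramified d p : squarefree d -> prime p -> odd p -> quad_char d p = 0 -> (p %| d)%N.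
Proof.
move=> sqf p_prime p_odd; rewrite quad_char_prime // => /eqP; rewrite legendre_eq0 //.
by rewrite dvdzE abszN.
Qed.

Lemma twisted_legendre_eq1 q n : prime q -> n = 1 %[mod 4] -> n = 1 %[mod conductor q] ->
  twisted_legendre q n = 1.
Proof. by move=> q_prime n4 nq; rewrite (twisted_legendre_mod q_prime n4 nq) twisted_legendre1. Qed.

Lemma twisted_legendre_nontrivial q : prime q -> exists2 a, coprime a q &
  forall n, n = a %[mod conductor q] -> (odd q -> n = 1 %[mod 4]) ->
    n = 1 %[mod 4] /\ twisted_legendre q n = -1.
Proof.
move=> q_prime; rewrite /conductor /twisted_legendre; case: eqP => [->|/eqP q2].
  by exists 5%N => // n n5 _; split; [lia|rewrite /chi8 n5].
have q_odd : odd q by case: (even_prime q_prime) q2 => [->|].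
have [a la] := legendre_nonresidue q_prime q_odd; exists a.
  by rewrite coprime_sym prime_coprime //; have := legendre_eq0 q_prime a; rewrite la dvdzE => <-.
move=> n na /(_ q_odd) n4; split=> //; rewrite (legendre_mod q_prime (b := a)) ?modz_nat ?na // la.
by rewrite /chi4 n4 expr1n mulr1.
Qed.

Lemma dvdn_part_coprime k N q : (0 < N)%N -> (k %| N)%N -> coprime k q -> (k %| N`_q^')%N.
Proof.
move=> N_gt0 kN kq; rewrite -(@Gauss_dvdr k N`_q) ?partnC //.
by rewrite p_part coprimeXr.
Qed.

(* The witness is 1 modulo everything except a prime q that divides exactly one
   of the two numbers, where it makes the symbol -1. *)
Lemma quad_char_separated d e q : (0 < d)%N -> (0 < e)%N -> prime q -> (q %| d)%N -> ~~ (q %| e)%N ->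
  exists2 n, coprime n (8 * d * e) & quad_char d n * quad_char e n = -1.
Proof.
move=> d_gt0 e_gt0 q_prime qd qe; set N := (8 * d * e)%N.
have N_gt0 : (0 < N)%N by rewrite !muln_gt0 d_gt0 e_gt0.
have [a a_q aP] := twisted_legendre_nontrivial q_prime.
have cond_dvd r : prime r -> (r %| d * e)%N -> r != q -> (conductor r %| N`_q^')%N.
  move=> r_prime r_de rq; apply: dvdn_part_coprime => //.
    by rewrite /conductor /N -mulnA; case: ifP => _; [rewrite dvdn_mulr|rewrite dvdn_mull].
  rewrite /conductor; case: eqP => [r2|_]; last by rewrite prime_coprime // dvdn_prime2.
  by rewrite -[8%N]/(2 ^ 3)%N coprimeXl // -r2 prime_coprime // dvdn_prime2.
have co : coprime N`_q^' (conductor q).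
  have co_q : coprime N`_q^' q by rewrite coprime_sym (pnat_coprime (pnat_id q_prime)) // part_pnat.
  by rewrite /conductor; case: eqP => // q2; rewrite -[8%N]/(2 ^ 3)%N coprimeXr // -q2.
pose n := chinese N`_q^' (conductor q) 1 a.
have n1 : n = 1 %[mod N`_q^'] by apply: chinese_modl.
have na : n = a %[mod conductor q] by apply: chinese_modr.
have n4q : odd q -> n = 1 %[mod 4].
  move=> q_odd; apply: modn_eq_dvd n1; apply: dvdn_part_coprime => //.
    by rewrite /N -mulnA dvdn_mulr.
  by rewrite -[4%N]/(2 ^ 2)%N coprimeXl // coprime2n.
have [n4 nN1] := aP n na n4q.
have char1 r : prime r -> (r %| d * e)%N -> r != q -> twisted_legendre r n = 1.
  by move=> r_prime r_de rq; apply: twisted_legendre_eq1 => //; apply: modn_eq_dvd n1; apply: cond_dvd.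
exists n.
  rewrite -(@partnC q N N_gt0) coprimeMr p_part coprimeXr //=.
    by rewrite -coprime_modl n1 coprime_modl coprime1n.
  have q_cond : (q %| conductor q)%N by rewrite /conductor; case: eqP => // ->.
  by rewrite -coprime_modl (modn_eq_dvd q_cond na) coprime_modl.
have chi4n : chi4 n = 1 by rewrite /chi4 n4.
rewrite /quad_char chi4n !mul1r (bigD1_seq q) ?primes_uniq ?mem_primes ?q_prime ?d_gt0 //= nN1.
rewrite big_seq_cond big1 => [|r /andP[]].
  rewrite mulr1 big1_seq ?mulr1 // => r; rewrite mem_primes => /andP[_ /and3P[r_prime _ re]].
  by apply: char1; rewrite ?dvdn_mull //; apply: contraNneq qe => <-.
by rewrite mem_primes => /and3P[r_prime _ rd] rq; rewrite char1 ?dvdn_mulr.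
Qed.

Section PeriodicMultiplicative.
Variables (R : numDomainType) (psi : nat -> R) (M n0 : nat).
Hypotheses (M_gt0 : (0 < M)%N) (psiM : forall m n, psi (m * n)%N = psi m * psi n).
Hypotheses (psi_mod : forall m n, m = n %[mod M] -> psi m = psi n).
Hypotheses (n0_M : coprime n0 M) (psi_n0 : psi n0 != 1).

Lemma sum_period_eq0 : \sum_(0 <= n < M) psi n = 0.
Proof.
have ltM i : ((n0 * i) %% M < M)%N by rewrite ltn_mod.
pose f (i : 'I_M) := Ordinal (ltM i).
have f_inj : injective f.
  move=> i j /(congr1 val) /= e; apply: val_inj; exact: (modn_mul_inj n0_M (ltn_ord i) (ltn_ord j)).
have : \sum_(i < M) psi i = psi n0 * \sum_(i < M) psi i.
  rewrite {1}(reindex_inj f_inj) /= mulr_sumr; apply: eq_bigr => i _.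
  by rewrite -psiM; apply: psi_mod; rewrite modn_mod.
rewrite big_mkord => /eqP; rewrite -subr_eq0 -{1}[X in X - _]mul1r -mulrBl mulf_eq0.
by rewrite subr_eq0 eq_sym (negPf psi_n0) => /eqP.
Qed.

Lemma norm_sum_periodic_le N : (forall n, `|psi n| <= 1) -> `|\sum_(0 <= n < N) psi n| <= M%:R.
Proof.
move=> psi_le1; have shift a b : \sum_(a * M <= n < a * M + b) psi n = \sum_(0 <= n < b) psi n.
  rewrite -{1}[(a * M)%N]add0n big_addn addKn; apply: eq_bigr => n _.
  by apply: psi_mod; rewrite addnC modnMDl.
have full q : \sum_(0 <= n < q * M) psi n = 0.
  elim: q => [|q IH]; first by rewrite mul0n big_geq.
  rewrite (@big_cat_nat _ _ _ (q * M)) ?leq_mul2r ?leqnSn ?orbT //= IH add0r.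
  by rewrite mulSnr shift sum_period_eq0.
rewrite (divn_eq N M) (@big_cat_nat _ _ _ (N %/ M * M)) ?leq_addr //= full add0r shift.
apply: le_trans (ler_norm_sum _ _ _) _; apply: le_trans (ler_sum _ (fun n _ => psi_le1 n)) _.
by rewrite sumr_const_nat subn0 ler_nat ltnW // ltn_mod.
Qed.
End PeriodicMultiplicative.

Lemma quad_char_correlation d e N : squarefree d -> squarefree e -> d != e ->
  \sum_(0 <= n < N) (quad_char d n * quad_char e n) <= (8 * d * e)%:R.
Proof.
move=> sqd sqe; have [d_gt0 e_gt0] := (squarefree_gt0 sqd, squarefree_gt0 sqe).
case: (pselect (exists q, prime q /\ (q %| d)%N != (q %| e)%N)) => [[q [q_prime qde]] _|same /eqP[]].
  have [n n_co n_sep] : exists2 n, coprime n (8 * d * e) & quad_char d n * quad_char e n = -1.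
    case qd : (q %| d)%N qde => qe; first by apply: quad_char_separated qd _.
    case: (@quad_char_separated e d q) => //; rewrite ?qd //; first by case: (q %| e)%N qe.
    by move=> n; rewrite mulrC [in X in _ -> X]mulnAC; exists n.
  apply: le_trans (ler_norm _) (norm_sum_periodic_le _ _ _ n_co _ _ _) => //.
  - by rewrite !muln_gt0 d_gt0 e_gt0.
  - by move=> a b; rewrite !quad_charM mulrACA.
  - move=> a b ab; congr (_ * _); apply: quad_char_mod; apply: modn_eq_dvd ab.
      by rewrite dvdn_mulr.
    by rewrite mulnAC dvdn_mulr.
  - by rewrite n_sep.
  - move=> a; move: (quad_char_signs d a) (quad_char_signs e a).
    by rewrite !inE => /or3P[] /eqP-> /or3P[] /eqP->.
apply: squarefree_eq_primes => // q; rewrite !mem_primes d_gt0 e_gt0.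
by case q_prime : (prime q) => //=; apply: contrapT => /eqP qde; case: same; exists q.
Qed.

(** * Finite sums and counting *)

Lemma leq_sum_seq_const (T : eqType) (s : seq T) (F : T -> nat) c :
  {in s, forall x, F x <= c}%N -> (\sum_(x <- s) F x <= size s * c)%N.
Proof.
move=> Fc; rewrite big_seq; apply: leq_trans (@leq_sum _ _ _ _ (fun=> c) Fc) _.
by rewrite -big_seq big_const_seq count_predT iter_addn_0 mulnC.
Qed.

Lemma ler_sum_seq_const (R : numDomainType) (T : eqType) (s : seq T) (F : T -> R) c :
  {in s, forall x, F x <= c} -> \sum_(x <- s) F x <= (size s)%:R * c.
Proof.
move=> Fc; rewrite big_seq; apply: le_trans (@ler_sum _ _ _ _ _ (fun=> c) Fc) _.
by rewrite -big_seq big_const_seq count_predT iter_addr_0 mulr_natl.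
Qed.

Lemma sqr_sum_le (R : realDomainType) (T : Type) (s : seq T) (F : T -> R) :
  (\sum_(x <- s) F x) ^+ 2 <= (size s)%:R * \sum_(x <- s) F x ^+ 2.
Proof.
elim: s => [|x s IH]; first by rewrite big_nil expr0n mul0r.
have cross : F x * (\sum_(y <- s) F y) *+ 2 <= (size s)%:R * F x ^+ 2 + \sum_(y <- s) F y ^+ 2.
  have -> : (size s)%:R * F x ^+ 2 = \sum_(y <- s) F x ^+ 2.
    by rewrite big_const_seq count_predT iter_addr_0 mulr_natl.
  rewrite -big_split mulr_sumr -sumrMnl; apply: ler_sum => y _.
  by have := sqr_ge0 (F x - F y); rewrite /= sqrrB; lra.
by rewrite !big_cons /= sqrrD -natr1; lra.
Qed.

Lemma sqr_sum_leq (T : Type) (s : seq T) (F : T -> nat) :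
  ((\sum_(x <- s) F x) ^ 2 <= size s * \sum_(x <- s) F x ^ 2)%N.
Proof.
rewrite -(ler_nat int) natrX natrM !natr_sum; under [in leRHS]eq_bigr do rewrite natrX.
exact: sqr_sum_le.
Qed.

Lemma sum_bool_count (T : Type) (s : seq T) (a : pred T) : (\sum_(x <- s) a x = count a s)%N.
Proof. by rewrite -sum1_count [RHS]big_mkcond; apply: eq_bigr => x _; case: (a x). Qed.

Lemma size_fibers_le (T U : eqType) (s : seq T) (r : seq U) (f : T -> U) :
  {in s, forall x, f x \in r} -> (size s <= \sum_(u <- r) size [seq x <- s | f x == u])%N.
Proof.
move=> fr; under eq_bigr do rewrite size_filter -sum_bool_count.
rewrite exchange_big /= -sum1_size big_seq [leqRHS]big_seq; apply: leq_sum => x xs.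
by rewrite sum_bool_count -has_count; apply/hasP; exists (f x); rewrite ?fr /=.
Qed.

Lemma size_sqr_le_collisions (T U : eqType) (s : seq T) (r : seq U) (f : T -> U) :
  {in s, forall x, f x \in r} -> (size s ^ 2 <= size r * \sum_(x <- s) count (fun y => f x == f y) s)%N.
Proof.
move=> fr; have ur : {in s, forall x, f x \in undup r} by move=> x /fr; rewrite mem_undup.
have one_block x : x \in s -> (\sum_(u <- undup r) (f x == u) = 1)%N.
  move=> /ur fx; under eq_bigr do rewrite eq_sym.
  by rewrite sum_bool_count (count_uniq_mem (f x)) ?undup_uniq ?fx.
pose c u := count (fun x => f x == u) s.
have -> : size s = (\sum_(u <- undup r) c u)%N.
  rewrite /c; under eq_bigr do rewrite -sum_bool_count.
  by rewrite exchange_big /= -sum1_size; apply: eq_big_seq => x /one_block ->.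
have -> : (\sum_(x <- s) count (fun y => f x == f y) s = \sum_(u <- undup r) c u ^ 2)%N.
  transitivity (\sum_(x <- s) \sum_(u <- undup r) (f x == u) * c u)%N.
    apply: eq_big_seq => x /ur fx; rewrite (bigD1_seq (f x)) ?undup_uniq //= eqxx mul1n big1.
      by rewrite addn0; apply: eq_count => y; rewrite eq_sym.
    by move=> u; rewrite eq_sym => /negPf ->.
  rewrite exchange_big; apply: eq_bigr => u _.
  by rewrite -big_distrl /= sum_bool_count -/(c u) mulnn.
by apply: leq_trans (sqr_sum_leq _ _) _; rewrite leq_mul2r size_undup orbT.
Qed.

Lemma product_collision_bound (A B U : eqType) (s : seq A) (t : seq B) (r : seq U)
    (f : A -> B -> U) (R : rel B) :
  uniq s -> {in s & t, forall x y, f x y \in r} ->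
  {in t, forall y, {in s &, injective (f^~ y)}} ->
  {in s &, forall x x', {in t &, forall y y', f x y = f x' y' -> R y y'}} ->
  (size s * size t ^ 2 <= size r * \sum_(y <- t) count (R y) t)%N.
Proof.
move=> s_uniq fr f_inj fR; case: (posnP (size s)) => [->//|s_gt0].
pose h (z : A * B) := f z.1 z.2.
have hr : {in [seq (x, y) | x <- s, y <- t], forall z, h z \in r}.
  by move=> _ /allpairsP[[x y] [/= xs yt ->]]; apply: fr.
have := size_sqr_le_collisions hr; rewrite size_allpairs => sqr_le.
rewrite -(leq_pmul2l s_gt0) mulnA mulnn -expnMn; apply: leq_trans sqr_le _.
rewrite mulnCA leq_mul2l; apply/orP; right.
rewrite big_allpairs_dep /=; apply: leq_sum_seq_const => x xs.
rewrite big_seq [leqRHS]big_seq; apply: leq_sum => y yt.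
rewrite -sum_bool_count big_allpairs_dep exchange_big /= -sum_bool_count.
rewrite big_seq [leqRHS]big_seq; apply: leq_sum => y' y't; rewrite /h /= sum_bool_count.
have [/hasP[x' x's /eqP e]|] := boolP (has (fun x' => f x y == f x' y') s); last first.
  by rewrite has_count -leqNgt leqn0 => /eqP ->.
rewrite (fR x x') // (eq_in_count (a2 := pred1 x')) ?count_uniq_mem ?x's // => z zs /=.
by rewrite e; apply/eqP/eqP => [/esym/(f_inj y')|->] //; apply.
Qed.

Lemma exists_min_mem (s : seq nat) x : x \in s -> exists2 a, a \in s & {in s, forall y, a <= y}%N.
Proof. by move=> xs; have [a sa a_min] := ex_minnP (ex_intro _ x xs); exists a. Qed.

(** * A large sieve *)

(* A tuple of primes takes its values among the entries of any other tuple with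
   the same product. *)
Lemma card_prime_tuples_le (m : nat) (P : seq nat) (n : nat) : uniq P -> {in P, forall p, prime p} ->
  (#|[set t : {ffun 'I_m -> 'I_(size P)} | \prod_i tnth (in_tuple P) (t i) == n]| <= m ^ m)%N.
Proof.
move=> P_uniq P_prime; set A := finset _.
case: (set_0Vmem A) => [->|[t0 t0A]]; first by rewrite cards0.
pose C := [set t0 i | i : 'I_m].
have prime_entry i : prime (tnth (in_tuple P) i) by apply/P_prime/mem_tnth.
have AC : A \subset [set t : {ffun 'I_m -> 'I_(size P)} | t \in ffun_on (mem C)].
  apply/fintype.subsetP => t; rewrite !inE in t0A *; move=> /eqP tn; apply/ffun_onP => i.
  have : (tnth (in_tuple P) (t i) %| \prod_i tnth (in_tuple P) (t0 i))%N.
    by rewrite (eqP t0A) -tn (bigD1 i) //= dvdn_mulr.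
  rewrite Euclid_dvd_prod // big_orE => /existsP[j /=]; rewrite dvdn_prime2 // => tij.
  have -> : t i = t0 j by apply/(tuple_uniqP (in_tuple P))/eqP.
  by apply/imsetP; exists j.
have CM : (#|C| <= m)%N by rewrite -[leqRHS]card_ord; apply: leq_imset_card.
apply: leq_trans (subset_leq_card AC) _; rewrite cardsE card_ffun_on card_ord.
by case: (m) CM => // k; rewrite leq_exp2r.
Qed.

Section LargeSieve.
Variables (R : realDomainType) (T : eqType) (psi : T -> nat -> R).
Hypotheses (psi1 : forall d, psi d 1%N = 1) (psiM : forall d m n, psi d (m * n)%N = psi d m * psi d n).
Hypothesis psi_sqr_le1 : forall d n, psi d n ^+ 2 <= 1.
Variables (E : seq T) (B : nat).
Hypothesis E_uniq : uniq E.
Hypothesis psi_correlation : {in E &, forall d e, d != e ->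
  forall N, \sum_(0 <= n < N) psi d n * psi e n <= B%:R}.
Variables (P : seq nat) (Z m : nat).
Hypotheses (P_uniq : uniq P) (P_prime : {in P, forall p, prime p}) (P_le : {in P, forall p, p <= Z}%N).

Let dual n := (\sum_(d <- E) psi d n) ^+ 2.
Let tuple_prod (t : {ffun 'I_m -> 'I_(size P)}) : nat := (\prod_i tnth (in_tuple P) (t i))%N.

Lemma sum_dual_le N : \sum_(0 <= n < N) dual n <= (size E)%:R * (N%:R + (size E)%:R * B%:R).
Proof.
under eq_bigr => n _ do rewrite /dual expr2 mulr_suml; rewrite exchange_big /=.
apply: ler_sum_seq_const => d dE; under eq_bigr do rewrite mulr_sumr.
rewrite exchange_big /= (bigD1_seq d) //=; apply: lerD.
  apply: le_trans (_ : \sum_(0 <= n < N) 1 <= _); last by rewrite sumr_const_nat subn0.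
  by apply: ler_sum => n _; rewrite -expr2.
rewrite big_mkcond /=; apply: ler_sum_seq_const => e eE.
by case: (eqVneq e d) => [_|ed] /=; rewrite ?ler0n // psi_correlation // eq_sym.
Qed.

Lemma sum_tuples_le : \sum_t dual (tuple_prod t) <= (m ^ m)%:R * \sum_(0 <= n < (Z ^ m).+1) dual n.
Proof.
have prod_le t : (tuple_prod t < (Z ^ m).+1)%N.
  rewrite ltnS -[X in (_ <= Z ^ X)%N](card_ord m) -prod_nat_const.
  by apply: leq_prod => i _; apply/P_le/mem_tnth.
rewrite big_mkord mulr_sumr (partition_big (fun t => inord (tuple_prod t) : 'I_(Z ^ m).+1) predT) //=.
apply: ler_sum => n _.
rewrite (eq_bigr (fun=> dual n)) => [|t /eqP <-]; last by rewrite inordK.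
rewrite sumr_const -[leLHS]mulr_natl; apply: ler_wpM2r; first exact: sqr_ge0.
rewrite ler_nat; apply: leq_trans (card_prime_tuples_le m n P_uniq P_prime).
rewrite -cardsE; apply/subset_leq_card/fintype.subsetP => t; rewrite !inE => /eqP <-.
by rewrite /= inordK.
Qed.

Lemma prime_sum_expE d : (\sum_(p <- P) psi d p) ^+ m = \sum_t psi d (tuple_prod t).
Proof.
rewrite big_tnth -[in LHS](card_ord m) -prodr_const bigA_distr_bigA /=.
by apply: eq_bigr => t _; rewrite (big_morph (psi d) (psiM d) (psi1 d)).
Qed.

Lemma moment_sum_le : (\sum_(d <- E) (\sum_(p <- P) psi d p) ^+ m) ^+ 2 <=
  (size P)%:R ^+ m * ((m ^ m)%:R * ((size E)%:R * ((Z ^ m).+1%:R + (size E)%:R * B%:R))).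
Proof.
under eq_bigr do rewrite prime_sum_expE.
rewrite exchange_big /=; apply: le_trans (sqr_sum_le _ _) _.
rewrite -[index_enum _]enumT -cardE card_ffun !card_ord natrX enumT.
apply: ler_wpM2l; first by rewrite exprn_ge0.
by apply: le_trans sum_tuples_le _; apply: ler_wpM2l (sum_dual_le _).
Qed.

(* The lower bound for the prime sums bounds their m-th moment from below by
   [size E * (size P / 2) ^ m], and Cauchy-Schwarz bounds it from above. *)
Lemma large_sieve : (0 < size P)%N -> ~~ odd m ->
  {in E, forall d, (size P)%:R <= 2 * `|\sum_(p <- P) psi d p|} ->
  (size E)%:R * (size P)%:R ^+ m <=
    (4 * m)%:R ^+ m * ((Z ^ m).+1%:R + (size E)%:R * B%:R) :> R.
Proof.
move=> P_gt0 m_even large; have [E0|E_gt0] := posnP (size E).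
  by rewrite E0 !mul0r addr0 mulr_ge0 ?exprn_ge0.
set M := \sum_(d <- E) (\sum_(p <- P) psi d p) ^+ m.
have x_gt0 : 0 < (size E)%:R * (size P)%:R ^+ m :> R by rewrite mulr_gt0 ?exprn_gt0 ?ltr0n.
have lower : (size E)%:R * (size P)%:R ^+ m <= 2 ^+ m * M.
  have -> : (size E)%:R * (size P)%:R ^+ m = \sum_(d <- E) (size P)%:R ^+ m :> R.
    by rewrite big_const_seq count_predT iter_addr_0 mulr_natl.
  rewrite mulr_sumr big_seq [leRHS]big_seq; apply: ler_sum => d /large.
  rewrite -exprMn -[X in _ -> _ <= X](ger0_norm (exprn_even_ge0 _ m_even)) normrX normrM ger0_norm //.
  by move=> Ple; rewrite lerXn2r ?nnegrE ?mulr_ge0.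
have /(le_trans _) := ler_wpM2l (exprn_ge0 m (ler0n R 4)) moment_sum_le; rewrite -/M => upper.
rewrite -(ler_pM2l x_gt0) -expr2.
have -> : (size E)%:R * (size P)%:R ^+ m * ((4 * m)%:R ^+ m * ((Z ^ m).+1%:R + (size E)%:R * B%:R)) =
  4 ^+ m * ((size P)%:R ^+ m * ((m ^ m)%:R * ((size E)%:R * ((Z ^ m).+1%:R + (size E)%:R * B%:R)))) :> R.
  by rewrite natrM exprMn natrX; ring.
apply: upper; rewrite (_ : 4 = 2 ^+ 2) -?exprM 1?mulnC 1?exprM -?exprMn; last by rewrite -natrX.
by rewrite lerXn2r ?nnegrE ?(le_trans (ltW x_gt0)).
Qed.
End LargeSieve.

(** * Powers of a growing parameter *)

Section Growth.
Local Open Scope classical_set_scope.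
Variable R : realType.
Implicit Types (a e x y z B : R) (D n : nat).

Lemma powRD_gt0 x a b : 0 < x -> x `^ (a + b) = x `^ a * x `^ b.
Proof. by move=> x_gt0; rewrite powRD // (gt_eqF x_gt0) implybT. Qed.

Lemma powR_natX x a n : (x `^ a) ^+ n = x `^ (a * n%:R).
Proof. by rewrite powRrM powR_mulrn ?powR_ge0. Qed.

Lemma ler_powRl a x y : 0 <= a -> 0 <= x -> x <= y -> x `^ a <= y `^ a.
Proof. by move=> a0 x0 xy; apply: ge0_ler_powR; rewrite ?nnegrE // (le_trans x0). Qed.

Lemma powR_ge1 x a : 1 <= x -> 0 <= a -> 1 <= x `^ a.
Proof. by move=> x1 a0; rewrite -(powRr0 x) ler_powR. Qed.

Lemma ln_le_powR e x : 0 < e -> 0 < x -> ln x <= e^-1 * x `^ e.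
Proof.
move=> e0 x0; rewrite ler_pdivlMl //; apply: le_trans (_ : 1 + e * ln x <= _).
  by rewrite lerDr.
by rewrite /powR gt_eqF //; apply: expR_ge1Dx.
Qed.

Lemma near_powR_ge z B : 0 < z -> \forall D \near \oo, B <= D%:R `^ z.
Proof.
move=> z0; near=> D; apply: le_trans (ler_norm B) _.
have -> : `|B| = (`|B| `^ z^-1) `^ z by rewrite -powRrM mulVf ?gt_eqF // powRr1.
by apply: ler_powRl; rewrite ?powR_ge0 ?(ltW z0) //; near: D; apply: nbhs_infty_ger.
Unshelve. all: end_near. Qed.

Lemma near_mul_powR_le C a e : 0 < e -> \forall D \near \oo, C * D%:R `^ a <= D%:R `^ (a + e).
Proof.
move=> e0; near=> D; have D_gt0 : 0 < D%:R :> R.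
  by apply: lt_le_trans ltr01 _; near: D; apply: nbhs_infty_ger.
rewrite addrC powRD_gt0 // ler_pM2r ?powR_gt0 //.
by near: D; apply: near_powR_ge.
Unshelve. all: end_near. Qed.
End Growth.

(** * The divisor bound *)

Definition tau (n : nat) : nat := size (divisors n).

Lemma size_add_divisors p k s : size (PrimeDecompAux.add_divisors (p, k) s) = (k.+1 * size s)%N.
Proof.
rewrite /PrimeDecompAux.add_divisors; elim: k => [|k IH]; first by rewrite mul1n.
by rewrite iterS size_merge size_cat size_map IH addnC -mulSn.
Qed.

Lemma tau_prod n : tau n = (\prod_(p <- primes n) (logn p n).+1)%N.
Proof.
transitivity (\prod_(f <- prime_decomp n) f.2.+1)%N.
  rewrite /tau /divisors; elim: (prime_decomp n) => [|[p k] s IH] /=; first by rewrite big_nil.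
  by rewrite big_cons size_add_divisors IH.
by rewrite prime_decompE big_map.
Qed.

Section DivisorBound.
Local Open Scope classical_set_scope.
Variable R : realType.
Implicit Types (e A : R).

Lemma natrS_le_expn_powR e p a : 0 < e -> (1 < p)%N ->
  a.+1%:R <= (1 + (e * ln 2)^-1) * (p ^ a)%:R `^ e :> R.
Proof.
move=> e0 p_gt1; have ln2 : 0 < ln (2 : R) by rewrite ln_gt0 // ltr1n.
have eln2 : 0 < e * ln 2 by rewrite mulr_gt0.
have K_gt0 : 0 < 1 + (e * ln 2)^-1 by rewrite ltr_wpDr // invr_ge0 ltW.
apply: (@le_trans _ _ ((1 + (e * ln 2)^-1) * (1 + e * ln 2 * a%:R))).
  rewrite mulrDl mul1r mulrDr mulr1 mulrA mulVf ?gt_eqF // mul1r -natr1.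
  have : 0 <= e * ln 2 * a%:R by rewrite mulr_ge0 // ltW.
  by have : 0 <= (e * ln (2 : R))^-1 by [rewrite invr_ge0 ltW]; lra.
rewrite ler_pM2l //; apply: (@le_trans _ _ ((2 ^ a)%:R `^ e)).
  rewrite natrX -powR_mulrn // -powRrM /powR pnatr_eq0 /=.
  by rewrite [e * ln 2 * _]mulrAC [e * _]mulrC expR_ge1Dx.
apply: ler_powRl; rewrite ?(ltW e0) // ler_nat.
by case: a => // a; rewrite leq_exp2r.
Qed.

Lemma natrS_le_large_expn_powR e p a : 2 <= p%:R `^ e -> a.+1%:R <= (p ^ a)%:R `^ e :> R.
Proof.
move=> pe; apply: (@le_trans _ _ (2 ^+ a)); first by rewrite -natrX ler_nat ltn_expl.
rewrite natrX -powR_mulrn // -powRrM mulrC powRrM powR_mulrn ?powR_ge0 //.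
by apply: lerXn2r; rewrite ?nnegrE ?powR_ge0.
Qed.

(* Each factor [logn p n + 1] of [tau n] is at most [(p ^ logn p n) `^ e], up to
   a constant that is only needed for the boundedly many small primes p. *)
Lemma tau_le_powR e : 0 < e -> exists2 C : R, 0 < C &
  forall n, (0 < n)%N -> (tau n)%:R <= C * n%:R `^ e.
Proof.
move=> e0; pose K : R := 1 + (e * ln 2)^-1.
have K_ge1 : 1 <= K by rewrite lerDl invr_ge0 mulr_ge0 ?(ltW e0) // ln_ge0 // ler1n.
have [B _ B_large] := near_powR_ge 2 e0.
exists (K ^+ B) => [|n n_gt0]; first by rewrite exprn_gt0 // (lt_le_trans ltr01).
have -> : n%:R `^ e = \prod_(p <- primes n) (p ^ logn p n)%:R `^ e :> R.
  rewrite {1}(prod_prime_decomp n_gt0) prime_decompE big_map /= natr_prod.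
  elim: (primes n) => [|p s IH]; first by rewrite !big_nil powR1.
  by rewrite !big_cons powRM ?IH // prodr_ge0.
rewrite tau_prod natr_prod; pose c p : R := if (p < B)%N then K else 1.
apply: (@le_trans _ _ (\prod_(p <- primes n) (c p * (p ^ logn p n)%:R `^ e))).
  rewrite big_seq [leRHS]big_seq; apply: ler_prod => p; rewrite mem_primes ler0n /=.
  case/and3P => p_prime _ _; rewrite /c; case: ltnP => [_|Bp].
    by apply: natrS_le_expn_powR; rewrite ?prime_gt1.
  by rewrite mul1r; apply: natrS_le_large_expn_powR; apply: B_large.
rewrite big_split; apply: ler_wpM2r; first by apply: prodr_ge0 => p _; apply: powR_ge0.
rewrite -big_mkcond /= big_const_seq -Monoid.iteropE.
have count_le : (count (fun p => p < B)%N (primes n) <= B)%N.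
  rewrite -size_filter -[leqRHS](size_iota 0); apply: uniq_leq_size.
    by rewrite filter_uniq ?primes_uniq.
  by move=> p; rewrite mem_filter mem_iota => /andP[].
by rewrite -[leLHS]/(K ^+ _) ler_weXn2l.
Qed.

Lemma near_tau_le A e : 0 < A -> 0 < e -> \forall D \near \oo,
  forall n, (0 < n)%N -> n%:R <= D%:R `^ A -> (tau n)%:R <= D%:R `^ e :> R.
Proof.
move=> A0 e0; have e'0 : 0 < e / 2 / A by rewrite !divr_gt0.
have [C C0 tau_C] := tau_le_powR e'0.
near=> D => n n_gt0 nD; apply: le_trans (tau_C n n_gt0) _.
apply: (@le_trans _ _ (C * D%:R `^ (e / 2))); last first.
  by rewrite {2}[e]splitr; near: D; apply: near_mul_powR_le; rewrite divr_gt0.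
rewrite ler_pM2l //; apply: le_trans (ler_powRl (ltW e'0) _ nD) _ => //.
by rewrite -powRrM mulrC divfK // gt_eqF.
Unshelve. all: end_near. Qed.
End DivisorBound.

(** * Chebyshev's lower bound for the number of primes *)

Lemma central_bin_ge n : (2 ^ n <= 'C(n + n, n))%N.
Proof.
elim: n => // n IH; rewrite addSn addnS binS.
have -> : 'C((n + n).+1, n.+1) = 'C((n + n).+1, n).
  by rewrite -bin_sub ?ltnS ?leq_addr // subSS addKn.
have : ('C(n + n, n) <= 'C((n + n).+1, n))%N by apply: leq_bin2l.
by rewrite expnS; lia.
Qed.

Lemma sum_divn_expn_widen p m n : (1 < p)%N -> (m <= n)%N ->
  (\sum_(1 <= k < n.+1) m %/ p ^ k = \sum_(1 <= k < m.+1) m %/ p ^ k)%N.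
Proof.
move=> p_gt1 mn; rewrite (@big_cat_nat _ _ _ m.+1) //= [X in (_ + X)%N]big1_seq ?addn0 // => k.
rewrite mem_index_iota => /andP[_ /andP[mk _]].
by rewrite divn_small // (leq_trans mk) // ltnW // ltn_expl.
Qed.

Lemma logn_central_bin p n : prime p ->
  (logn p 'C(n + n, n) + \sum_(1 <= k < (n + n).+1) (n %/ p ^ k + n %/ p ^ k) =
   \sum_(1 <= k < (n + n).+1) (n + n) %/ p ^ k)%N.
Proof.
move=> p_prime; rewrite big_split /= sum_divn_expn_widen ?leq_addr ?prime_gt1 //.
rewrite -!logn_fact // -(bin_fact (leq_addr n n)) addKn !lognM ?muln_gt0 ?fact_gt0 //.
by rewrite bin_gt0 leq_addr.
Qed.

(* By Legendre's formula, each power [p ^ k <= 2 n] contributes at most 1 to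
   the exponent. *)
Lemma pfactor_central_bin_le p n : prime p -> (0 < n)%N -> (p ^ logn p 'C(n + n, n) <= n + n)%N.
Proof.
move=> p_prime n_gt0; have p_gt1 := prime_gt1 p_prime.
have nn_gt0 : (0 < n + n)%N by rewrite addn_gt0 n_gt0.
set t := trunc_log p (n + n); have pt : (p ^ t <= n + n)%N by apply: trunc_logP.
apply: leq_trans pt; rewrite leq_exp2l //.
suff : (\sum_(1 <= k < (n + n).+1) (n + n) %/ p ^ k <=
        \sum_(1 <= k < (n + n).+1) (n %/ p ^ k + n %/ p ^ k) + t)%N.
  by rewrite -logn_central_bin // addnC leq_add2l.
have t_le : (t <= n + n)%N by rewrite ltnW // (leq_trans _ (trunc_logP p_gt1 nn_gt0)) // ltn_expl.
rewrite -[X in (_ <= _ + X)%N](sum_leq_count t_le) -big_split /=; apply: leq_sum => k _.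
case: (leqP k t) => kt; first by rewrite divnD ?expn_gt0 ?prime_gt0 // leq_add2l leq_b1.
by rewrite divn_small // ltnNge; apply: contraL kt => /(trunc_log_max p_gt1); rewrite -leqNgt.
Qed.

Lemma primes_central_bin_le p n : p \in primes 'C(n + n, n) -> (p <= n + n)%N.
Proof.
rewrite mem_primes => /and3P[p_prime _ p_bin]; have : (p %| (n + n)`!)%N.
  by rewrite -(bin_fact (leq_addr n n)) dvdn_mulr.
rewrite fact_prod Euclid_dvd_prod // big_has => /hasP[k].
by rewrite mem_index_iota ltnS => /andP[k_gt0 kn] /(dvdn_leq k_gt0)/leq_trans; apply.
Qed.

Definition odd_primes (Z : nat) : seq nat := [seq p <- iota 0 Z.+1 | prime p && odd p].

Lemma mem_odd_primes Z p : (p \in odd_primes Z) = [&& prime p, odd p & (p <= Z)%N].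
Proof. by rewrite mem_filter mem_iota /= add0n ltnS andbA. Qed.

Lemma odd_primes_uniq Z : uniq (odd_primes Z).
Proof. by rewrite filter_uniq ?iota_uniq. Qed.

Lemma leq_size_odd_primes : {homo (fun Z => size (odd_primes Z)) : m n / (m <= n)%N}.
Proof.
move=> m n mn; apply: uniq_leq_size; first exact: odd_primes_uniq.
by move=> p; rewrite !mem_odd_primes => /and3P[-> -> /leq_trans]; apply.
Qed.

Lemma expn2_le_odd_primes n : (0 < n)%N -> (2 ^ n <= (n + n) ^ (size (odd_primes (n + n))).+1)%N.
Proof.
move=> n_gt0; apply: leq_trans (central_bin_ge n) _.
have bin_gt : (0 < 'C(n + n, n))%N by rewrite bin_gt0 leq_addr.
rewrite {1}(prod_prime_decomp bin_gt) prime_decompE big_map /=.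
apply: (@leq_trans (\prod_(p <- primes 'C(n + n, n)) (n + n))).
  rewrite big_seq [leqRHS]big_seq; apply: leq_prod => p; rewrite mem_primes => /and3P[p_prime _ _].
  exact: pfactor_central_bin_le.
rewrite big_const_seq count_predT iter_muln_1 leq_pexp2l ?addn_gt0 ?n_gt0 //.
rewrite -[leqRHS]/(size (2%N :: odd_primes (n + n))); apply: uniq_leq_size (primes_uniq _) _ => p p_bin.
have /and3P[p_prime _ _] : [&& prime p, (0 < 'C(n + n, n))%N & (p %| 'C(n + n, n))%N] by rewrite -mem_primes.
rewrite inE mem_odd_primes p_prime primes_central_bin_le //=.
by case: (even_prime p_prime) => [->|->]; rewrite ?orbT.
Qed.

Lemma chebyshev_odd_primes (R : realType) (Z : nat) : (3 <= Z)%N ->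
  Z%:R * ln 2 <= 6 * (size (odd_primes Z))%:R * ln Z%:R :> R.
Proof.
move=> Z3; pose n := Z./2; have n_gt0 : (0 < n)%N by rewrite /n; lia.
have nZ : (n + n <= Z <= 3 * n)%N by rewrite /n; lia.
have P_gt0 : (0 < size (odd_primes Z))%N.
  by rewrite -has_predT; apply/hasP; exists 3%N; rewrite ?mem_odd_primes.
have pow_le : (2 ^ n <= Z ^ (size (odd_primes Z) + size (odd_primes Z)))%N.
  have /andP[nnZ _] := nZ; apply: leq_trans (expn2_le_odd_primes n_gt0) _.
  apply: (@leq_trans (Z ^ (size (odd_primes (n + n))).+1)); first by rewrite leq_exp2r.
  rewrite leq_pexp2l ?(leq_trans _ Z3) //; have := leq_size_odd_primes nnZ; lia.
have ln_le : n%:R * ln 2 <= 2 * (size (odd_primes Z))%:R * ln Z%:R :> R.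
  have : ln ((2 ^ n)%:R : R) <= ln ((Z ^ (size (odd_primes Z) + size (odd_primes Z)))%:R : R).
    by rewrite ler_ln ?posrE ?ltr0n ?expn_gt0 ?(leq_trans _ Z3) // ler_nat.
  rewrite !natrX !lnXn ?ltr0n ?(leq_trans _ Z3) // -![ln _ *+ _]mulr_natl natrD; lra.
have ln2 : 0 <= ln (2 : R) by rewrite ln_ge0 // ler1n.
have Zn : Z%:R * ln 2 <= (3 * n)%:R * ln 2 :> R.
  by rewrite ler_wpM2r // ler_nat; case/andP: nZ.
by apply: le_trans Zn _; rewrite natrM; lra.
Qed.

Section PrimesUpToPower.
Local Open Scope classical_set_scope.
Variable R : realType.
Implicit Types (z e : R) (D : nat).

Definition primes_upto z D : seq nat := odd_primes (Num.truncn (D%:R `^ z : R)).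

Lemma mem_primes_upto z D p : (p \in primes_upto z D) = [&& prime p, odd p & p%:R <= D%:R `^ z :> R].
Proof. by rewrite mem_odd_primes truncn_ge_nat ?powR_ge0. Qed.

Lemma size_primes_upto_le z D : (size (primes_upto z D))%:R <= D%:R `^ z :> R.
Proof.
rewrite -truncn_ge_nat ?powR_ge0 // -[leqRHS](size_iota 1); apply: uniq_leq_size.
  exact: odd_primes_uniq.
by move=> p; rewrite mem_odd_primes mem_iota add1n ltnS => /and3P[/prime_gt0 -> _ ->].
Qed.

Lemma near_size_primes_upto_ge z e : 0 < z -> 0 < e ->
  \forall D \near \oo, D%:R `^ (z - e) <= (size (primes_upto z D))%:R :> R.
Proof.
move=> z0 e0; have e20 : 0 < e / 2 by rewrite divr_gt0.
have ln2 : 0 < ln (2 : R) by rewrite ln_gt0 // ltr1n.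
pose C := 12 * (z * (e / 2)^-1) / ln 2.
near=> D; have D_gt0 : 0 < D%:R :> R by apply: lt_le_trans ltr01 _; near: D; apply: nbhs_infty_ger.
set P := primes_upto z D; set Z := Num.truncn (D%:R `^ z).
have Z3 : (3 <= Z)%N.
  by rewrite truncn_ge_nat ?powR_ge0 //; near: D; apply: near_powR_ge.
have Z_le : Z%:R <= D%:R `^ z by rewrite truncn_le powR_ge0.
have lt_ZS : D%:R `^ z < Z.+1%:R by apply: truncnS_gt.
have Z1 : 1 <= Z%:R :> R by rewrite ler1n (leq_trans _ Z3).
have lnZ : ln Z%:R <= z * ((e / 2)^-1 * D%:R `^ (e / 2)).
  apply: (@le_trans _ _ (ln (D%:R `^ z))); first by rewrite ler_ln ?posrE ?powR_gt0 // (lt_le_trans ltr01).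
  by rewrite ln_powR ler_pM2l // ln_le_powR.
have Dz : D%:R `^ z <= (size P)%:R * (C * D%:R `^ (e / 2)).
  have cheb := chebyshev_odd_primes R Z3; rewrite -/P in cheb.
  have : Z%:R * ln 2 <= 6 * (size P)%:R * (z * ((e / 2)^-1 * D%:R `^ (e / 2))).
    by apply: le_trans cheb _; rewrite ler_wpM2l ?mulr_ge0.
  have -> : (size P)%:R * (C * D%:R `^ (e / 2)) =
      2 * (6 * (size P)%:R * (z * ((e / 2)^-1 * D%:R `^ (e / 2))) / ln 2) by rewrite /C; ring.
  rewrite -ler_pdivlMr // => Zle; apply: le_trans (_ : 2 * Z%:R <= _); last by rewrite ler_pM2l.
  by move: lt_ZS; rewrite -natr1; lra.
rewrite powRD_gt0 // powRN ler_pdivrMr ?powR_gt0 //; apply: le_trans Dz _; rewrite ler_wpM2l //.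
by rewrite {2}[e]splitr; near: D; apply: near_mul_powR_le.
Unshelve. all: end_near. Qed.
End PrimesUpToPower.

(** * Counting representations 4 n = x^2 + d y^2 *)

Lemma size_congruent_le (A : seq nat) (a L M : nat) : uniq A ->
  {in A, forall x, (a <= x <= a + L)%N} -> {in A &, forall x y, x = y %[mod M]} ->
  (size A <= (L %/ M).+1)%N.
Proof.
move=> A_uniq A_range A_mod; pose f x := ((x - a) %/ M)%N.
have f_inj : {in A &, injective f}.
  move=> x y xA yA fxy; have [/andP[ax _] /andP[ay _]] := (A_range x xA, A_range y yA).
  have eq_mod : (x - a = y - a %[mod M])%N.
    by apply/eqP; rewrite -(eqn_modDr a) !subnK //; apply/eqP/A_mod.
  have : (x - a = y - a)%N by rewrite (divn_eq (x - a) M) (divn_eq (y - a) M) -/(f x) fxy eq_mod.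
  lia.
rewrite -(size_map f) -(size_iota 0 (L %/ M).+1); apply: uniq_leq_size.
  by rewrite map_inj_in_uniq.
move=> _ /mapP[x xA ->]; rewrite mem_iota /= add0n ltnS.
by apply: leq_div2r; have := A_range x xA; lia.
Qed.

Lemma gcdn_cofactor_dvd M u v : (0 < M)%N -> (M %| u * v)%N -> (M %/ gcdn u M %| v)%N.
Proof.
move=> M_gt0 Muv; have k_gt0 : (0 < gcdn u M)%N by rewrite gcdn_gt0 M_gt0 orbT.
have co : coprime (M %/ gcdn u M) (u %/ gcdn u M).
  by rewrite /coprime -(eqn_pmul2r k_gt0) muln_gcdl !divnK ?dvdn_gcdl ?dvdn_gcdr // mul1n gcdnC.
rewrite -(Gauss_dvdr v co) -(dvdn_pmul2r k_gt0) mulnAC.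
by rewrite !divnK ?dvdn_gcdl ?dvdn_gcdr.
Qed.

Lemma gcdn_cofactors_dvd4 k l n x x0 y : (k * l = y ^ 2)%N -> coprime y n ->
  (x0 ^ 2 = 4 * n %[mod y ^ 2])%N -> (x0 <= x)%N -> (k %| x - x0)%N -> (l %| x + x0)%N ->
  (gcdn k l %| 4)%N.
Proof.
move=> kl yn x0n x0x kx lx; set f := gcdn k l.
have [fk fl] : (f %| k)%N /\ (f %| l)%N by rewrite dvdn_gcdl dvdn_gcdr.
have f2y : (f ^ 2 %| y ^ 2)%N by rewrite -kl expnS expn1 dvdn_mul.
have fy : (f %| y)%N by rewrite -(dvdn_pexp2r _ _ (isT : (0 < 2)%N)).
have f_2x0 : (f %| 2 * x0)%N.
  rewrite -(_ : (x + x0) - (x - x0) = 2 * x0)%N; last by rewrite subnBA // -addnA addKn addnn mul2n.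
  by apply: dvdn_sub; [apply: dvdn_trans fl lx|apply: dvdn_trans fk kx].
have f2_16n : (f ^ 2 %| 16 * n)%N.
  have : (f ^ 2 %| 4 * x0 ^ 2)%N by rewrite -[4%N]/(2 ^ 2)%N -expnMn dvdn_exp2r.
  by rewrite /dvdn -modnMmr (modn_eq_dvd f2y x0n) modnMmr mulnA.
rewrite -(dvdn_pexp2r _ _ (isT : (0 < 2)%N)); rewrite Gauss_dvdl // in f2_16n.
by rewrite coprimeXl // (coprime_dvdl fy).
Qed.

Lemma cofactors_eqmod k l x0 x x' : (x0 <= x)%N -> (x0 <= x')%N ->
  (k %| x - x0)%N -> (l %| x + x0)%N -> (k %| x' - x0)%N -> (l %| x' + x0)%N ->
  x = x' %[mod lcmn k l].
Proof.
wlog xx' : x x' / (x' <= x)%N => [W|] x0x x0x' kx lx kx' lx'.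
  by case: (leqP x' x) => [le|/ltnW le]; [apply: W|symmetry; apply: W].
apply/eqP; rewrite eqn_mod_dvd // dvdn_lcm; apply/andP; split.
  by rewrite -{1}(subnK x0x) -(subnBA _ x0x') dvdn_sub.
by rewrite -(subnDr x0) dvdn_sub.
Qed.

(* If y^2 divides x^2 - 4n and x0^2 - 4n, then k = gcd(x - x0, y^2) determines
   x modulo lcm(k, y^2 / k), which is at least y^2 / 4 as y is prime to n. *)
Lemma size_square_roots_le (A : seq nat) (n y a L : nat) : uniq A -> (0 < y)%N -> coprime y n ->
  {in A, forall x, (x ^ 2 = 4 * n %[mod y ^ 2])%N} -> {in A, forall x, (a <= x <= a + L)%N} ->
  (size A <= tau (y ^ 2) * ((4 * L) %/ y ^ 2).+1)%N.
Proof.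
move=> A_uniq y_gt0 yn A_sqr A_range; have y2_gt0 : (0 < y ^ 2)%N by rewrite expn_gt0 y_gt0.
have [/eqP/size0nil -> //|[x1 x1A]] : size A == 0%N \/ exists x, x \in A.
  by case: (A) => [|x s]; [left|right; exists x; rewrite mem_head].
have [x0 x0A x0_min] := exists_min_mem x1A.
pose k x := gcdn (x - x0) (y ^ 2).
have k_div x : x \in A -> k x \in divisors (y ^ 2) by rewrite -dvdn_divisors // dvdn_gcdr.
apply: leq_trans (size_fibers_le k_div) _; apply: leq_sum_seq_const => q.
rewrite -dvdn_divisors // => qy; set F := [seq x <- A | k x == q]; set l := (y ^ 2 %/ q)%N.
have ql : (q * l = y ^ 2)%N by rewrite mulnC divnK.
have FP x : x \in F -> [/\ x \in A, (q %| x - x0)%N & (l %| x + x0)%N].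
  rewrite mem_filter => /andP[/eqP kx xA]; split=> //; first by rewrite -kx dvdn_gcdl.
  rewrite /l -kx; apply: gcdn_cofactor_dvd => //; rewrite -subn_sqr -eqn_mod_dvd.
    by apply/eqP; rewrite !A_sqr.
  by rewrite leq_sqr x0_min.
case: (posnP (size F)) => [->//|]; rewrite -has_predT => /hasP[x xF _].
have [xA qx lx] := FP x xF.
have ql4 : (gcdn q l %| 4)%N.
  by apply: (gcdn_cofactors_dvd4 ql yn _ _ qx lx); [apply: A_sqr|apply: x0_min].
have lcm_gt0 : (0 < lcmn q l)%N.
  by have := y2_gt0; rewrite -ql muln_gt0 lcmn_gt0.
have : (size F <= (L %/ lcmn q l).+1)%N.
  apply: (@size_congruent_le F a L) => //; first by rewrite filter_uniq.
    by move=> z /FP[/A_range].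
  by move=> z z' /FP[zA ? ?] /FP[z'A ? ?]; apply: (@cofactors_eqmod _ _ x0); rewrite ?x0_min.
move/leq_trans; apply; rewrite ltnS leq_divRL //.
apply: (@leq_trans (L %/ lcmn q l * (4 * lcmn q l))%N).
  by rewrite leq_mul2l -ql -muln_lcm_gcd mulnC leq_mul2r (dvdn_leq _ ql4) ?orbT.
by rewrite mulnCA leq_mul2l /= leq_divM.
Qed.

Lemma norm_form_window n D y d d' x x' : (D <= d)%N -> (d' < 2 * D)%N ->
  (4 * n = x ^ 2 + d * y ^ 2)%N -> (4 * n = x' ^ 2 + d' * y ^ 2)%N -> (x' <= x)%N ->
  ((x - x') ^ 2 * n <= (D * y ^ 2) ^ 2)%N.
Proof.
move=> Dd d'D rep rep' /subnKC xE; move: xE rep; set k := (x - x')%N => <-.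
set Y := (y ^ 2)%N in rep' * => rep.
have [DY d'Y] : (D * Y <= d * Y /\ d' * Y <= 2 * (D * Y))%N.
  by rewrite mulnA !leq_mul2r Dd (ltnW d'D) !orbT.
case: (leqP n ((x' + k) ^ 2)) => nx.
  apply: (@leq_trans ((k * (x' + k)) ^ 2)%N); first by rewrite expnMn leq_mul2l nx orbT.
  rewrite leq_sqr; apply: (@leq_trans (k * (x' + x' + k))%N).
    by rewrite leq_mul2l -addnA leq_addl orbT.
  have : (k * (x' + x' + k) + x' ^ 2 = (x' + k) ^ 2)%N by ring.
  by lia.
apply: (@leq_trans (n ^ 2)%N); last by rewrite leq_sqr; lia.
rewrite [leqRHS]expnS expn1 leq_mul2r; apply/orP; right; apply: ltnW; apply: leq_ltn_trans nx.
by rewrite leq_sqr leq_addl.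
Qed.

Section FixedY.
Variables (R : rcfType) (n D y : nat) (F : seq nat).
Hypotheses (n_gt0 : (0 < n)%N) (y_gt0 : (0 < y)%N) (yn : coprime y n).
Hypotheses (F_uniq : uniq F) (F_range : {in F, forall d, (D <= d < 2 * D)%N}).
Variable x_of : nat -> nat.
Hypothesis F_rep : {in F, forall d, (4 * n = x_of d ^ 2 + d * y ^ 2)%N}.

(* Distinct d give distinct x, all in a window of length at most
   [D * y ^ 2 / sqrt n], and [x ^ 2 = 4 * n] modulo [y ^ 2]. *)
Lemma size_reps_fixed_y_le :
  (size F)%:R <= (tau (y ^ 2))%:R * (4 * D%:R / Num.sqrt n%:R + 1) :> R.
Proof.
set s := Num.sqrt (n%:R : R); have s_gt0 : 0 < s by rewrite sqrtr_gt0 ltr0n.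
have y2_gt0 : (0 < y ^ 2)%N by rewrite expn_gt0 y_gt0.
case: (posnP (size F)) => [->|]; first by rewrite mulr_ge0 // addr_ge0 // divr_ge0 ?mulr_ge0 // ltW.
rewrite -has_predT => /hasP[d1 d1F _]; pose A := map x_of F.
have A_uniq : uniq A.
  rewrite map_inj_in_uniq // => d d' dF d'F eq_x; apply/eqP; rewrite -(eqn_pmul2r y2_gt0).
  by apply/eqP/(@addnI (x_of d ^ 2)%N); rewrite -(F_rep dF) eq_x -(F_rep d'F).
have A_sqr : {in A, forall x, (x ^ 2 = 4 * n %[mod y ^ 2])%N}.
  by move=> _ /mapP[d dF ->]; rewrite (F_rep dF) addnC modnMDl.
have [_ /mapP[d0 d0F ->] x0_min] := exists_min_mem (map_f x_of d1F).
pose L := (\max_(x <- A) (x - x_of d0))%N.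
have A_range : {in A, forall x, (x_of d0 <= x <= x_of d0 + L)%N}.
  move=> x xA; rewrite x0_min //= -leq_subLR.
  by apply: (@leq_bigmax_seq _ A xpredT (fun x => (x - x_of d0)%N)).
have L_le : L%:R * s <= D%:R * (y ^ 2)%:R.
  rewrite -(@ler_pXn2r _ 2) ?nnegrE ?mulr_ge0 ?(ltW s_gt0) // exprMn sqr_sqrtr //.
  rewrite -natrM -!natrX -natrM ler_nat /L big_seq.
  apply: (big_ind (fun L => L ^ 2 * n <= (D * y ^ 2) ^ 2)%N) => // [u v Hu Hv|x xA].
    by case: (leqP u v).
  have /mapP[d dF xE] := xA; rewrite xE in xA *.
  have [/andP[Dd _] /andP[_ d0D]] := (F_range dF, F_range d0F).
  by apply: norm_form_window Dd d0D (F_rep dF) (F_rep d0F) (x0_min _ xA).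
have size_A := size_square_roots_le A_uniq y_gt0 yn A_sqr A_range; rewrite size_map in size_A.
apply: (@le_trans _ _ (tau (y ^ 2) * ((4 * L) %/ y ^ 2).+1)%:R); first by rewrite ler_nat.
rewrite natrM ler_wpM2l // -natr1 lerD2r ler_pdivlMr // -(@ler_pM2r _ (y ^ 2)%:R) ?ltr0n //.
rewrite mulrAC; apply: (@le_trans _ _ (4 * L%:R * s)); last by rewrite -!mulrA ler_pM2l.
by rewrite ler_pM2r // -!natrM ler_nat leq_divM.
Qed.
End FixedY.

Lemma norm_form_y_le (R : rcfType) n D d x y : (0 < D)%N -> (D <= d)%N ->
  (4 * n = x ^ 2 + d * y ^ 2)%N -> y%:R <= 2 * (Num.sqrt n%:R / Num.sqrt D%:R) :> R.
Proof.
move=> D_gt0 Dd rep; have t_gt0 : 0 < Num.sqrt (D%:R : R) by rewrite sqrtr_gt0 ltr0n.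
rewrite mulrA ler_pdivlMr // -(@ler_pXn2r _ 2) ?nnegrE ?mulr_ge0 ?sqrtr_ge0 //.
rewrite !exprMn !sqr_sqrtr // -!natrX -!natrM ler_nat mulnC rep.
by rewrite (leq_trans _ (leq_addl _ _)) // leq_mul2r Dd orbT.
Qed.

Definition primitive_rep (d n : nat) : Prop :=
  exists x y, (4 * n = x ^ 2 + d * y ^ 2)%N /\ coprime y n.

Lemma size_primitive_reps_le (R : realType) (n D T : nat) (E : seq nat) : (0 < D)%N -> (1 < n)%N ->
  uniq E -> {in E, forall d, (D <= d < 2 * D)%N /\ primitive_rep d n} ->
  (forall y, (0 < y)%N -> (y ^ 2 <= 4 * n)%N -> (tau (y ^ 2) <= T)%N) ->
  (size E)%:R <= T%:R * (8 * Num.sqrt D%:R + 2 * (Num.sqrt n%:R / Num.sqrt D%:R)) :> R.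
Proof.
move=> D_gt0 n_gt1 E_uniq E_rep tau_le; have n_gt0 := ltnW n_gt1.
pose rep d (z : nat * nat) := (4 * n = z.1 ^ 2 + d * z.2 ^ 2)%N /\ coprime z.2 n.
pose z d := xget (0, 0)%N (rep d).
have zP d : d \in E -> rep d (z d).
  by move=> /E_rep[_ [x [y H]]]; apply: xgetPex; exists (x, y).
set s := Num.sqrt (n%:R : R); set t := Num.sqrt (D%:R : R).
have [s_gt0 t_gt0] : 0 < s /\ 0 < t by rewrite !sqrtr_gt0 !ltr0n.
have st_ge0 : 0 <= 2 * (s / t) by rewrite mulr_ge0 // divr_ge0 // ltW.
pose Y := Num.truncn (2 * (s / t)).
have z2_range d : d \in E -> (z d).2 \in iota 1 Y.
  move=> dE; have [z_rep z_co] := zP d dE; have [/andP[Dd _] _] := E_rep d dE.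
  rewrite mem_iota add1n ltnS lt0n; apply/andP; split.
    by apply: contraTneq z_co => ->; rewrite /coprime gcd0n gtn_eqF.
  by rewrite truncn_ge_nat // (norm_form_y_le R D_gt0 Dd z_rep).
have fixed_y y : y \in iota 1 Y ->
    (size [seq d <- E | (z d).2 == y])%:R <= T%:R * (4 * D%:R / s + 1) :> R.
  rewrite mem_iota => /andP[y_gt0 _]; set F := [seq d <- E | _].
  have FP d : d \in F -> d \in E /\ (z d).2 = y by rewrite mem_filter => /andP[/eqP].
  case: (posnP (size F)) => [->|]; first by rewrite mulr_ge0 // addr_ge0 // divr_ge0 ?mulr_ge0 // ltW.
  rewrite -has_predT => /hasP[d dF _]; have [dE dy] := FP d dF; have [z_rep z_co] := zP d dE.
  rewrite dy in z_rep z_co; have [/andP[Dd _] _] := E_rep d dE.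
  have F_range : {in F, forall e, (D <= e < 2 * D)%N} by move=> e /FP[/E_rep[]].
  have F_rep : {in F, forall e, (4 * n = (z e).1 ^ 2 + e * y ^ 2)%N} by move=> e /FP[/zP[+ _] <-].
  apply: le_trans (size_reps_fixed_y_le R n_gt0 y_gt0 z_co (filter_uniq _ E_uniq) F_range F_rep) _.
  apply: ler_wpM2r; first by rewrite addr_ge0 // divr_ge0 ?mulr_ge0 // ltW.
  rewrite ler_nat tau_le // z_rep (leq_trans _ (leq_addl _ _)) // leq_pmull //.
  exact: leq_trans Dd.
apply: (@le_trans _ _ (\sum_(y <- iota 1 Y) (size [seq d <- E | (z d).2 == y])%:R)).
  by rewrite -natr_sum ler_nat size_fibers_le.
apply: le_trans (ler_sum_seq_const fixed_y) _; rewrite size_iota.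
apply: (@le_trans _ _ (2 * (s / t) * (T%:R * (4 * D%:R / s + 1)))).
  by rewrite ler_wpM2r ?truncn_le // mulr_ge0 // addr_ge0 // divr_ge0 ?mulr_ge0 // ltW.
have -> : D%:R = t ^+ 2 by rewrite sqr_sqrtr.
rewrite (_ : 2 * (s / t) * _ = T%:R * (8 * t + 2 * (s / t))) //.
by field; rewrite !gt_eqF.
Qed.

(** * Products, dilations and conjugates of sets of numbers *)

Section IdealOperations.
Local Open Scope classical_set_scope.
Implicit Types (I J L Y : set algC) (a b x y : algC).

Definition add_closed Y : Prop := Y 0 /\ forall x y, Y x -> Y y -> Y (x + y).

Lemma add_closed_preimage_mul a Y : add_closed Y -> add_closed [set x | Y (a * x)].
Proof. by move=> [Y0 YD]; split=> [|x y] /=; rewrite ?mulr0 ?mulrDr //; apply: YD. Qed.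

Lemma ideal_mul_closed I J : add_closed (ideal_mul I J).
Proof.
split=> [|x y [s Hs ->] [t Ht ->]]; first by exists [::]; rewrite ?big_nil.
by exists (s ++ t) => [p|]; rewrite ?big_cat // mem_cat => /orP[/Hs|/Ht].
Qed.

Lemma mem_ideal_mul I J x y : I x -> J y -> ideal_mul I J (x * y).
Proof. by move=> Ix Jy; exists [:: (x, y)] => [p|]; rewrite ?big_seq1 // inE => /eqP->. Qed.

Lemma ideal_mul_subset I J Y : add_closed Y -> (forall x y, I x -> J y -> Y (x * y)) ->
  ideal_mul I J `<=` Y.
Proof.
move=> [Y0 YD] IJY x [s Hs ->]; elim: s Hs => [|p s IH] Hs; first by rewrite big_nil.
rewrite big_cons; apply: YD; first by have [] := Hs p (mem_head _ _); apply: IJY.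
by apply: IH => q qs; apply: Hs; rewrite inE qs orbT.
Qed.

Lemma ideal_mulC I J : ideal_mul I J = ideal_mul J I.
Proof.
have mulC_sub A B : ideal_mul A B `<=` ideal_mul B A.
  apply: ideal_mul_subset (ideal_mul_closed _ _) _ => x y Ax By.
  by rewrite mulrC; apply: mem_ideal_mul.
by apply/seteqP; split.
Qed.

Lemma ideal_mulA I J L : ideal_mul I (ideal_mul J L) = ideal_mul (ideal_mul I J) L.
Proof.
have mulA_sub A B C : ideal_mul (ideal_mul A B) C `<=` ideal_mul A (ideal_mul B C).
  apply: ideal_mul_subset (ideal_mul_closed _ _) _ => x z ABx Cz; rewrite mulrC.
  move: x ABx; apply: ideal_mul_subset (add_closed_preimage_mul _ (ideal_mul_closed _ _)) _.
  by move=> x y Ax By /=; rewrite mulrC -mulrA; do 2!apply: mem_ideal_mul => //.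
apply/seteqP; split; last exact: mulA_sub.
by rewrite ideal_mulC (ideal_mulC J) (ideal_mulC _ L) (ideal_mulC I); apply: mulA_sub.
Qed.

Lemma ideal_mulS I J I' J' : I `<=` I' -> J `<=` J' -> ideal_mul I J `<=` ideal_mul I' J'.
Proof.
move=> II' JJ'; apply: ideal_mul_subset (ideal_mul_closed _ _) _ => x y Ix Jy.
by apply: mem_ideal_mul; [apply: II'|apply: JJ'].
Qed.

Lemma ideal_mulACA I J I' J' :
  ideal_mul (ideal_mul I J) (ideal_mul I' J') = ideal_mul (ideal_mul I I') (ideal_mul J J').
Proof. by rewrite -!ideal_mulA; congr ideal_mul; rewrite !ideal_mulA (ideal_mulC J). Qed.

Lemma ideal_scale1 I : ideal_scale 1 I = I.
Proof.
apply/seteqP; split=> x; first by move=> [y Iy <-]; rewrite mul1r.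
by move=> Ix; exists x; rewrite ?mul1r.
Qed.

Lemma ideal_scaleA a b I : ideal_scale a (ideal_scale b I) = ideal_scale (a * b) I.
Proof.
apply/seteqP; split=> [_ [_ [z Iz <-] <-]|_ [z Iz <-]]; first by exists z; rewrite ?mulrA.
by exists (b * z); rewrite ?mulrA //; exists z.
Qed.

Lemma ideal_scale_closed a I : add_closed I -> add_closed (ideal_scale a I).
Proof.
move=> [I0 ID]; split=> [|_ _ [x Ix <-] [y Iy <-]]; first by exists 0; rewrite ?mulr0.
by exists (x + y); rewrite ?mulrDr //; apply: ID.
Qed.

Lemma ideal_mul_scale a b I J :
  ideal_mul (ideal_scale a I) (ideal_scale b J) = ideal_scale (a * b) (ideal_mul I J).
Proof.
apply/seteqP; split.
  apply: ideal_mul_subset (ideal_scale_closed _ (ideal_mul_closed _ _)) _.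
  by move=> _ _ [u Iu <-] [v Jv <-]; exists (u * v); [apply: mem_ideal_mul|rewrite mulrACA].
move=> _ [x + <-]; move: x.
apply: ideal_mul_subset (add_closed_preimage_mul _ (ideal_mul_closed _ _)) _ => x y Ix Jy /=.
by rewrite mulrACA; apply: mem_ideal_mul; [exists x|exists y].
Qed.

Definition ideal_conj I : set algC := [set x | I x^*].

Lemma ideal_conjK : involutive ideal_conj.
Proof. by move=> I; apply/seteqP; split=> x; rewrite /ideal_conj /= conjCK. Qed.

Lemma ideal_conj_closed I : add_closed I -> add_closed (ideal_conj I).
Proof.
by move=> [I0 ID]; split=> [|x y]; rewrite /ideal_conj /= ?rmorph0 // rmorphD; apply: ID.
Qed.

Lemma ideal_conj_mul I J : ideal_conj (ideal_mul I J) = ideal_mul (ideal_conj I) (ideal_conj J).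
Proof.
have conj_sub A B : ideal_mul (ideal_conj A) (ideal_conj B) `<=` ideal_conj (ideal_mul A B).
  apply: ideal_mul_subset (ideal_conj_closed (ideal_mul_closed _ _)) _ => x y Ax By.
  by rewrite /ideal_conj /= rmorphM; apply: mem_ideal_mul.
apply/seteqP; split; last exact: conj_sub.
move=> x; have := conj_sub (ideal_conj I) (ideal_conj J) x^*.
by rewrite !ideal_conjK /ideal_conj /= conjCK.
Qed.

Lemma ideal_conj_scale a I : ideal_conj (ideal_scale a I) = ideal_scale a^* (ideal_conj I).
Proof.
apply/seteqP; split=> x.
  by move=> [y Iy e]; exists y^*; [rewrite /ideal_conj /= conjCK|rewrite -rmorphM e /= conjCK].
by move=> [y Iy <-]; exists y^* => //; rewrite rmorphM /= conjCK.
Qed.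

Implicit Types A B C : set (set algC).

Lemma class_mulC A B : class_mul A B = class_mul B A.
Proof.
have mulC_sub C D : class_mul C D `<=` class_mul D C.
  by move=> _ [I CI [J DJ <-]]; exists J => //; exists I => //; rewrite ideal_mulC.
by apply/seteqP; split.
Qed.

Lemma class_mulA A B C : class_mul A (class_mul B C) = class_mul (class_mul A B) C.
Proof.
apply/seteqP; split.
  move=> _ [I AI [_ [J BJ [L CL <-]] <-]]; exists (ideal_mul I J); first by exists I => //; exists J.
  by exists L; rewrite ?ideal_mulA.
move=> _ [_ [I AI [J BJ <-]] [L CL <-]]; exists I => //; exists (ideal_mul J L).
  by exists J => //; exists L.
by rewrite ideal_mulA.
Qed.

Lemma class_mulACA A B C D :
  class_mul (class_mul A B) (class_mul C D) = class_mul (class_mul A C) (class_mul B D).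
Proof. by rewrite -!class_mulA; congr class_mul; rewrite !class_mulA (class_mulC B). Qed.
End IdealOperations.

(** * Ideals and ideal classes of Q(sqrt(-d)) *)

Lemma Aint_rat (a : rat) : (ratr a : algC) \in Aint -> exists m : int, a = m%:~R.
Proof.
move=> aA; have /intrP[m am] := Cint_rat_Aint (Crat_rat a) aA.
by exists m; apply: (fmorph_inj (ratr : rat -> algC)); rewrite /= ratr_int.
Qed.

Lemma Aint_dvdn (u v : nat) (z : algC) : (0 < u)%N -> z \in Aint -> v%:R = u%:R * z -> (u %| v)%N.
Proof.
move=> u_gt0 zA vE; have u0 : u%:R != 0 :> algC by rewrite pnatr_eq0 -lt0n.
have zE : z = v%:R / u%:R by rewrite vE mulrC mulKf.
have z_int : z \in Num.int by apply: Cint_rat_Aint => //; rewrite zE rpred_div ?rpred_nat.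
by rewrite -dvdC_nat; apply/dvdCP; exists z; rewrite // mulrC.
Qed.

Section ImaginaryQuadratic.
Local Open Scope classical_set_scope.
Variable d : nat.
Hypothesis d_gt0 : (0 < d)%N.
Implicit Types (a b : rat) (x y : algC) (I J : set algC) (C : set (set algC)).
Let w : algC := sqrtC (- d%:R).
Let K := imag_quad_field d.
Let O := ring_of_integers d.

Definition quad_elt a b : algC := ratr a + ratr b * sqrtC (- d%:R).

Lemma quad_eltD a b a' b' : quad_elt a b + quad_elt a' b' = quad_elt (a + a') (b + b').
Proof. by rewrite /quad_elt !rmorphD /=; ring. Qed.

Lemma quad_eltN a b : - quad_elt a b = quad_elt (- a) (- b).
Proof. by rewrite /quad_elt !rmorphN /=; ring. Qed.

Let w_sqr : w * w = - d%:R.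
Proof. by rewrite -expr2 sqrtCK. Qed.

Lemma quad_eltM a b a' b' :
  quad_elt a b * quad_elt a' b' = quad_elt (a * a' - d%:R * b * b') (a * b' + a' * b).
Proof.
rewrite /quad_elt rmorphB rmorphD /= !rmorphM /= ratr_nat -/w.
transitivity (ratr a * ratr a' + ratr b * ratr b' * (w * w) +
  (ratr a * ratr b' + ratr a' * ratr b) * w); first by ring.
by rewrite w_sqr; ring.
Qed.

Lemma rat_quad_elt a : ratr a = quad_elt a 0.
Proof. by rewrite /quad_elt rmorph0 mul0r addr0. Qed.

Lemma int_quad_elt (m : int) : m%:~R = quad_elt m%:~R 0.
Proof. by rewrite -rat_quad_elt ratr_int. Qed.

Lemma nat_quad_elt (m : nat) : m%:R = quad_elt m%:R 0.
Proof. by rewrite -rat_quad_elt ratr_nat. Qed.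

Lemma sqrt_quad_elt : sqrtC (- d%:R) = quad_elt 0 1.
Proof. by rewrite /quad_elt rmorph0 rmorph1 add0r mul1r. Qed.

Lemma mem_imag_quad_field a b : K (quad_elt a b).
Proof. by exists a, b. Qed.

Lemma imag_quad_fieldD x y : K x -> K y -> K (x + y).
Proof. by move=> [a [b ->]] [a' [b' ->]]; rewrite quad_eltD; apply: mem_imag_quad_field. Qed.

Lemma imag_quad_fieldM x y : K x -> K y -> K (x * y).
Proof. by move=> [a [b ->]] [a' [b' ->]]; rewrite quad_eltM; apply: mem_imag_quad_field. Qed.

Lemma imag_quad_field1 : K 1.
Proof. by rewrite -[1]/(1%:R) nat_quad_elt; apply: mem_imag_quad_field. Qed.

Let w_conj : w^* = - w.
Proof.
have : (w^* - w) * (w^* + w) = 0.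
  have ww : w^* * w^* = w * w by rewrite -rmorphM w_sqr rmorphN rmorph_nat.
  by rewrite mulrDr !mulrBl ww; ring.
move/eqP; rewrite mulf_eq0 subr_eq0 [X in _ || X]addr_eq0 => /orP[/eqP wr|/eqP//].
have : 0 <= w * w by rewrite -{2}wr mul_conjC_ge0.
by rewrite w_sqr oppr_ge0 lt_geF // ltr0n.
Qed.

Lemma conj_quad_elt a b : (quad_elt a b)^* = quad_elt a (- b).
Proof.
have -> : (quad_elt a b)^* = (ratr a)^* + (ratr b)^* * w^*.
  by rewrite rmorphD; congr (_ + _); apply: rmorphM.
by rewrite w_conj !conj_Crat ?Crat_rat // /quad_elt rmorphN mulrN mulNr.
Qed.

Lemma quad_elt_inj a b a' b' : quad_elt a b = quad_elt a' b' -> a = a' /\ b = b'.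
Proof.
move=> e; have aa : a = a'.
  have := congr1 (fun x => x + x^*) e; rewrite !conj_quad_elt !quad_eltD !subrr -!rat_quad_elt.
  by move/(fmorph_inj (ratr : rat -> algC)); lra.
split=> //; move: e; rewrite aa => /addrI/mulIf; rewrite sqrtC_eq0 oppr_eq0 pnatr_eq0 -lt0n.
by move=> /(_ d_gt0)/(fmorph_inj (ratr : rat -> algC)).
Qed.

Lemma quad_elt_eq0 a b : (quad_elt a b == 0) = (a == 0) && (b == 0).
Proof.
apply/eqP/andP => [e|[/eqP-> /eqP->]]; last by rewrite -rat_quad_elt rmorph0.
have : quad_elt a b = quad_elt 0 0 by rewrite e -rat_quad_elt rmorph0.
by move=> /quad_elt_inj[-> ->].
Qed.

Lemma quad_elt_norm a b : quad_elt a b * (quad_elt a b)^* = ratr (a ^+ 2 + d%:R * b ^+ 2).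
Proof. by rewrite conj_quad_elt quad_eltM rat_quad_elt; congr quad_elt; ring. Qed.

Lemma imag_quad_field_conj x : K x -> K x^*.
Proof. by move=> [a [b ->]]; rewrite -/(quad_elt a b) conj_quad_elt; apply: mem_imag_quad_field. Qed.

Lemma imag_quad_fieldV x : K x -> K x^-1.
Proof.
move=> [a [b ->]]; rewrite -/(quad_elt a b) invC_norm normCK mulrC.
apply: imag_quad_fieldM; first exact/imag_quad_field_conj/mem_imag_quad_field.
by rewrite quad_elt_norm -fmorphV /= rat_quad_elt; apply: mem_imag_quad_field.
Qed.

Lemma Aint_conj x : (x^* \in Aint) = (x \in Aint).
Proof. exact: Aint_aut. Qed.

Lemma Aint_quad_elt a b (s n : int) : 2 * a = s%:~R -> a ^+ 2 + d%:R * b ^+ 2 = n%:~R ->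
  quad_elt a b \in Aint.
Proof.
move=> trace norm; pose p : {poly algC} := 'X^2 - s%:~R *: 'X + (n%:~R)%:P.
have size_lower : (size (- (s%:~R *: 'X) + (n%:~R)%:P : {poly algC})%R < 3)%N.
  rewrite (leq_ltn_trans (size_polyD _ _)) // gtn_max size_polyN.
  by rewrite (leq_ltn_trans (size_scale_leq _ _)) ?size_polyX // (leq_ltn_trans (size_polyC_leq1 _)).
apply: (@root_monic_Aint p).
- have s_trace : s%:~R = quad_elt a b + (quad_elt a b)^*.
    by rewrite conj_quad_elt quad_eltD subrr int_quad_elt -trace; congr quad_elt; ring.
  have n_norm : n%:~R = quad_elt a b * (quad_elt a b)^* by rewrite quad_elt_norm norm ratr_int.
  by rewrite /root /p !hornerE s_trace n_norm; apply/eqP; ring.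
- by rewrite /p -addrA monicE lead_coefDl ?lead_coefXn // size_polyXn.
- apply/polyOverP => i; rewrite /p !coefE rpredD ?rpredB ?rpredM ?rpred_nat ?rpred_int //.
  by case: ifP => _; rewrite ?rpred_int ?rpred0.
Qed.

Lemma integers_quad_elt a b : O (quad_elt a b) ->
  (exists s : int, 2 * a = s%:~R) /\ (exists n : int, a ^+ 2 + d%:R * b ^+ 2 = n%:~R).
Proof.
move=> [_ xA]; split; apply: Aint_rat.
  have -> : ratr (2 * a) = quad_elt a b + (quad_elt a b)^*.
    by rewrite conj_quad_elt quad_eltD subrr rat_quad_elt; congr quad_elt; ring.
  by rewrite rpredD // Aint_conj.
by rewrite -quad_elt_norm rpredM // Aint_conj.
Qed.

Lemma integersD x y : O x -> O y -> O (x + y).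
Proof. by move=> [? ?] [? ?]; split; [apply: imag_quad_fieldD|apply: rpredD]. Qed.

Lemma integersM x y : O x -> O y -> O (x * y).
Proof. by move=> [? ?] [? ?]; split; [apply: imag_quad_fieldM|apply: rpredM]. Qed.

Lemma integers_conj x : O x -> O x^*.
Proof. by move=> [? ?]; split; [apply: imag_quad_field_conj|rewrite Aint_conj]. Qed.

Lemma integers_int (m : int) : O m%:~R.
Proof. by split; [rewrite int_quad_elt; apply: mem_imag_quad_field|rewrite rpred_int]. Qed.

Lemma integers_nat (m : nat) : O m%:R.
Proof. exact: (integers_int m). Qed.

Lemma integers_sqrt : O (sqrtC (- d%:R)).
Proof.
split; rewrite sqrt_quad_elt; first exact: mem_imag_quad_field.
by apply: (@Aint_quad_elt _ _ 0 d); rewrite ?mulr0 // expr0n /= add0r expr1n mulr1.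
Qed.

Lemma integers_closed : add_closed O.
Proof. by split; [apply: (integers_nat 0)|apply: integersD]. Qed.

Lemma integers_norm x : O x -> exists n : nat, x * x^* = n%:R.
Proof.
move=> Ox; have [[a [b xE]] _] := Ox; rewrite -/(quad_elt a b) in xE.
have [_ [n norm]] := integers_quad_elt (eq_ind _ _ Ox _ xE).
have := mul_conjC_ge0 x; rewrite xE quad_elt_norm norm ratr_int.
by case: n {norm} => n; [exists n|rewrite NegzE ler0z].
Qed.

Lemma ideal_conj_integers : ideal_conj O = O.
Proof. by apply/seteqP; split=> x; [move=> /integers_conj; rewrite conjCK|apply: integers_conj]. Qed.

Lemma exists_denominator x : K x -> exists2 m : nat, (0 < m)%N & O (m%:R * x).
Proof.
move=> [p [q xE]]; exists (`|denq p| * `|denq q|)%N; first by rewrite muln_gt0 !absz_gt0 !denq_neq0.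
have -> : (`|denq p| * `|denq q|)%:R * x =
    (numq p * denq q)%:~R + (denq p * numq q)%:~R * sqrtC (- d%:R).
  have den_ratr (r : rat) : ((denq r)%:~R : algC) * ratr r = (numq r)%:~R.
    by rewrite -[(denq r)%:~R]ratr_int -rmorphM mulrC -numqE /= ratr_int.
  rewrite xE natrM !natr_absz !gtr0_norm ?denq_gt0 // !intrM -!den_ratr; ring.
apply: integersD; first exact: integers_int.
by apply: integersM; [apply: integers_int|apply: integers_sqrt].
Qed.

Lemma fractional_ideal_closed I : fractional_ideal d I -> add_closed I.
Proof.
move=> [_ [x Ix _] ID IM _]; split=> //.
by have := IM 0 x (integers_nat 0) Ix; rewrite mul0r.
Qed.

Lemma fractional_ideal_integers : fractional_ideal d O.
Proof.
split=> [x [] //||x y|x y|]; [|exact: integersD|exact: integersM|].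
  by exists 1; [apply: (integers_nat 1)|apply: oner_neq0].
by exists 1; [split; [apply: (integers_nat 1)|apply: oner_neq0]|move=> x; rewrite mul1r].
Qed.

Lemma fractional_ideal_scale (a : algC) I : K a -> a != 0 -> fractional_ideal d I ->
  fractional_ideal d (ideal_scale a I).
Proof.
move=> Ka a0 [IK [x Ix x0] ID IM [c [Oc c0] cI]]; split.
- by move=> _ [y Iy <-]; apply: imag_quad_fieldM => //; apply: IK.
- by exists (a * x); [exists x|rewrite mulf_neq0].
- by move=> _ _ [y Iy <-] [z Iz <-]; exists (y + z); rewrite ?mulrDr //; apply: ID.
- by move=> u _ Ou [y Iy <-]; exists (u * y); [apply: IM|rewrite mulrCA].
have [m m_gt0 Om] := exists_denominator (imag_quad_fieldV Ka).
have m0 : m%:R != 0 :> algC by rewrite pnatr_eq0 -lt0n.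
exists (c * (m%:R * a^-1)).
  by split; [apply: integersM|rewrite !mulf_neq0 // invr_eq0].
move=> _ [y Iy <-]; have -> : c * (m%:R / a) * (a * y) = m%:R * (c * y) by field.
by apply: integersM; [apply: integers_nat|apply: cI].
Qed.

Lemma fractional_ideal_mul I J : fractional_ideal d I -> fractional_ideal d J ->
  fractional_ideal d (ideal_mul I J).
Proof.
move=> [IK [x Ix x0] _ IM [c [Oc c0] cI]] [JK [y Jy y0] _ _ [e [Oe e0] eJ]].
have [_ IJD] := ideal_mul_closed I J; split=> //.
- have K_closed : add_closed K by split=> [|u v]; [case: integers_closed => -[]|exact: imag_quad_fieldD].
  by apply: ideal_mul_subset => // u v Iu Jv; apply: imag_quad_fieldM; [apply: IK|apply: JK].
- by exists (x * y); [apply: mem_ideal_mul|rewrite mulf_neq0].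
- move=> u + Ou; apply: ideal_mul_subset (add_closed_preimage_mul u (ideal_mul_closed _ _)) _ => a b Ia Jb /=.
  by rewrite mulrA; apply: mem_ideal_mul => //; apply: IM.
exists (c * e); first by split; [apply: integersM|rewrite mulf_neq0].
apply: ideal_mul_subset (add_closed_preimage_mul (c * e) integers_closed) _ => a b Ia Jb /=.
by rewrite mulrACA; apply: integersM; [apply: cI|apply: eJ].
Qed.

Lemma fractional_ideal_conj I : fractional_ideal d I -> fractional_ideal d (ideal_conj I).
Proof.
move=> [IK [x Ix x0] ID IM [c [Oc c0] cI]]; rewrite /ideal_conj; split => /=.
- by move=> y /IK /imag_quad_field_conj; rewrite conjCK.
- by exists x^*; rewrite ?conjCK // conjC_eq0.
- by move=> y z; rewrite rmorphD; apply: ID.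
- by move=> u y Ou; rewrite rmorphM; apply: IM; apply: integers_conj.
exists c^*; first by split; [apply: integers_conj|rewrite conjC_eq0].
by move=> y /cI /integers_conj; rewrite rmorphM /= conjCK.
Qed.

Lemma integers_mul_ideal I : fractional_ideal d I -> ideal_mul O I = I.
Proof.
move=> fI; have [_ _ _ IM _] := fI; apply/seteqP; split.
  exact: ideal_mul_subset (fractional_ideal_closed fI) _.
by move=> y Iy; rewrite -(mul1r y); apply: mem_ideal_mul => //; apply: (integers_nat 1).
Qed.

Definition ideal_pow I n : set algC := iter n (ideal_mul I) (ring_of_integers d).

Lemma fractional_ideal_pow I n : fractional_ideal d I -> fractional_ideal d (ideal_pow I n).
Proof.
by move=> fI; elim: n => [|n IH]; [apply: fractional_ideal_integers|apply: fractional_ideal_mul].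
Qed.

Lemma ideal_pow_mul I J n : ideal_pow (ideal_mul I J) n = ideal_mul (ideal_pow I n) (ideal_pow J n).
Proof.
elim: n => [|n IH]; first by rewrite integers_mul_ideal //; apply: fractional_ideal_integers.
by rewrite /ideal_pow /= -!/(ideal_pow _ n) IH ideal_mulACA.
Qed.

Lemma ideal_conj_pow I n : ideal_conj (ideal_pow I n) = ideal_pow (ideal_conj I) n.
Proof.
elim: n => [|n IH]; first exact: ideal_conj_integers.
by rewrite /ideal_pow /= -!/(ideal_pow _ n) ideal_conj_mul IH.
Qed.

Lemma ideal_pow_scale_integers (a : algC) n : ideal_pow (ideal_scale a O) n = ideal_scale (a ^+ n) O.
Proof.
elim: n => [|n IH]; first by rewrite expr0 ideal_scale1.
rewrite /ideal_pow /= -!/(ideal_pow _ n) IH ideal_mul_scale exprS integers_mul_ideal //.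
exact: fractional_ideal_integers.
Qed.

Lemma mem_ideal_pow I x n : I x -> ideal_pow I n (x ^+ n).
Proof.
move=> Ix; elim: n => [|n IH]; first exact: (integers_nat 1).
by rewrite exprS; apply: mem_ideal_mul.
Qed.

Lemma ideal_pow_sub_integers I n : I `<=` O -> ideal_pow I n `<=` O.
Proof.
move=> IO; elim: n => // n IH; rewrite /ideal_pow /= -/(ideal_pow I n).
rewrite -[X in _ `<=` X](integers_mul_ideal fractional_ideal_integers).
exact: ideal_mulS.
Qed.

Lemma mem_ideal_class I : ideal_class d I I.
Proof.
by exists 1; rewrite ?ideal_scale1 //=; split; [apply: imag_quad_field1|apply: oner_neq0].
Qed.

Lemma ideal_class_scale (a : algC) I : K a -> a != 0 -> ideal_class d (ideal_scale a I) = ideal_class d I.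
Proof.
move=> Ka a0; apply/seteqP; split=> _ [b [Kb b0] <-].
  exists (b * a); last by rewrite ideal_scaleA.
  by split; [apply: imag_quad_fieldM|rewrite mulf_neq0].
exists (b / a); last by rewrite ideal_scaleA divfK.
by split; [apply: imag_quad_fieldM => //; apply: imag_quad_fieldV|rewrite mulf_neq0 ?invr_eq0].
Qed.

Lemma ideal_class_eq I J : ideal_class d I = ideal_class d J ->
  exists a : algC, [/\ K a, a != 0 & J = ideal_scale a I].
Proof. by move=> IJ; have := mem_ideal_class J; rewrite -IJ => -[a [Ka a0] <-]; exists a. Qed.

Lemma class_mulE I J : class_mul (ideal_class d I) (ideal_class d J) = ideal_class d (ideal_mul I J).
Proof.
apply/seteqP; split.
  move=> _ [_ [a [Ka a0] <-] [_ [b [Kb b0] <-] <-]]; rewrite ideal_mul_scale.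
  by exists (a * b) => //; split; [apply: imag_quad_fieldM|rewrite mulf_neq0].
move=> _ [a [Ka a0] <-]; exists (ideal_scale a I); first by exists a.
by exists J; [apply: mem_ideal_class|rewrite -{1}(ideal_scale1 J) ideal_mul_scale mulr1].
Qed.

Lemma class_powE I n : class_pow d (ideal_class d I) n = ideal_class d (ideal_pow I n).
Proof. by elim: n => // n IH; rewrite /class_pow /= -/(class_pow d _ n) IH class_mulE. Qed.

Lemma principal_class_mul C : class_group d C -> class_mul (principal_class d) C = C.
Proof. by move=> [I fI <-]; rewrite class_mulE integers_mul_ideal. Qed.

Lemma class_group_ideal_class I : fractional_ideal d I -> class_group d (ideal_class d I).
Proof. by move=> fI; exists I. Qed.

Lemma class_group_mul C C' : class_group d C -> class_group d C' -> class_group d (class_mul C C').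
Proof.
move=> [I fI <-] [J fJ <-]; rewrite class_mulE.
exact/class_group_ideal_class/fractional_ideal_mul.
Qed.

Lemma class_group_pow C n : class_group d C -> class_group d (class_pow d C n).
Proof.
by move=> [I fI <-]; rewrite class_powE; apply/class_group_ideal_class/fractional_ideal_pow.
Qed.

Lemma class_pow_mul C C' n :
  class_pow d (class_mul C C') n = class_mul (class_pow d C n) (class_pow d C' n).
Proof.
elim: n => [|n IH].
  by rewrite principal_class_mul //; apply/class_group_ideal_class/fractional_ideal_integers.
by rewrite /class_pow /= -!/(class_pow d _ n) IH class_mulACA.
Qed.

(** * Reduction theory *)

Definition reduced_ideal I : Prop :=
  [/\ fractional_ideal d I, I 1 & forall x, I x -> x != 0 -> 1 <= x * x^*].

Lemma exists_reduced_scale I : fractional_ideal d I ->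
  exists z : algC, [/\ K z, z != 0 & reduced_ideal (ideal_scale z I)].
Proof.
move=> fI; have [IK [x Ix x0] _ _ [c [_ c0] cI]] := fI.
pose is_norm (n : nat) := `[< exists y, [/\ I y, y != 0 & (c * y) * (c * y)^* = n%:R] >].
have ex_norm : exists n, is_norm n.
  by have [n xn] := integers_norm (cI _ Ix); exists n; apply/asboolP; exists x.
case: (ex_minnP ex_norm) => m /asboolP[y [Iy y0 ym]] m_min.
have Kyi : K y^-1 by apply/imag_quad_fieldV/IK.
exists y^-1; split; rewrite ?invr_eq0 //; split; [|by exists y; rewrite ?mulVf|].
  by apply: fractional_ideal_scale; rewrite ?invr_eq0.
move=> _ [z Iz <-]; rewrite mulf_eq0 invr_eq0 (negPf y0) /= => z0.
have [n zn] := integers_norm (cI _ Iz).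
have mn : (m <= n)%N by apply: m_min; apply/asboolP; exists z.
have y_norm : 0 < (c * y) * (c * y)^* by rewrite mul_conjC_gt0 mulf_neq0.
have -> : y^-1 * z * (y^-1 * z)^* = ((c * z) * (c * z)^*) / ((c * y) * (c * y)^*).
  rewrite !rmorphM fmorphV /=; have [yc cc] : y^* != 0 /\ c^* != 0 by rewrite !conjC_eq0.
  by field; rewrite y0 c0 yc cc.
by rewrite ler_pdivlMr // mul1r ym zn ler_nat.
Qed.

Lemma fractional_ideal_intM I (m : int) x : fractional_ideal d I -> I x -> I (m%:~R * x).
Proof. by move=> [_ _ _ IM _]; apply: IM; apply: integers_int. Qed.

Lemma fractional_idealB I x y : fractional_ideal d I -> I x -> I y -> I (x - y).
Proof.
move=> fI Ix Iy; have [_ _ ID _ _] := fI; apply: ID => //.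
by rewrite -mulN1r; apply: (fractional_ideal_intM (-1)).
Qed.

Lemma reduced_rat I a : reduced_ideal I -> I (ratr a) -> exists m : int, a = m%:~R.
Proof.
move=> [fI I1 I_min] Ia; exists (Num.floor a); have /andP[floor_le lt_floor] := floor_itv a.
set r := a - (Num.floor a)%:~R.
have Ir : I (ratr r).
  rewrite rmorphB /= ratr_int; apply: fractional_idealB => //.
  by rewrite -[X in I X]mulr1; apply: fractional_ideal_intM.
case: (eqVneq r 0) => [/eqP|r0]; first by rewrite subr_eq0 => /eqP.
have := I_min _ Ir; rewrite fmorph_eq0 => /(_ r0).
rewrite conj_Crat ?Crat_rat // -rmorphM -(rmorph1 (ratr : rat -> algC)) ler_rat leNgt -expr2.
have r_ge0 : 0 <= r by rewrite subr_ge0.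
have r_lt1 : r < 1 by rewrite ltrBlDl -[1]/(1%:~R) -intrD.
by rewrite expr_lt1 // r_lt1.
Qed.

Lemma sqrt_coef_denominator I : fractional_ideal d I -> exists2 e : nat, (0 < e)%N &
  forall a b, I (quad_elt a b) -> exists m : int, e%:R * b = m%:~R.
Proof.
move=> [_ _ _ _ [c [Oc c0] cI]]; have [k ck] := integers_norm Oc.
have k_gt0 : (0 < k)%N by rewrite lt0n -(pnatr_eq0 algC) -ck mulf_neq0 ?conjC_eq0.
exists (2 * k * d)%N; first by rewrite !muln_gt0 k_gt0 d_gt0.
move=> a b Ix; suff [m mE] : exists m : int, - ((2 * k * d)%:R * b) = m%:~R.
  by exists (- m); rewrite intrN -mE opprK.
apply: Aint_rat.
have -> : ratr (- ((2 * k * d)%:R * b)) =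
   (k%:R * quad_elt a b - (k%:R * quad_elt a b)^*) * sqrtC (- d%:R) :> algC.
  rewrite [LHS]rat_quad_elt (nat_quad_elt k) quad_eltM conj_quad_elt quad_eltN quad_eltD.
  by rewrite sqrt_quad_elt quad_eltM; congr quad_elt; rewrite ?natrM; ring.
have kA : k%:R * quad_elt a b \in Aint.
  by rewrite -ck (mulrC c) -mulrA rpredM ?Aint_conj //; [case: Oc|case: (cI _ Ix)].
by rewrite rpredM ?rpredB ?Aint_conj //; case: integers_sqrt.
Qed.

(* v > 0 is the least coefficient of sqrt(-d) in I. *)
Lemma reduced_basis I : reduced_ideal I -> exists u v, [/\ 0 < v, I (quad_elt u v) &
  forall a b, I (quad_elt a b) -> exists s q : int, a = s%:~R + q%:~R * u /\ b = q%:~R * v].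
Proof.
move=> redI; have [fI I1 _] := redI; have [e e_gt0 e_denom] := sqrt_coef_denominator fI.
have eR_gt0 : 0 < e%:R :> rat by rewrite ltr0n.
pose is_coef (t : nat) := (0 < t)%N && `[< exists a b, I (quad_elt a b) /\ e%:R * b = t%:R >].
have ex_coef : exists t, is_coef t.
  exists e; rewrite /is_coef e_gt0; apply/asboolP; exists 0, 1; rewrite mulr1 -sqrt_quad_elt.
  have [_ _ _ IM _] := fI; split=> //.
  by rewrite -[X in I X]mulr1; apply: IM => //; apply: integers_sqrt.
case: (ex_minnP ex_coef) => t /andP[t_gt0 /asboolP[u [v [Iuv ev]]]] t_min.
exists u, v; split=> [|//|a b Iab]; first by rewrite -(pmulr_rgt0 _ eR_gt0) ev ltr0n.
have [m em] := e_denom _ _ Iab; pose q := (m %/ t)%Z; pose r := (m %% t)%Z.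
have Iq : I (quad_elt (a - q%:~R * u) (b - q%:~R * v)).
  have := fractional_idealB fI Iab (fractional_ideal_intM q fI Iuv).
  by rewrite int_quad_elt quad_eltM quad_eltN quad_eltD; congr (I (quad_elt _ _)); ring.
have er : e%:R * (b - q%:~R * v) = r%:~R.
  by rewrite mulrBr mulrCA em ev {1}(divz_eq m t) intrD intrM; ring.
have r_ge0 : 0 <= r by rewrite modz_ge0 // eqz_nat -lt0n.
have r0 : r = 0.
  apply/eqP; apply: contraT; rewrite -absz_gt0 => r_gt0; have : r < t by rewrite ltz_pmod.
  have : (t <= `|r|)%N.
    apply: t_min; rewrite /is_coef r_gt0; apply/asboolP.
    by exists (a - q%:~R * u), (b - q%:~R * v); rewrite er natr_absz ger0_norm.
  by move: r_ge0; clear; lia.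
have b0 : b - q%:~R * v = 0 by apply/eqP; rewrite -(mulrI_eq0 _ (lregP (lt0r_neq0 eR_gt0))) er r0.
move: Iq; rewrite b0 -rat_quad_elt => /(reduced_rat redI)[s es].
by exists s, q; split; [rewrite -es; ring|apply/eqP; rewrite -subr_eq0 b0].
Qed.

(* The lattice Z + Z (b + sqrt(-d)) / n. *)
Definition quad_lattice (n b : nat) : set algC :=
  [set x | exists s t : int, x = quad_elt (s%:~R + t%:~R * (b%:R / n%:R)) (t%:~R / n%:R)].

Lemma reduced_lattice I : reduced_ideal I ->
  exists n b : nat, [/\ (0 < n)%N, (b < n)%N & I = quad_lattice n b].
Proof.
move=> redI; have [fI I1 _] := redI; have [IK _ ID IM _] := fI.
have [u [v [v_gt0 Iuv basis]]] := reduced_basis redI.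
have Iw : I (quad_elt 0 1).
  by rewrite -sqrt_quad_elt -[X in I X]mulr1; apply: IM => //; apply: integers_sqrt.
have [s [n [u_eq v_eq]]] := basis _ _ Iw.
have n_gt0 : 0 < n by rewrite -(ltr0z rat) -(pmulr_lgt0 _ v_gt0) -v_eq.
case: n n_gt0 u_eq v_eq => // n n_gt0; rewrite -pmulrn => u_eq v_eq.
have nR0 : (n%:R : rat) != 0 by rewrite pnatr_eq0 -lt0n.
have vE : v = n%:R^-1 by apply: (mulfI nR0); rewrite -v_eq mulfV.
have uE : u = (- s)%:~R / n%:R.
  by apply: (mulfI nR0); rewrite [RHS]mulrC divfK // intrN; apply/eqP; rewrite -addr_eq0 addrC -u_eq.
pose b := `|((- s) %% n)%Z|%N; pose k := ((- s) %/ n)%Z.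
have nZ0 : n%:Z != 0 by rewrite eqz_nat -lt0n.
have bE : b%:Z = ((- s) %% n)%Z by rewrite gez0_abs ?modz_ge0.
have {}uE : u = k%:~R + b%:R / n%:R.
  by rewrite uE (divz_eq (- s) n) -bE intrD intrM mulrDl mulfK.
exists n, b; split=> //; first by rewrite -ltz_nat bE ltz_pmod.
apply/seteqP; split=> x.
  move=> Ix; have [a [c xE]] := IK _ Ix; rewrite -/(quad_elt a c) in xE; rewrite xE in Ix *.
  have [s' [q [-> ->]]] := basis _ _ Ix; exists (s' + q * k), q.
  by rewrite uE vE intrD intrM; congr quad_elt; ring.
move=> [s' [q ->]]; have := ID _ _ (fractional_ideal_intM (s' - q * k) fI I1) (fractional_ideal_intM q fI Iuv).
by rewrite mulr1 !int_quad_elt quad_eltM quad_eltD uE vE intrB intrM; congr (I (quad_elt _ _)); ring.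
Qed.

(* The elements (r + sqrt(-d)) / n with r = b and r = b - n have norm at least 1. *)
Lemma reduced_lattice_bound (n b : nat) : (0 < n)%N -> (b < n)%N -> reduced_ideal (quad_lattice n b) ->
  (3 * n ^ 2 <= 4 * d)%N.
Proof.
move=> n_gt0 bn [_ _ I_min]; have nR0 : (n%:R : rat) != 0 by rewrite pnatr_eq0 -lt0n.
have norm_ge (r j : int) : r = b%:Z + j * n -> (n ^ 2)%N%:Z <= r ^+ 2 + d.
  move=> rE; have Ix : quad_lattice n b (quad_elt (r%:~R / n%:R) n%:R^-1).
    by exists j, 1; congr quad_elt; rewrite ?mul1r // rE intrD intrM mulrDl mulfK // addrC.
  have := I_min _ Ix; rewrite quad_elt_eq0 invr_eq0 (negPf nR0) andbF => /(_ isT).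
  rewrite quad_elt_norm -(rmorph1 (ratr : rat -> algC)) ler_rat.
  have -> : (r%:~R / n%:R) ^+ 2 + d%:R * n%:R^-1 ^+ 2 = (r ^+ 2 + d)%:~R / (n ^ 2)%:R :> rat.
    by rewrite natrX intrD rmorphXn /=; field.
  by rewrite ler_pdivlMr ?ltr0n ?expn_gt0 ?n_gt0 // mul1r -[X in X <= _]/((n ^ 2)%N%:~R) ler_int.
have norm_b := norm_ge b%:Z 0; have norm_bn := norm_ge (b%:Z - n%:Z) (-1).
rewrite mul0r addr0 in norm_b; rewrite mulN1r in norm_bn.
move: (norm_b erefl) (norm_bn erefl) bn; clear.
by case: (leqP (2 * b) n) => ? ? ? ?; nia.
Qed.

(* The product of sqrt(-d) and (b + sqrt(-d)) / n lies in the lattice. *)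
Lemma quad_lattice_dvd (n b : nat) : (0 < n)%N -> fractional_ideal d (quad_lattice n b) -> (n %| b ^ 2 + d)%N.
Proof.
move=> n_gt0 [_ _ _ IM _]; have nR0 : (n%:R : rat) != 0 by rewrite pnatr_eq0 -lt0n.
have Lx : quad_lattice n b (quad_elt (b%:R / n%:R) n%:R^-1).
  by exists 0, 1; congr quad_elt; rewrite ?mul1r ?add0r.
have := IM _ _ integers_sqrt Lx; rewrite sqrt_quad_elt quad_eltM => -[s [q]] /quad_elt_inj[rat_part sqrt_part].
have qb : q = b.
  apply/eqP; rewrite -(eqr_int rat); apply/eqP/(mulIf (invr_neq0 nR0)).
  by rewrite -sqrt_part; ring.
have : (b ^ 2 + d)%:R = (- s)%:~R * n%:R :> rat.
  have -> : (- s)%:~R * n%:R = b%:R ^+ 2 - (s%:~R + q%:~R * (b%:R / n%:R)) * n%:R :> rat.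
    by rewrite qb intrN; field.
  by rewrite -rat_part natrD natrX; field.
rewrite -[n%:R]/(n%:~R) -intrM -[LHS]/((b ^ 2 + d)%N%:~R) => /eqP; rewrite eqr_int => /eqP bd.
by have := dvdz_mull (- s) (dvdzz n%:Z); rewrite -bd.
Qed.

Lemma class_lattice C : class_group d C -> exists n b : nat,
  [/\ (0 < n)%N, (b < n)%N, (3 * n ^ 2 <= 4 * d)%N, fractional_ideal d (quad_lattice n b) &
    C = ideal_class d (quad_lattice n b)].
Proof.
move=> [I fI <-]; have [z [Kz z0 redI]] := exists_reduced_scale fI.
have [n [b [n_gt0 bn IE]]] := reduced_lattice redI; rewrite IE in redI.
exists n, b; split=> //; [exact: reduced_lattice_bound bn redI|by case: redI|].
by rewrite -IE ideal_class_scale.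
Qed.

Definition class_bound (S : nat) : nat := (\sum_(0 <= b < S) tau (b ^ 2 + d))%N.

Lemma class_group_enum S : (4 * d < 3 * S ^ 2)%N ->
  exists2 r : seq (set (set algC)), size r = class_bound S & forall C, class_group d C -> C \in r.
Proof.
move=> dS; exists (flatten [seq [seq ideal_class d (quad_lattice n m) | n <- divisors (m ^ 2 + d)] | m <- iota 0 S]).
  rewrite /class_bound size_flatten /shape -map_comp sumnE big_map /index_iota subn0.
  by apply: eq_bigr => b _; rewrite /= size_map.
move=> C /class_lattice[n [b [n_gt0 bn n_le fL ->]]]; apply/flatten_mapP; exists b.
  rewrite mem_iota /= add0n ltnNge; apply/negP => Sb.
  have : (S ^ 2 <= n ^ 2)%N by rewrite leq_sqr (leq_trans Sb) // ltnW.
  by move: dS n_le; move: (S ^ 2)%N (n ^ 2)%N; clear; lia.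
by apply/mapP; exists n; rewrite // -dvdn_divisors ?addn_gt0 ?d_gt0 ?orbT ?quad_lattice_dvd.
Qed.

(** * Inverses of ideal classes *)

Section LatticeConj.
Variables n b : nat.
Hypotheses (n_gt0 : (0 < n)%N) (n_dvd : (n %| b ^ 2 + d)%N) (fL : fractional_ideal d (quad_lattice n b)).
Let L := quad_lattice n b.
Let c := ((b ^ 2 + d) %/ n)%N.
Let f := gcdn n (gcdn (2 * b) c).
Let omega := quad_elt (b%:R / n%:R) n%:R^-1.

Let f_dvd : [/\ f %| n, f %| 2 * b & f %| c]%N.
Proof.
by split; rewrite ?dvdn_gcdl // (dvdn_trans (dvdn_gcdr _ _)) ?dvdn_gcdl ?dvdn_gcdr.
Qed.

Let f_neq0 : (f%:R : rat) != 0.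
Proof. by rewrite pnatr_eq0 -lt0n gcdn_gt0 n_gt0. Qed.

Let n_eq : n%:R = (n %/ f)%:R * f%:R :> rat.
Proof. by have [fn _ _] := f_dvd; rewrite -natrM divnK. Qed.

Let n'_neq0 : ((n %/ f)%:R : rat) != 0.
Proof.
have := n_gt0; rewrite lt0n -(pnatr_eq0 rat) n_eq mulf_eq0.
by apply: contraNneq => ->; rewrite eqxx.
Qed.

Let d_eq : d%:R = (n %/ f)%:R * f%:R * ((c %/ f)%:R * f%:R) - b%:R ^+ 2 :> rat.
Proof.
have [fn _ fc] := f_dvd; rewrite -!natrM (divnK fn) (divnK fc) mulnC (divnK n_dvd) natrD natrX.
by ring.
Qed.

Let integer_theta : O (quad_elt (b%:R / f%:R) f%:R^-1).
Proof.
have [_ fb _] := f_dvd; split; first exact: mem_imag_quad_field.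
apply: (@Aint_quad_elt _ _ ((2 * b) %/ f)%N ((n %/ f) * (c %/ f))%N).
  by apply: (mulIf f_neq0); rewrite -mulrA divfK // -[RHS]natrM divnK // natrM.
by rewrite d_eq -[RHS]/((n %/ f * (c %/ f))%N%:R) natrM; field.
Qed.

Lemma quad_lattice_mul_conj_sub :
  ideal_mul L (ideal_conj L) `<=` ideal_scale (quad_elt (f%:R / n%:R) 0) O.
Proof.
apply: ideal_mul_subset (ideal_scale_closed _ integers_closed) _ => x y [s [t ->]].
rewrite /ideal_conj /= => -[s' [t' y_conj]].
have -> : y = quad_elt (s'%:~R + t'%:~R * (b%:R / n%:R)) (- (t'%:~R / n%:R)).
  by rewrite -[LHS]conjCK y_conj conj_quad_elt.
pose theta := quad_elt (b%:R / f%:R) f%:R^-1; have O_theta : O theta := integer_theta.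
exists (((n %/ f)%:R * s%:~R * s'%:~R + s%:~R * t'%:~R * theta^*) +
        (s'%:~R * t%:~R * theta + t%:~R * t'%:~R * (c %/ f)%:R)).
  have O_conj := integers_conj O_theta.
  by do !(done || apply: integers_nat || apply: integers_int || apply: integersM || apply: integersD).
rewrite /theta conj_quad_elt !int_quad_elt !nat_quad_elt !(quad_eltM, quad_eltD) n_eq.
by congr quad_elt; rewrite ?d_eq; field; rewrite ?f_neq0 ?n'_neq0.
Qed.

(* f / n is an integral combination of 1, the trace 2b / n and the norm c / n of
   (b + sqrt(-d)) / n. *)
Lemma mem_quad_lattice_mul_conj : ideal_mul L (ideal_conj L) (quad_elt (f%:R / n%:R) 0).
Proof.
have L1 : L 1 by exists 1, 0; rewrite !mul0r addr0 -rat_quad_elt rmorph1.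
have L_omega : L omega by exists 0, 1; rewrite add0r !mul1r.
have [L1' L_omega'] : ideal_conj L 1 /\ ideal_conj L omega^*.
  by rewrite /ideal_conj /= rmorph1 conjCK.
have [_ _ LD LM _] := fractional_ideal_mul fL (fractional_ideal_conj fL).
have [u [v uv]] := Bezoutz n (gcdz (2 * b)%N c); have [u' [v' uv']] := Bezoutz (2 * b)%N c.
have fE : f%:R = u%:~R * n%:R + v%:~R * (u'%:~R * (2 * b)%N%:R + v'%:~R * c%:R) :> rat.
  have -> : f%:R = (gcdz n (gcdz (2 * b)%N c))%:~R :> rat by [].
  by rewrite -uv -uv' !(intrD, intrM).
have [_ _ fc] := f_dvd; have cE : c%:R = (c %/ f)%:R * f%:R :> rat by rewrite -natrM divnK.
have -> : quad_elt (f%:R / n%:R) 0 = u%:~R * (1 * 1) +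
    ((v * u')%:~R * (omega * 1 + 1 * omega^*) + (v * v')%:~R * (omega * omega^*)).
  rewrite /omega conj_quad_elt !mulr1 !mul1r !int_quad_elt !(quad_eltM, quad_eltD).
  by congr quad_elt; rewrite ?fE ?cE ?n_eq ?d_eq ?natrM ?intrM; field; rewrite ?f_neq0 ?n'_neq0.
apply: (LD); first by apply: LM; [apply: integers_int|apply: mem_ideal_mul].
apply: (LD); apply: LM; try exact: integers_int; last exact: mem_ideal_mul.
by apply: (LD); apply: mem_ideal_mul.
Qed.

Lemma quad_lattice_mul_conj : exists z : algC,
  [/\ K z, z != 0 & ideal_mul L (ideal_conj L) = ideal_scale z O].
Proof.
exists (quad_elt (f%:R / n%:R) 0); split; first exact: mem_imag_quad_field.
  by rewrite quad_elt_eq0 eqxx andbT mulf_neq0 // invr_eq0 pnatr_eq0 -lt0n.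
apply/seteqP; split; first exact: quad_lattice_mul_conj_sub.
have [_ _ _ LM _] := fractional_ideal_mul fL (fractional_ideal_conj fL).
by move=> _ [z Oz <-]; rewrite mulrC; apply: LM mem_quad_lattice_mul_conj.
Qed.
End LatticeConj.

Lemma class_group_inv C : class_group d C ->
  exists2 C', class_group d C' & class_mul C C' = principal_class d.
Proof.
move=> /class_lattice[n [b [n_gt0 _ _ fL ->]]].
have [z [Kz z0 LL]] := quad_lattice_mul_conj n_gt0 (quad_lattice_dvd n_gt0 fL) fL.
exists (ideal_class d (ideal_conj (quad_lattice n b))).
  exact/class_group_ideal_class/fractional_ideal_conj.
by rewrite class_mulE LL ideal_class_scale.
Qed.

Lemma class_mulIr C C1 C2 : class_group d C -> class_group d C1 -> class_group d C2 ->
  class_mul C1 C = class_mul C2 C -> C1 = C2.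
Proof.
move=> gC gC1 gC2 e; have [C' _ CC'] := class_group_inv gC.
have := congr1 (class_mul ^~ C') e.
by rewrite -!class_mulA CC' !(class_mulC _ (principal_class d)) !principal_class_mul.
Qed.

(** * Prime ideals above split primes *)

Definition ideal_span2 (y z : algC) : set algC :=
  [set x | exists u v, [/\ ring_of_integers d u, ring_of_integers d v & x = y * u + z * v]].

Lemma mem_ideal_span2l y z : ideal_span2 y z y.
Proof. by exists 1, 0; rewrite mulr1 mulr0 addr0; split; [exact: (integers_nat 1)|exact: (integers_nat 0)|]. Qed.

Lemma mem_ideal_span2r y z : ideal_span2 y z z.
Proof. by exists 0, 1; rewrite mulr1 mulr0 add0r; split; [exact: (integers_nat 0)|exact: (integers_nat 1)|]. Qed.

Lemma ideal_span2_sub_integers y z : O y -> O z -> ideal_span2 y z `<=` O.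
Proof. by move=> Oy Oz _ [u [v [Ou Ov ->]]]; apply: integersD; apply: integersM. Qed.

Lemma fractional_ideal_span2 y z : y != 0 -> O y -> O z -> fractional_ideal d (ideal_span2 y z).
Proof.
move=> y0 Oy Oz; have sub := ideal_span2_sub_integers Oy Oz; split.
- by move=> x /sub[].
- by exists y => //; apply: mem_ideal_span2l.
- move=> _ _ [u [v [Ou Ov ->]]] [u' [v' [Ou' Ov' ->]]]; exists (u + u'), (v + v').
  by split; [apply: integersD|apply: integersD|ring].
- move=> c _ Oc [u [v [Ou Ov ->]]]; exists (c * u), (c * v).
  by split; [apply: integersM|apply: integersM|ring].
exists 1; first by split; [apply: (integers_nat 1)|apply: oner_neq0].
by move=> x /sub; rewrite mul1r.
Qed.

Lemma ideal_conj_span2 y z : ideal_conj (ideal_span2 y z) = ideal_span2 y^* z^*.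
Proof.
have conj_sub u v : ideal_span2 u^* v^* `<=` ideal_conj (ideal_span2 u v).
  move=> _ [r [s [Or Os ->]]]; exists r^*, s^*; split; [exact: integers_conj|exact: integers_conj|].
  by rewrite rmorphD !rmorphM /= !conjCK.
apply/seteqP; split; last exact: conj_sub.
by move=> x yz_x; rewrite -[x]conjCK; apply: (conj_sub y^* z^*); rewrite /= !conjCK.
Qed.

Let beta (b : nat) : algC := quad_elt b%:R 1.

Let integers_beta (b : nat) : O (beta b).
Proof.
have -> : beta b = b%:R + sqrtC (- d%:R) by rewrite nat_quad_elt sqrt_quad_elt quad_eltD addr0 add0r.
by apply: integersD; [apply: integers_nat|apply: integers_sqrt].
Qed.

Let beta_trace (b : nat) : beta b + (beta b)^* = (2 * b)%:R.
Proof. by rewrite conj_quad_elt quad_eltD nat_quad_elt; congr quad_elt; rewrite ?natrM; ring. Qed.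

Let beta_norm (b : nat) : beta b * (beta b)^* = (b ^ 2 + d)%:R.
Proof. by rewrite quad_elt_norm expr1n mulr1 -natrX -natrD ratr_nat. Qed.

Definition prime_ideal (p b : nat) : set algC := ideal_span2 p%:R (quad_elt b%:R 1).

Lemma fractional_prime_ideal (p b : nat) : (0 < p)%N -> fractional_ideal d (prime_ideal p b).
Proof.
move=> p_gt0; apply: fractional_ideal_span2; first by rewrite pnatr_eq0 -lt0n.
  exact: integers_nat.
exact: integers_beta.
Qed.

Lemma prime_ideal_sub_integers (p b : nat) : prime_ideal p b `<=` O.
Proof. exact: ideal_span2_sub_integers (integers_nat p) (integers_beta b). Qed.

Lemma ideal_conj_prime (p b : nat) : ideal_conj (prime_ideal p b) = ideal_span2 p%:R (beta b)^*.
Proof. by rewrite ideal_conj_span2 rmorph_nat. Qed.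

(* The product contains p^2 and p times the trace 2b, which is prime to p. *)
Lemma prime_ideal_mul_conj (p b : nat) : splits_with d p b ->
  ideal_mul (prime_ideal p b) (ideal_conj (prime_ideal p b)) = ideal_scale p%:R O.
Proof.
move=> p_split; have [p_prime _ _ p_b2d] := p_split; have p_gt0 := prime_gt0 p_prime.
have fP := fractional_prime_ideal b p_gt0.
have [_ _ LD LM _] := fractional_ideal_mul fP (fractional_ideal_conj fP).
rewrite ideal_conj_prime in LD LM *; have Ob := integers_beta b; have Ob' := integers_conj Ob.
apply/seteqP; split.
  apply: ideal_mul_subset (ideal_scale_closed _ integers_closed) _.
  move=> _ _ [u [v [Ou Ov ->]]] [u' [v' [Ou' Ov' ->]]].
  pose n := ((b ^ 2 + d) %/ p)%N; have norm_beta : beta b * (beta b)^* = p%:R * n%:R.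
    by rewrite beta_norm -natrM mulnC divnK.
  exists (p%:R * u * u' + u * (beta b)^* * v' + (beta b * v * u' + n%:R * v * v')).
    by do !(done || apply: integers_nat || apply: integersM || apply: integersD).
  transitivity (p%:R * (p%:R * u * u' + u * (beta b)^* * v' + beta b * v * u') + (p%:R * n%:R) * v * v').
    by ring.
  by rewrite -norm_beta /beta; ring.
have [r [s bezout]] := Bezoutz p (2 * b)%N.
have rs : r%:~R * p%:R + s%:~R * (2 * b)%:R = 1 :> algC.
  rewrite -[p%:R]/(p%:~R) -[(2 * b)%:R]/((2 * b)%N%:~R) -!intrM -intrD bezout.
  by rewrite /gcdz /= (eqP (splits_with_coprime p_split)).
have pE : p%:R = r%:~R * (p%:R * p%:R) + s%:~R * (beta b * p%:R + p%:R * (beta b)^*) :> algC.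
  transitivity (p%:R * (r%:~R * p%:R + s%:~R * (2 * b)%:R) : algC); first by rewrite rs mulr1.
  by rewrite -beta_trace; ring.
have Lp : ideal_mul (prime_ideal p b) (ideal_span2 p%:R (beta b)^*) p%:R.
  rewrite [X in ideal_mul _ _ X]pE; apply: (LD); apply: LM; try exact: integers_int.
    by apply: mem_ideal_mul; apply: mem_ideal_span2l.
  by apply: LD; apply: mem_ideal_mul; do ?[exact: mem_ideal_span2l|exact: mem_ideal_span2r].
by move=> _ [z Oz <-]; rewrite mulrC; apply: LM.
Qed.

Lemma ideal_scale_nat_inj m n : (0 < m)%N -> (0 < n)%N ->
  ideal_scale m%:R O = ideal_scale n%:R O -> m = n.
Proof.
move=> m_gt0 n_gt0 mn.
have dvd_scale u v : (0 < u)%N -> ideal_scale u%:R O = ideal_scale v%:R O -> (u %| v)%N.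
  move=> u_gt0 uv; have : ideal_scale v%:R O v%:R by exists 1; rewrite ?mulr1 //; apply: (integers_nat 1).
  by rewrite -uv => -[z [_ zA] uz]; apply: Aint_dvdn u_gt0 zA (esym uz).
by apply/eqP; rewrite eqn_dvd !dvd_scale.
Qed.

Lemma principal_pow_mul_conj I J (z q : algC) g :
  ideal_mul J (ideal_conj J) = ideal_scale q O -> ideal_pow I g = ideal_scale z (ideal_pow J g) ->
  ideal_mul (ideal_pow I g) (ideal_pow (ideal_conj J) g) = ideal_scale (z * q ^+ g) O.
Proof.
move=> JJ ->; rewrite -[X in ideal_mul _ X]ideal_scale1 ideal_mul_scale mulr1.
by rewrite -ideal_pow_mul JJ ideal_pow_scale_integers ideal_scaleA.
Qed.

Lemma norm_of_generator I J (p q g : nat) (z : algC) : (0 < p)%N -> (0 < q)%N ->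
  ideal_mul I (ideal_conj I) = ideal_scale p%:R O -> ideal_mul J (ideal_conj J) = ideal_scale q%:R O ->
  ideal_mul (ideal_pow I g) (ideal_pow (ideal_conj J) g) = ideal_scale z O -> O z ->
  z * z^* = ((p * q) ^ g)%:R.
Proof.
move=> p_gt0 q_gt0 II JJ AE Oz; have OO := integers_mul_ideal fractional_ideal_integers.
have [m zm] := integers_norm Oz.
have mpq : ideal_scale m%:R O = ideal_scale ((p * q) ^ g)%:R O.
  rewrite -zm -{1}OO -ideal_mul_scale -{2}ideal_conj_integers -ideal_conj_scale -AE.
  rewrite ideal_conj_mul !ideal_conj_pow ideal_conjK ideal_mulACA -!ideal_pow_mul.
  rewrite (ideal_mulC (ideal_conj J)) II JJ ideal_mul_scale OO.
  by rewrite ideal_pow_scale_integers natrX natrM.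
have pq_gt0 : (0 < (p * q) ^ g)%N by rewrite expn_gt0 muln_gt0 p_gt0 q_gt0.
rewrite zm (ideal_scale_nat_inj _ pq_gt0 mpq) // lt0n; apply/eqP => m0; rewrite m0 in mpq.
have : ideal_scale ((p * q) ^ g)%:R O ((p * q) ^ g)%:R by exists 1; rewrite ?mulr1 //; apply: (integers_nat 1).
by rewrite -mpq => -[y _ /esym/eqP]; rewrite mul0r pnatr_eq0 -leqn0 leqNgt pq_gt0.
Qed.

Lemma squarefree_half_integers a b : squarefree d -> O (quad_elt a b) ->
  exists s t : int, a = s%:~R / 2 /\ b = t%:~R / 2.
Proof.
move=> sqf /integers_quad_elt[[s trace] [n norm]]; exists s.
pose c := 2 * b; have dc2 : d%:R * c ^+ 2 = (4 * n - s ^+ 2)%:~R.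
  by rewrite intrB intrM rmorphXn /= -norm -trace /c; ring.
have den_dvd : (`|denq c| ^ 2 %| d)%N.
  have : ((denq c) ^+ 2 %| d%:Z * (numq c) ^+ 2)%Z.
    apply/dvdzP; exists (4 * n - s ^+ 2); apply/eqP; rewrite -(eqr_int rat) !intrM.
    by rewrite -dc2 numqE; apply/eqP; rewrite -[(d%:Z)%:~R]/(d%:R); ring.
  rewrite dvdzE abszM !abszX Gauss_dvdl //=.
  by rewrite coprimeXl // coprimeXr // coprime_sym coprime_num_den.
have den1 : denq c = 1 by rewrite -(gtz0_abs (denq_gt0 c)) (sqf _ den_dvd).
exists (numq c); split; first by rewrite -trace; field.
by rewrite numqE den1 /c; field.
Qed.

Lemma integers_norm_form (z : algC) (N : nat) : squarefree d -> O z -> z * z^* = N%:R ->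
  exists s t : int, z = quad_elt (s%:~R / 2) (t%:~R / 2) /\ s ^+ 2 + d%:Z * t ^+ 2 = (4 * N)%N.
Proof.
move=> sqf Oz; have [[a [b zE]] _] := Oz; rewrite -/(quad_elt a b) in zE.
have [s [t [aE bE]]] := squarefree_half_integers sqf (eq_ind _ _ Oz _ zE).
rewrite zE aE bE quad_elt_norm -(ratr_nat _ N) => /(fmorph_inj (ratr : rat -> algC)) norm.
exists s, t; split=> //; apply/eqP; rewrite -(eqr_int rat) -[X in _ == X]/((4 * N)%:R) natrM -norm.
by rewrite intrD !intrM -[(d%:Z)%:~R]/(d%:R); apply/eqP; field.
Qed.

Lemma sum_pow_expand (x y : algC) n : x \in Aint -> y \in Aint ->
  exists2 q, q \in Aint & (x + y) ^+ n.+1 = x ^+ n.+1 + y ^+ n.+1 + x * y * q.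
Proof.
move=> xA yA; elim: n => [|n [q qA expand]]; first by exists 0; rewrite ?rpred0 //; ring.
exists (x ^+ n + y ^+ n + (x + y) * q); first by rewrite !(rpredD, rpredM, rpredX).
by rewrite exprS expand !exprS; ring.
Qed.

(* Otherwise p divides the trace of beta^g q^g; but the trace of beta^g is
   congruent to (2b)^g modulo the norm of beta, which is a multiple of p. *)
Lemma prime_ndvd_beta_pow (g p q b : nat) z : (0 < g)%N -> splits_with d p b -> ~~ (p %| q)%N -> O z ->
  beta b ^+ g * q%:R ^+ g <> p%:R * z.
Proof.
move=> g_gt0 p_split pq Oz beta_z; have [p_prime _ _ p_b2d] := p_split.
have [_ betaA] := integers_beta b; have betaA' : (beta b)^* \in Aint by rewrite Aint_conj.
have [r rA] := sum_pow_expand g.-1 betaA betaA'; rewrite prednK // beta_trace beta_norm => expand.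
have beta_z' : (beta b)^* ^+ g * q%:R ^+ g = p%:R * z^*.
  by have := congr1 Num.conj beta_z; rewrite !rmorphM !rmorphXn /= !rmorph_nat.
have trace_pow : ((2 * b) ^ g * q ^ g)%:R =
    p%:R * (z + z^* + ((b ^ 2 + d) %/ p)%:R * r * q%:R ^+ g) :> algC.
  have norm_p : p%:R * ((b ^ 2 + d) %/ p)%:R = (b ^ 2 + d)%:R :> algC by rewrite -natrM mulnC divnK.
  by rewrite natrM !natrX expand -norm_p !mulrDl beta_z beta_z'; ring.
have : (p %| (2 * b) ^ g * q ^ g)%N.
  apply: Aint_dvdn (prime_gt0 p_prime) _ trace_pow.
  have [_ zA] := Oz; have zA' : z^* \in Aint by rewrite Aint_conj.
  by do !(done || apply: rpred_nat || apply: rpredX || apply: rpredM || apply: rpredD).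
rewrite Euclid_dvdM // !Euclid_dvdX // (negPf pq) andFb orbF => /andP[p_2b _].
by have := splits_with_coprime p_split; rewrite prime_coprime // p_2b.
Qed.

Lemma half_quad_elt_dvd g p q (s t : int) : (1 < g)%N -> prime p -> (p %| `|t|)%N ->
  s ^+ 2 + d%:Z * t ^+ 2 = (4 * (p * q) ^ g)%N ->
  exists2 z, O z & quad_elt (s%:~R / 2) (t%:~R / 2) = p%:R * z.
Proof.
move=> g_gt1 p_prime pt norm; have p2_g : (p ^ 2 %| (p * q) ^ g)%N.
  by rewrite expnMn dvdn_mulr // dvdn_exp2l.
have ps : (p %| `|s|)%N.
  have : (p %| `|s ^+ 2|)%N.
    have -> : s ^+ 2 = (4 * (p * q) ^ g)%N%:Z - d%:Z * t ^+ 2 by rewrite -norm addrK.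
    rewrite -[(_ %| _)%N]/((p%:Z %| _)%Z) rpredB //.
      by rewrite dvdzE /= dvdn_mull // (dvdn_trans _ p2_g) // dvdn_exp.
    by rewrite dvdz_mull // expr2 dvdz_mull // dvdzE.
  by rewrite abszX Euclid_dvdX // => /andP[].
have /dvdzP[s1 sE] : (p%:Z %| s)%Z by rewrite dvdzE.
have /dvdzP[t1 tE] : (p%:Z %| t)%Z by rewrite dvdzE.
have pR0 : (p%:R : rat) != 0 by rewrite pnatr_eq0 -lt0n prime_gt0.
exists (quad_elt (s1%:~R / 2) (t1%:~R / 2)); last first.
  by rewrite nat_quad_elt quad_eltM sE tE !intrM; congr quad_elt; rewrite -[(p%:Z)%:~R]/(p%:R); ring.
split; first exact: mem_imag_quad_field.
apply: (@Aint_quad_elt _ _ s1 ((p * q) ^ g %/ p ^ 2)%N); first by field.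
have p2R0 : (p%:R ^+ 2 : rat) != 0 by rewrite expf_neq0.
apply: (mulIf p2R0).
have -> : ((p * q) ^ g %/ p ^ 2)%N%:~R * p%:R ^+ 2 = ((p * q) ^ g)%:R :> rat.
  by rewrite -natrX -natrM divnK.
apply: (@mulfI rat 4) => //; rewrite -natrM.
have := congr1 (fun m : int => m%:~R : rat) norm; rewrite -[X in _ = X -> _]/((4 * (p * q) ^ g)%:R) => <-.
by rewrite sE tE intrD !intrM -[(d%:Z)%:~R]/(d%:R) -[(p%:Z)%:~R]/(p%:R); field.
Qed.

Lemma prime_ndvd_half_coef (g p q b : nat) (s t : int) z : (1 < g)%N -> splits_with d p b -> ~~ (p %| q)%N ->
  s ^+ 2 + d%:Z * t ^+ 2 = (4 * (p * q) ^ g)%N -> O z ->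
  quad_elt (s%:~R / 2) (t%:~R / 2) * z = beta b ^+ g * q%:R ^+ g -> ~~ (p %| `|t|)%N.
Proof.
move=> g_gt1 p_split pq norm Oz beta_z; have [p_prime _ _ _] := p_split; apply/negP => pt.
have [y Oy yE] := half_quad_elt_dvd g_gt1 p_prime pt norm.
apply: (@prime_ndvd_beta_pow g p q b (y * z)) => //; [exact: ltnW|exact: integersM|].
by rewrite mulrA -yE beta_z.
Qed.

Lemma same_class_pow_primitive_rep (g p q b c : nat) : squarefree d -> (1 < g)%N ->
  splits_with d p b -> splits_with d q c -> p != q ->
  class_pow d (ideal_class d (prime_ideal p b)) g =
  class_pow d (ideal_class d (prime_ideal q c)) g -> primitive_rep d ((p * q) ^ g).
Proof.
move=> sqf g_gt1 p_split q_split pq; have [[p_prime _ _ _] [q_prime _ _ _]] := (p_split, q_split).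
have [p_gt0 q_gt0] : (0 < p)%N /\ (0 < q)%N by rewrite !prime_gt0.
set P := prime_ideal p b; set Q := prime_ideal q c.
rewrite !class_powE => /esym/ideal_class_eq[y [_ _ PQ]].
have [PP QQ] := (prime_ideal_mul_conj p_split, prime_ideal_mul_conj q_split).
set z := y * q%:R ^+ g; have AE := principal_pow_mul_conj QQ PQ.
have QO' : ideal_conj Q `<=` O by rewrite -ideal_conj_integers => x /prime_ideal_sub_integers.
have Oz : O z.
  rewrite -[z]mulr1; apply: (_ : ideal_scale z O `<=` O); last by exists 1; first exact: (integers_nat 1).
  rewrite -AE -[X in _ `<=` X](integers_mul_ideal fractional_ideal_integers).
  by apply: ideal_mulS; apply: ideal_pow_sub_integers => //; apply: prime_ideal_sub_integers.
have z_norm := norm_of_generator p_gt0 q_gt0 PP QQ AE Oz.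
have [s [t [zE norm]]] := integers_norm_form sqf Oz z_norm.
exists `|s|%N, `|t|%N; split.
  by apply/eqP; rewrite -eqz_nat -norm PoszD PoszM -!abszX !gez0_abs ?sqr_ge0.
rewrite coprimeXr // coprime_sym coprimeMl !prime_coprime //; apply/andP; split.
  have : ideal_scale z O (beta b ^+ g * q%:R ^+ g).
    rewrite -AE; apply: mem_ideal_mul; apply: mem_ideal_pow; first exact: mem_ideal_span2r.
    by rewrite ideal_conj_prime; apply: mem_ideal_span2l.
  move=> [u Ou uE]; apply: (prime_ndvd_half_coef (q := q) g_gt1 p_split _ norm Ou).
    by rewrite dvdn_prime2.
  by rewrite -zE.
have : ideal_scale z^* O (beta c ^+ g * p%:R ^+ g).
  rewrite -[X in ideal_scale _ X]ideal_conj_integers -ideal_conj_scale -AE.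
  rewrite ideal_conj_mul !ideal_conj_pow ideal_conjK ideal_mulC; apply: mem_ideal_mul.
    by apply: mem_ideal_pow; apply: mem_ideal_span2r.
  by rewrite ideal_conj_prime; apply/mem_ideal_pow/mem_ideal_span2l.
move=> [u Ou uE]; rewrite -abszN; apply: (prime_ndvd_half_coef (q := p) (s := s) g_gt1 q_split _ _ Ou).
- by rewrite dvdn_prime2 // eq_sym.
- by rewrite sqrrN norm (mulnC q).
by rewrite -uE zE conj_quad_elt intrN mulNr.
Qed.
End ImaginaryQuadratic.

(** * Torsion and small split primes *)

Definition rep_pairs (g d : nat) (Q : seq nat) : nat :=
  (\sum_(p <- Q) \sum_(q <- Q) ((p != q) && `[< primitive_rep d ((p * q) ^ g) >]))%N.

Section Torsion.
Local Open Scope classical_set_scope.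
Variables (d g S : nat).
Hypotheses (sqf : squarefree d) (g_gt1 : (1 < g)%N) (dS : (4 * d < 3 * S ^ 2)%N).
Let torsion : set (set (set algC)) := [set C | class_group d C /\ class_pow d C g = principal_class d].
Let torsion_seq : seq (set (set algC)) := enum_fset (fset_set torsion).

Let d_gt0 : (0 < d)%N := squarefree_gt0 sqf.

Let torsionP C : C \in torsion_seq -> torsion C.
Proof.
have [r _ r_enum] := class_group_enum d_gt0 dS.
have torsion_finite : finite_set torsion.
  by apply: (@sub_finite_set _ _ [set` r]); [move=> C' [/r_enum]|apply: finite_seq].
by move=> C_tors; apply: set_mem; rewrite -(in_fset_set torsion_finite).
Qed.

Lemma class_torsion_le : (class_torsion g d <= class_bound d S)%N.
Proof.
have [r size_r r_enum] := class_group_enum d_gt0 dS; rewrite -size_r.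
by apply: (@uniq_leq_size _ torsion_seq) => [|C /torsionP[/r_enum]]; first exact: fset_uniq.
Qed.

Variable Q : seq nat.
Hypotheses (Q_uniq : uniq Q) (Q_splits : {in Q, forall p, exists b, splits_with d p b}).

(* Cauchy-Schwarz for the map (C, p) |-> C [P_p] from the torsion classes and
   the split primes to the class group. *)
Lemma class_torsion_split_le :
  (class_torsion g d * size Q ^ 2 <= class_bound d S * (size Q + rep_pairs g d Q))%N.
Proof.
have [r size_r r_enum] := class_group_enum d_gt0 dS; rewrite -size_r.
pose b p := xget 0%N [set b | splits_with d p b].
have b_splits p : p \in Q -> splits_with d p (b p) by move=> /Q_splits/(xgetPex 0%N).
pose P p := ideal_class d (prime_ideal d p (b p)).
have P_class p : p \in Q -> class_group d (P p).
  by move=> /b_splits[p_prime _ _ _]; apply/class_group_ideal_class/fractional_prime_ideal/prime_gt0.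
pose R p q := (p == q) || `[< primitive_rep d ((p * q) ^ g) >].
apply: leq_trans (_ : size r * (\sum_(p <- Q) count (R p) Q) <= _)%N.
  apply: (@product_collision_bound _ _ _ torsion_seq Q r (fun C p => class_mul C (P p)) R).
  - exact: fset_uniq.
  - by move=> C p /torsionP[C_class _] pQ; apply/r_enum/class_group_mul/P_class.
  - move=> p pQ C C' /torsionP[C_class _] /torsionP[C'_class _].
    exact: class_mulIr (P_class p pQ) C_class C'_class.
  move=> C C' /torsionP[_ C_tors] /torsionP[_ C'_tors] p q pQ qQ /(congr1 (fun A => class_pow d A g)).
  rewrite !class_pow_mul // C_tors C'_tors !principal_class_mul //; last 2 first.
  - by apply: class_group_pow => //; apply: P_class.
  - by apply: class_group_pow => //; apply: P_class.
  rewrite /R => pow_eq; case: eqVneq => //= pq; apply/asboolP.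
  exact: same_class_pow_primitive_rep (b_splits p pQ) (b_splits q qQ) pq pow_eq.
rewrite leq_mul2l -(sum1_size Q) -big_split /=; apply/orP; right.
rewrite big_seq [leqRHS]big_seq; apply: leq_sum => p pQ.
rewrite -[X in (_ <= X + _)%N](_ : count_mem p Q = 1%N); last by rewrite count_uniq_mem ?pQ.
rewrite -[count (R p) Q]sum_bool_count -[count_mem p Q]sum_bool_count -big_split /=.
apply: leq_sum => q _.
by rewrite /R [q == p]eq_sym; case: eqVneq; case: asboolP.
Qed.
End Torsion.

(** * Dyadic blocks of discriminants *)

Section Blocks.
Local Open Scope classical_set_scope.
Variable R : realType.
Implicit Types (e z : R) (D d n : nat).

Definition block D : seq nat := [seq d <- index_iota D (2 * D) | `[< squarefree d >]].

Lemma blockP D d : d \in block D -> (D <= d < 2 * D)%N /\ squarefree d.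
Proof. by rewrite mem_filter mem_index_iota => /andP[/asboolP]. Qed.

Lemma block_uniq D : uniq (block D).
Proof. by rewrite filter_uniq ?iota_uniq. Qed.

Lemma size_block_le D : (size (block D) <= D)%N.
Proof.
by rewrite size_filter (leq_trans (count_size _ _)) // size_iota mul2n -addnn addnK.
Qed.

Lemma near_class_bound e : 0 < e -> \forall D \near \oo, {in block D, forall d,
  exists2 S, (4 * d < 3 * S ^ 2)%N &
    (class_bound d S)%:R <= D%:R `^ (2^-1 + e) :> R}.
Proof.
move=> e0; have e20 : 0 < e / 2 by rewrite divr_gt0.
near=> D => d /blockP[/andP[Dd dD] _]; have D6 : (6 <= D)%N by near: D; apply: nbhs_infty_ge.
have D_gt0 : 0 < D%:R :> R by rewrite ltr0n (leq_trans _ D6).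
set t := Num.sqrt (D%:R : R); have t2 : t ^+ 2 = D%:R by rewrite sqr_sqrtr.
have t1 : 1 <= t by rewrite -[leLHS]sqrtr1 ler_sqrt // ler1n (leq_trans _ D6).
have t0 : 0 <= 2 * t by lra.
exists (Num.truncn (2 * t)).+1.
  have : 2 * t < (Num.truncn (2 * t)).+1%:R by apply: truncnS_gt.
  rewrite -(@ltr_pXn2r _ 2) ?nnegrE // exprMn t2 -!natrX -natrM ltr_nat.
  by move: ((Num.truncn (2 * t)).+1 ^ 2)%N dD => S2; rewrite -[(2 ^ 2)%N]/4%N; clear; lia.
have tau_D : forall n, (0 < n)%N -> n%:R <= D%:R `^ 2 :> R -> (tau n)%:R <= D%:R `^ (e / 2) :> R.
  by near: D; apply: near_tau_le.
rewrite /class_bound natr_sum; apply: le_trans (_ : (3 * t) * D%:R `^ (e / 2) <= _).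
  apply: le_trans (ler_sum_seq_const (c := D%:R `^ (e / 2)) _) _ => [b|].
    rewrite mem_index_iota /= ltnS truncn_ge_nat // => b_le; apply: tau_D.
      by rewrite addn_gt0 orbC (leq_trans _ Dd) ?(leq_trans _ D6).
    have b2 : (b ^ 2 <= 4 * D)%N.
      by rewrite -(ler_nat R) natrX natrM -t2; have := ler0n R b; nra.
    rewrite powR_mulrn // -natrX ler_nat (leq_trans (_ : _ <= 6 * D)%N) //.
      by move: (b ^ 2)%N b2 dD => ?; clear; lia.
    by rewrite expnS expn1 leq_mul2r D6 orbT.
  rewrite size_iota subn0 ler_wpM2r ?powR_ge0 // -natr1.
  by have : (Num.truncn (2 * t))%:R <= 2 * t by [rewrite truncn_le]; lra.
rewrite /t -mulrA -powR12_sqrt // -powRD_gt0 // {2}[e]splitr addrA.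
by near: D; apply: near_mul_powR_le.
Unshelve. all: end_near. Qed.

Lemma near_class_torsion_le g e : 0 < e -> \forall D \near \oo,
  {in block D, forall d, (class_torsion g d)%:R <= D%:R `^ (2^-1 + e) :> R}.
Proof.
move=> e0; near=> D => d dB; have [_ sqf] := blockP dB.
have /(_ d dB)[S dS] : {in block D, forall d, exists2 S, (4 * d < 3 * S ^ 2)%N &
    (class_bound d S)%:R <= D%:R `^ (2^-1 + e) :> R}.
  by near: D; apply: near_class_bound.
by apply: le_trans; rewrite ler_nat class_torsion_le.
Unshelve. all: end_near. Qed.

(** * Discriminants with few small split primes *)

Definition split_primes d (P : seq nat) : seq nat := [seq p <- P | quad_char d p == 1].

Lemma split_primes_splits d P : squarefree d -> {in P, forall p, prime p && odd p} ->
  {in split_primes d P, forall p, exists b, splits_with d p b}.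
Proof.
move=> sqf P_odd p; rewrite mem_filter => /andP[/eqP char1 /P_odd /andP[p_prime p_odd]].
exact: quad_char_splits.
Qed.

Definition exceptional z D : seq nat :=
  [seq d <- block D | 8 * size (split_primes d (primes_upto z D)) < size (primes_upto z D)]%N.

(* Few split primes and few ramified primes leave mostly inert ones. *)
Lemma quad_char_sum_large d (P : seq nat) : squarefree d -> uniq P ->
  {in P, forall p, prime p && odd p} ->
  (8 * size (split_primes d P) < size P)%N -> (4 * tau d <= size P)%N ->
  (size P)%:R <= 2 * `|\sum_(p <- P) quad_char d p|.
Proof.
move=> sqf P_uniq P_odd few_split tau_small.
pose num v := count (fun p => quad_char d p == v) P.
have sumE : \sum_(p <- P) quad_char d p = (num 1)%:Z - (num (-1))%:Z.
  rewrite /num; elim: (P) => [|p s IH]; first by rewrite big_nil.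
  rewrite big_cons IH /=; have := quad_char_signs d p.
  by rewrite !inE => /or3P[] /eqP -> /=; rewrite !PoszD; ring.
have sizeE : (size P = num 1%R + num (-1)%R + num 0%R)%N.
  rewrite /num; elim: (P) => // p s IH /=; rewrite {1}IH; have := quad_char_signs d p.
  by rewrite !inE => /or3P[] /eqP -> /=; clear; lia.
have ramified : (num 0%R <= tau d)%N.
  rewrite /num -size_filter; apply: uniq_leq_size; first by rewrite filter_uniq.
  move=> p; rewrite mem_filter => /andP[/eqP char0 /P_odd /andP[p_prime p_odd]].
  by rewrite -dvdn_divisors ?squarefree_gt0 //; apply: quad_char_ramified.
rewrite sumE natz; move: few_split; rewrite /split_primes size_filter -/(num 1).
by move: sizeE ramified tau_small; move: (size P) (num 1) (num (-1)) (num 0) (tau d); clear; lia.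
Qed.

Lemma large_sieve_exceptional z D m : ~~ odd m -> (0 < size (primes_upto z D))%N ->
  {in block D, forall d, 4 * tau d <= size (primes_upto z D)}%N ->
  (size (exceptional z D))%:R * (size (primes_upto z D))%:R ^+ m <=
    (4 * m)%:R ^+ m * ((D%:R `^ z) ^+ m + 1 + (size (exceptional z D))%:R * (32 * D%:R ^+ 2)) :> R.
Proof.
move=> m_even P_gt0 tau_small; set E := exceptional z D; set P := primes_upto z D.
have P_odd : {in P, forall p, prime p && odd p} by move=> p; rewrite mem_primes_upto => /and3P[-> ->].
have EP d : d \in E -> d \in block D /\ (8 * size (split_primes d P) < size P)%N.
  by rewrite mem_filter => /andP[].
set Z := Num.truncn (D%:R `^ z : R).
have sieve : (size E)%:R * (size P)%:R ^+ m <=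
    (4 * m)%:R ^+ m * ((Z ^ m).+1%:R + (size E)%:R * (8 * (2 * D) * (2 * D))%:R) :> int.
  apply: (@large_sieve _ _ quad_char quad_char1 quad_charM) => //.
  - by move=> d n; move: (quad_char_signs d n); rewrite !inE => /or3P[] /eqP->.
  - by rewrite filter_uniq ?block_uniq.
  - move=> d e /EP[/blockP[/andP[_ dD] sqd] _] /EP[/blockP[/andP[_ eD] sqe] _] de N.
    apply: le_trans (quad_char_correlation N sqd sqe de) _.
    by rewrite ler_nat !leq_mul // ltnW.
  - exact: odd_primes_uniq.
  - by move=> p /P_odd /andP[].
  - by move=> p; rewrite mem_odd_primes => /and3P[].
  move=> d /EP[dB few_split]; have [_ sqd] := blockP dB.
  by apply: quad_char_sum_large => //; [exact: odd_primes_uniq|exact: tau_small].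
have -> : 32 * D%:R ^+ 2 = (8 * (2 * D) * (2 * D))%:R :> R by rewrite !natrM; ring.
move: (4 * m)%N (8 * (2 * D) * (2 * D))%N sieve => M c.
rewrite -(ler_int R) !(rmorphM, rmorphD, rmorphXn) /= !rmorph_nat => /le_trans; apply.
apply: ler_wpM2l; first by rewrite exprn_ge0.
by rewrite -natr1 natrX !lerD2r lerXn2r ?nnegrE ?powR_ge0 // truncn_le powR_ge0.
Qed.
End Blocks.

Section BlockEstimates.
Local Open Scope classical_set_scope.
Variable R : realType.
Implicit Types (e z : R) (D d n : nat).

Lemma block_le_sqr D d : (2 <= D)%N -> d \in block D -> (0 < d)%N /\ d%:R <= D%:R `^ 2 :> R.
Proof.
move=> D2 /blockP[/andP[Dd dD] _]; split; first by rewrite (leq_trans _ Dd) // (leq_trans _ D2).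
by rewrite powR_mulrn // -natrX ler_nat (leq_trans (ltnW dD)) // expnS expn1 leq_mul2r D2 orbT.
Qed.

Lemma near_tau_le_primes_upto z : 0 < z -> \forall D \near \oo,
  {in block D, forall d, 4 * tau d <= size (primes_upto z D)}%N.
Proof.
move=> z0; have z40 : 0 < z / 4 by rewrite divr_gt0.
near=> D => d dB; have D2 : (2 <= D)%N by near: D; apply: nbhs_infty_ge.
have [d_gt0 d_le] := block_le_sqr D2 dB.
have tau_D : forall n, (0 < n)%N -> n%:R <= D%:R `^ 2 :> R -> (tau n)%:R <= D%:R `^ (z / 4) :> R.
  by near: D; apply: near_tau_le.
rewrite -(ler_nat R) natrM; apply: le_trans (_ : D%:R `^ (z - z / 2) <= _); last first.
  by near: D; apply: near_size_primes_upto_ge; rewrite ?divr_gt0.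
apply: (@le_trans _ _ (4 * D%:R `^ (z / 4))); first by rewrite ler_pM2l // tau_D.
have -> : z - z / 2 = z / 4 + z / 4 by field.
by near: D; apply: near_mul_powR_le.
Unshelve. all: end_near. Qed.

(* For m z >= 6 the second term of the large sieve is absorbed by its left-hand
   side, as [size (primes_upto z D) ^ m] exceeds [D ^ 3]. *)
Lemma near_size_exceptional_le z e : 0 < z -> 0 < e ->
  \forall D \near \oo, (size (exceptional z D))%:R <= D%:R `^ e.
Proof.
move=> z0 e0; pose m := (Num.truncn (3 / z)).+1.*2.
have mz : 6 <= m%:R * z.
  have : 3 / z < (Num.truncn (3 / z)).+1%:R by apply: truncnS_gt.
  by rewrite ltr_pdivrMr // /m -muln2 natrM; lra.
pose e' := Num.min (z / 2) (e / 2 / m%:R).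
have e'0 : 0 < e' by rewrite lt_min !divr_gt0.
have e'z : m%:R * e' <= m%:R * z / 2 by rewrite -mulrA ler_pM2l // ge_min lexx.
have e'm : m%:R * e' <= e / 2 by rewrite mulrC -ler_pdivlMr // ge_min lexx orbT.
pose M : R := (4 * m)%:R ^+ m; have M_gt0 : 0 < M by rewrite exprn_gt0 // ltr0n muln_gt0.
near=> D; have D_gt0 : (0 < D)%N by near: D; apply: nbhs_infty_ge.
have [D1 DR_gt0] : 1 <= D%:R :> R /\ 0 < D%:R :> R by rewrite ler1n ltr0n.
set x : R := (size _)%:R; pose P : R := (size (primes_upto z D))%:R.
have P_ge : D%:R `^ (z - e') <= P by rewrite /P; near: D; apply: near_size_primes_upto_ge.
have Pm_ge : D%:R `^ (m%:R * z - m%:R * e') <= P ^+ m.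
  by rewrite -mulrBr mulrC -powR_natX lerXn2r ?nnegrE ?powR_ge0 // ler0n.
have Pm_large : 64 * M * D%:R `^ 2 <= P ^+ m.
  apply: (@le_trans _ _ (D%:R `^ (2 + 1))); first by near: D; apply: near_mul_powR_le.
  by apply: le_trans Pm_ge; rewrite ler_powR //; lra.
have tau_small : {in block D, forall d, 4 * tau d <= size (primes_upto z D)}%N.
  by near: D; apply: near_tau_le_primes_upto.
have P_gt0 : (0 < size (primes_upto z D))%N.
  by rewrite -(ltr0n R); apply: lt_le_trans P_ge; apply: powR_gt0.
have := large_sieve_exceptional _ P_gt0 tau_small (m := m).
rewrite odd_double -/x -/P -/M powR_natX [z * _]mulrC -[D%:R ^+ 2]powR_mulrn // => /(_ isT) sieve.
have Dmz : 1 <= D%:R `^ (m%:R * z) by apply: powR_ge1 => //; lra.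
have absorbed : x * P ^+ m <= 4 * M * D%:R `^ (m%:R * z).
  have : x * (64 * M * D%:R `^ 2) <= x * P ^+ m by rewrite ler_wpM2l // ler0n.
  have : M * 1 <= M * D%:R `^ (m%:R * z) by rewrite ler_pM2l.
  by move: sieve; lra.
have x_le : x <= 4 * M * D%:R `^ (m%:R * e').
  rewrite -(ler_pM2r (powR_gt0 (m%:R * z - m%:R * e') DR_gt0)) -[leRHS]mulrA -powRD_gt0 //.
  by rewrite [m%:R * e' + _]addrC subrK; apply: le_trans absorbed; rewrite ler_wpM2l // ler0n.
apply: le_trans x_le _; apply: (@le_trans _ _ (4 * M * D%:R `^ (e / 2))).
  by apply: ler_wpM2l; [rewrite mulr_ge0 // ltW|rewrite ler_powR].
by rewrite {2}[e]splitr; near: D; apply: near_mul_powR_le; rewrite divr_gt0.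
Unshelve. all: end_near. Qed.

(** * Discriminants with many representations *)

Definition crowded (g : nat) z D : seq nat :=
  [seq d <- block D | D%:R `^ z < (rep_pairs g d (primes_upto z D))%:R :> R].

Lemma rep_pairs_filter g d (a : pred nat) (P : seq nat) :
  (rep_pairs g d [seq p <- P | a p] <= rep_pairs g d P)%N.
Proof.
have filter_le (f : nat -> nat) : (\sum_(p <- [seq p <- P | a p]) f p <= \sum_(p <- P) f p)%N.
  by rewrite big_filter; apply: (sub_le_big leqnn (fun x y => leq_addr y x)).
by apply: leq_trans (filter_le _); apply: leq_sum => p _; apply: filter_le.
Qed.

Lemma class_torsion_not_exceptional_le g z D d S : (1 < g)%N -> (4 * d < 3 * S ^ 2)%N ->
  d \in block D -> d \notin exceptional z D ->
  (class_torsion g d * size (primes_upto z D) ^ 2 <=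
   64 * (class_bound d S * (size (primes_upto z D) + rep_pairs g d (primes_upto z D))))%N.
Proof.
move=> g_gt1 dS dB; rewrite mem_filter dB andbT -leqNgt; set P := primes_upto z D => many_split.
have [_ sqf] := blockP dB.
have P_odd : {in P, forall p, prime p && odd p} by move=> p; rewrite mem_primes_upto => /and3P[-> ->].
have split_uniq : uniq (split_primes d P) by rewrite filter_uniq ?odd_primes_uniq.
have := class_torsion_split_le sqf g_gt1 dS split_uniq (split_primes_splits sqf P_odd).
set h := class_torsion g d => bound.
apply: (@leq_trans (h * (8 * size (split_primes d P)) ^ 2)%N).
  by rewrite leq_mul2l leq_sqr many_split orbT.
rewrite expnMn mulnCA leq_mul2l /=; apply: leq_trans bound _.
by rewrite leq_mul2l leq_add ?orbT ?rep_pairs_filter // size_filter count_size.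
Qed.

Lemma near_class_torsion_typical_le g z e : (1 < g)%N -> 0 < z -> 0 < e -> \forall D \near \oo,
  {in block D, forall d, d \notin exceptional z D -> d \notin crowded g z D ->
    (class_torsion g d)%:R <= D%:R `^ (2^-1 - z + e)}.
Proof.
move=> g_gt1 z0 e0; have e40 : 0 < e / 4 by rewrite divr_gt0.
near=> D => d dB not_exc; rewrite mem_filter dB andbT -leNgt => not_crowded.
have DR_gt0 : 0 < D%:R :> R by rewrite ltr0n; near: D; apply: nbhs_infty_ge.
have /(_ d dB)[S dS class_le] : {in block D, forall d, exists2 S, (4 * d < 3 * S ^ 2)%N &
    (class_bound d S)%:R <= D%:R `^ (2^-1 + e / 4) :> R}.
  by near: D; apply: near_class_bound.
have := class_torsion_not_exceptional_le g_gt1 dS dB not_exc.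
rewrite -(ler_nat R) natrM natrX natrM natrM natrD; set h : R := (class_torsion g d)%:R => bound.
have P_ge : D%:R `^ (z - e / 4) <= (size (primes_upto z D))%:R :> R.
  by near: D; apply: near_size_primes_upto_ge.
have P_le := size_primes_upto_le z D.
have {}bound : h * D%:R `^ (z - e / 4 + (z - e / 4)) <= 128 * D%:R `^ (2^-1 + e / 4 + z).
  rewrite (powRD_gt0 _ _ DR_gt0) [in leRHS]powRD_gt0 //.
  apply: (@le_trans _ _ (h * (size (primes_upto z D))%:R ^+ 2)).
    by rewrite ler_wpM2l ?ler0n // expr2 ler_pM ?powR_ge0.
  apply: le_trans bound _.
  set c : R := (\sum_(0 <= b < S) _)%:R; rewrite -/c in class_le.
  have PN_le : (size (primes_upto z D))%:R + (rep_pairs g d (primes_upto z D))%:R <= 2 * D%:R `^ z :> R.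
    lra.
  have : c * ((size (primes_upto z D))%:R + (rep_pairs g d (primes_upto z D))%:R) <=
      D%:R `^ (2^-1 + e / 4) * (2 * D%:R `^ z) by rewrite ler_pM ?addr_ge0 ?ler0n.
  lra.
rewrite -(ler_pM2r (powR_gt0 (z - e / 4 + (z - e / 4)) DR_gt0)) -powRD_gt0 //.
apply: le_trans bound _.
have -> : 2^-1 - z + e + (z - e / 4 + (z - e / 4)) = 2^-1 + e / 4 + z + e / 4 by field.
by near: D; apply: near_mul_powR_le.
Unshelve. all: end_near. Qed.
End BlockEstimates.

Section CrowdedEstimates.
Local Open Scope classical_set_scope.
Variables (R : realType) (g : nat) (z : R).
Hypotheses (g_gt0 : (0 < g)%N) (z_gt0 : 0 < z).
Implicit Types (e : R) (D d : nat).

Lemma prime_pair_pow_le D p q : p \in primes_upto z D -> q \in primes_upto z D ->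
  ((p * q) ^ g)%:R <= D%:R `^ (2 * g%:R * z).
Proof.
rewrite !mem_primes_upto => /and3P[_ _ pz] /and3P[_ _ qz].
have -> : 2 * g%:R * z = z * (2 * g)%:R by rewrite natrM; ring.
rewrite -powR_natX exprM expr2 natrX natrM; apply: lerXn2r.
- by rewrite nnegrE mulr_ge0.
- by rewrite nnegrE mulr_ge0 ?powR_ge0.
by apply: ler_pM.
Qed.

Lemma prime_pair_pow_gt1 D p q : p \in primes_upto z D -> q \in primes_upto z D ->
  (1 < (p * q) ^ g)%N.
Proof.
rewrite !mem_primes_upto => /and3P[p_prime _ _] /and3P[q_prime _ _].
by rewrite -(exp1n g) ltn_exp2r // (leq_trans (prime_gt1 p_prime)) // leq_pmulr // prime_gt0.
Qed.

Lemma near_size_primitive_reps_le e : 0 < e -> \forall D \near \oo,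
  {in primes_upto z D &, forall p q,
    (size [seq d <- block D | `[< primitive_rep d ((p * q) ^ g) >]])%:R <=
      D%:R `^ e * (D%:R `^ 2^-1 + D%:R `^ (g%:R * z - 2^-1))}.
Proof.
move=> e0; have e20 : 0 < e / 2 by rewrite divr_gt0.
near=> D => p q pP qP; have D_gt0 : (0 < D)%N by near: D; apply: nbhs_infty_ge.
have DR_gt0 : 0 < D%:R :> R by rewrite ltr0n.
set n := ((p * q) ^ g)%N; have n_le : n%:R <= D%:R `^ (2 * g%:R * z) := prime_pair_pow_le pP qP.
set E := [seq d <- block D | _]; pose T := Num.truncn (D%:R `^ (e / 2) : R).
have E_uniq : uniq E by rewrite filter_uniq ?block_uniq.
have E_rep : {in E, forall d, (D <= d < 2 * D)%N /\ primitive_rep d n}.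
  by move=> d; rewrite mem_filter => /andP[/asboolP d_rep /blockP[]].
have tau_T y : (0 < y)%N -> (y ^ 2 <= 4 * n)%N -> (tau (y ^ 2) <= T)%N.
  move=> y_gt0 y2; rewrite truncn_ge_nat ?powR_ge0 //.
  have tau_D : forall k, (0 < k)%N -> k%:R <= D%:R `^ (2 * g%:R * z + 1) :> R -> (tau k)%:R <= D%:R `^ (e / 2) :> R.
    by near: D; apply: near_tau_le; rewrite // addr_gt0 // !mulr_gt0 // ltr0n.
  apply: tau_D; rewrite ?expn_gt0 ?y_gt0 //.
  apply: (@le_trans _ _ (4 * D%:R `^ (2 * g%:R * z))); last by near: D; apply: near_mul_powR_le.
  by apply: (@le_trans _ _ (4 * n)%:R); [rewrite ler_nat|rewrite natrM ler_pM2l].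
apply: le_trans (size_primitive_reps_le R D_gt0 (prime_pair_pow_gt1 pP qP) E_uniq E_rep tau_T) _.
have sqrt_n : Num.sqrt n%:R <= D%:R `^ (g%:R * z).
  rewrite -powR12_sqrt // (_ : g%:R * z = 2 * g%:R * z * 2^-1); last by field.
  by rewrite powRrM; apply: ler_powRl; rewrite ?invr_ge0.
rewrite -[Num.sqrt D%:R]powR12_sqrt //; set a := D%:R `^ 2^-1.
have sqrt_ratio : Num.sqrt n%:R / a <= D%:R `^ (g%:R * z - 2^-1).
  by rewrite powRD_gt0 // powRN ler_pM2r ?invr_gt0 ?powR_gt0.
set b := D%:R `^ (g%:R * z - 2^-1) in sqrt_ratio *.
have [a_ge0 b_ge0] : 0 <= a /\ 0 <= b by rewrite !powR_ge0.
apply: (@le_trans _ _ (D%:R `^ (e / 2) * (8 * (a + b)))).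
  apply: ler_pM; rewrite ?ler0n ?addr_ge0 ?mulr_ge0 ?invr_ge0 ?sqrtr_ge0 //.
    by rewrite truncn_le powR_ge0.
  by lra.
rewrite mulrA ler_wpM2r ?addr_ge0 // mulrC {2}[e]splitr.
by near: D; apply: near_mul_powR_le.
Unshelve. all: end_near. Qed.

Lemma near_sum_rep_pairs_le e : 0 < e -> \forall D \near \oo,
  (\sum_(d <- block D) rep_pairs g d (primes_upto z D))%:R <=
    D%:R `^ (2 * z + e) * (D%:R `^ 2^-1 + D%:R `^ (g%:R * z - 2^-1)) :> R.
Proof.
move=> e0; near=> D; have DR_gt0 : 0 < D%:R :> R by rewrite ltr0n; near: D; apply: nbhs_infty_ge.
set P := primes_upto z D; set B := D%:R `^ 2^-1 + _.
have B_ge0 : 0 <= B by rewrite addr_ge0 ?powR_ge0.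
have pair_le : {in P &, forall p q,
    (size [seq d <- block D | `[< primitive_rep d ((p * q) ^ g) >]])%:R <= D%:R `^ e * B}.
  by rewrite /P /B; near: D; apply: near_size_primitive_reps_le.
have -> : (\sum_(d <- block D) rep_pairs g d P = \sum_(p <- P) \sum_(q <- P)
    \sum_(d <- block D) ((p != q) && `[< primitive_rep d ((p * q) ^ g) >]))%N.
  by rewrite exchange_big; apply: eq_bigr => p _; rewrite exchange_big.
have inner_le p q : p \in P -> q \in P ->
    (\sum_(d <- block D) ((p != q) && `[< primitive_rep d ((p * q) ^ g) >]))%:R <= D%:R `^ e * B.
  move=> pP qP; apply: le_trans (pair_le p q pP qP); rewrite ler_nat sum_bool_count size_filter.
  by apply: sub_count => d /andP[].
rewrite natr_sum; apply: (@le_trans _ _ ((size P)%:R * ((size P)%:R * (D%:R `^ e * B)))).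
  apply: ler_sum_seq_const => p pP; rewrite natr_sum.
  by apply: ler_sum_seq_const => q qP; apply: inner_le.
rewrite mulrA powRD_gt0 // -[leRHS]mulrA ler_wpM2r ?mulr_ge0 ?powR_ge0 //.
rewrite (_ : 2 * z = z + z); last by ring.
by rewrite powRD_gt0 //; apply: ler_pM; rewrite ?size_primes_upto_le.
Unshelve. all: end_near. Qed.

Lemma near_size_crowded_le e : 0 < e -> \forall D \near \oo,
  (size (crowded g z D))%:R <= D%:R `^ (z + e) * (D%:R `^ 2^-1 + D%:R `^ (g%:R * z - 2^-1)).
Proof.
move=> e0; near=> D; have DR_gt0 : 0 < D%:R :> R by rewrite ltr0n; near: D; apply: nbhs_infty_ge.
have sum_le : (\sum_(d <- block D) rep_pairs g d (primes_upto z D))%:R <=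
    D%:R `^ (2 * z + e) * (D%:R `^ 2^-1 + D%:R `^ (g%:R * z - 2^-1)) :> R.
  by near: D; apply: near_sum_rep_pairs_le.
rewrite -(ler_pM2l (powR_gt0 z DR_gt0)) mulrA -powRD_gt0 // addrA -mulr2n -[z *+ 2]mulr_natl.
apply: le_trans sum_le; rewrite size_filter -sum_bool_count !natr_sum mulr_sumr.
apply: ler_sum => d _; case: ltP => [/ltW|_]; first by rewrite mulr1.
by rewrite mulr0.
Unshelve. all: end_near. Qed.

(* A representation of 4 (p q)^g with y > 0 forces d <= 4 (p q)^g < D. *)
Lemma near_crowded_nil : 2 * g%:R * z < 1 -> \forall D \near \oo, crowded g z D = [::].
Proof.
move=> gz; have gap : 0 < 1 - 2 * g%:R * z by rewrite subr_gt0.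
near=> D; have DR_gt0 : 0 < D%:R :> R by rewrite ltr0n; near: D; apply: nbhs_infty_ge.
apply/eqP; rewrite -(negbK (_ == _)) -has_filter; apply/hasPn => d /blockP[/andP[Dd _] _].
rewrite -leNgt [rep_pairs _ _ _](_ : _ = 0%N) ?powR_ge0 // /rep_pairs.
rewrite big_seq big1 // => p pP; rewrite big_seq big1 // => q qP.
apply/eqP; rewrite eqb0 negb_and negbK; apply/orP; right; apply/asboolPn => -[x [y [rep y_co]]].
have y_gt0 : (0 < y)%N.
  by rewrite lt0n; apply: contraTneq y_co => ->; rewrite /coprime gcd0n gtn_eqF ?(prime_pair_pow_gt1 pP qP).
have D_le : (D <= 4 * (p * q) ^ g)%N.
  by rewrite rep (leq_trans Dd) // (leq_trans _ (leq_addl _ _)) // leq_pmulr // expn_gt0 y_gt0.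
have : D%:R <= 4 * D%:R `^ (2 * g%:R * z).
  apply: (@le_trans _ _ (4 * (p * q) ^ g)%:R); first by rewrite ler_nat.
  by rewrite natrM ler_pM2l // prime_pair_pow_le.
have D5 : 5 <= D%:R `^ (1 - 2 * g%:R * z) by near: D; apply: near_powR_ge.
have D_eq : D%:R = D%:R `^ (1 - 2 * g%:R * z) * D%:R `^ (2 * g%:R * z) :> R.
  by rewrite -powRD_gt0 // subrK powRr1 // ltW.
by rewrite {1}D_eq ler_pM2r ?powR_gt0 //; move: D5; lra.
Unshelve. all: end_near. Qed.
End CrowdedEstimates.

(** * The exponents *)

Section MomentExponent.
Variables (R : realType) (g : nat) (k : R).
Hypotheses (g_gt1 : (1 < g)%N) (k_ge1 : 1 <= k).
Implicit Type z : R.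

Definition exponent_low : R := 1 + k * ((g%:R - 2) / (2 * g%:R + 2)).
Definition exponent_mid : R := 1 + k * ((g%:R - 1) / (2 * g%:R)) - (g%:R - 1) / (2 * g%:R).
Definition moment_exponent : R := Num.max (k / 2) (Num.max exponent_low exponent_mid).

(* Primes up to D ^ top_scale are used; there, the bounds for the generic and
   for the crowded discriminants agree. *)
Definition top_scale : R := 3 / (2 * g%:R + 2).

Let g_ge2 : 2 <= g%:R :> R.
Proof. by rewrite ler_nat. Qed.

Let denominators_neq0 : [/\ g%:R != 0 :> R, g%:R + 1 != 0 :> R & 2 * g%:R + 2 != 0 :> R].
Proof. by split; rewrite gt_eqF //; have := g_ge2; lra. Qed.

Lemma top_scale_gt0 : 0 < top_scale.
Proof. by rewrite divr_gt0 //; have := g_ge2; lra. Qed.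

Lemma moment_exponent_ge :
  [/\ k / 2 <= moment_exponent, exponent_low <= moment_exponent & exponent_mid <= moment_exponent].
Proof. by rewrite /moment_exponent !le_max !lexx !orbT. Qed.

Lemma moment_exponent_gt0 : 0 < moment_exponent.
Proof. by have [half_le _ _] := moment_exponent_ge; apply: lt_le_trans half_le; have := k_ge1; lra. Qed.

Lemma generic_exponent_le : 1 + k * (2^-1 - top_scale) <= moment_exponent.
Proof.
have [_ low_le _] := moment_exponent_ge.
by rewrite (_ : 1 + _ = exponent_low) // /exponent_low /top_scale; field.
Qed.

Lemma crowded_exponent_mid_le z : 1 <= 2 * g%:R * z -> k * (2^-1 - z) + z + 2^-1 <= moment_exponent.
Proof.
move=> gz; have [_ _] := moment_exponent_ge; apply: le_trans; have [g_neq0 _ _] := denominators_neq0.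
have -> : exponent_mid = k / 2 + 2^-1 - (k - 1) / (2 * g%:R) by rewrite /exponent_mid; field.
suff : (k - 1) / (2 * g%:R) <= (k - 1) * z by lra.
apply: ler_wpM2l; first by have := k_ge1; lra.
by rewrite -div1r ler_pdivrMr ?mulr_gt0 ?(lt_le_trans _ g_ge2) // mulrC.
Qed.

Lemma crowded_exponent_low_le z : 0 < z <= top_scale ->
  k * (2^-1 - z) + z + (g%:R * z - 2^-1) <= moment_exponent.
Proof.
move=> /andP[z0 z_le]; have [half_le low_le _] := moment_exponent_ge.
have [kg|kg] := leP k (g%:R + 1).
  apply: le_trans low_le.
  have -> : exponent_low = k / 2 - 2^-1 + (g%:R + 1 - k) * top_scale.
    by rewrite /exponent_low /top_scale; field.
  have : (g%:R + 1 - k) * z <= (g%:R + 1 - k) * top_scale by rewrite ler_wpM2l // subr_ge0.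
  by lra.
apply: le_trans half_le.
have : (g%:R + 1 - k) * z <= 0 by rewrite mulr_le0_ge0 ?(ltW z0) // subr_le0 ltW.
by lra.
Qed.

Lemma exponent_mid_sub_half : exponent_mid - k / 2 = (g%:R + 1 - k) / (2 * g%:R).
Proof. by have [g_neq0 _ _] := denominators_neq0; rewrite /exponent_mid; field. Qed.

Lemma exponent_low_sub_half : exponent_low - k / 2 = (2 * g%:R + 2 - 3 * k) / (2 * g%:R + 2).
Proof. by rewrite /exponent_low; field. Qed.

Lemma exponent_low_sub_mid :
  exponent_low - exponent_mid = (g%:R ^+ 2 - 1 - k * (2 * g%:R - 1)) / (2 * g%:R * (g%:R + 1)).
Proof.
have [g_neq0 g1_neq0 low_den_neq0] := denominators_neq0; rewrite /exponent_low /exponent_mid; field.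
by rewrite g_neq0 g1_neq0 low_den_neq0.
Qed.

Let denominator_gt0 : 0 < 2 * g%:R - 1 :> R.
Proof. by have := g_ge2; lra. Qed.

Lemma moment_exponent_lowE : k <= (g%:R ^+ 2 - 1) / (2 * g%:R - 1) -> moment_exponent = exponent_low.
Proof.
rewrite ler_pdivlMr ?denominator_gt0 // => kg.
have mid_le : exponent_mid <= exponent_low.
  by rewrite -subr_ge0 exponent_low_sub_mid mulr_ge0 // subr_ge0.
have half_le : k / 2 <= exponent_low.
  rewrite -subr_ge0 exponent_low_sub_half mulr_ge0 // -(pmulr_lge0 _ denominator_gt0).
  have -> : (2 * g%:R + 2 - 3 * k) * (2 * g%:R - 1) =
     3 * (g%:R ^+ 2 - 1 - k * (2 * g%:R - 1)) + (g%:R + 1) ^+ 2 by ring.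
  by rewrite addr_ge0 ?sqr_ge0 // mulr_ge0 // subr_ge0.
by rewrite /moment_exponent (max_l mid_le) max_r.
Qed.

Lemma moment_exponent_midE : (g%:R ^+ 2 - 1) / (2 * g%:R - 1) <= k <= g%:R + 1 ->
  moment_exponent = exponent_mid.
Proof.
rewrite ler_pdivrMr ?denominator_gt0 // => /andP[gk kg].
have half_le : k / 2 <= exponent_mid.
  by rewrite -subr_ge0 exponent_mid_sub_half mulr_ge0 // subr_ge0.
have low_le : exponent_low <= exponent_mid.
  by rewrite -subr_le0 exponent_low_sub_mid mulr_le0_ge0 // subr_le0.
by rewrite /moment_exponent (max_r low_le) max_r.
Qed.

Lemma moment_exponent_halfE : g%:R + 1 <= k -> moment_exponent = k / 2.
Proof.
move=> gk; have g2 := g_ge2.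
have mid_le : exponent_mid <= k / 2.
  by rewrite -subr_le0 exponent_mid_sub_half mulr_le0_ge0 // subr_le0.
have low_le : exponent_low <= k / 2.
  by rewrite -subr_le0 exponent_low_sub_half mulr_le0_ge0 //; lra.
by rewrite /moment_exponent max_l // ge_max low_le.
Qed.
End MomentExponent.

(** * Moments over dyadic blocks *)

Section BlockMoment.
Local Open Scope classical_set_scope.
Variables (R : realType) (g : nat) (k : R).
Hypotheses (g_gt1 : (1 < g)%N) (k_ge1 : 1 <= k).
Implicit Types (e z : R) (D d j J : nat).

Let k_gt0 : 0 < k := lt_le_trans ltr01 k_ge1.

(* Either no grid point is bad for h, or h is bounded by the last grid point
   before the first bad one. *)
Lemma grid_powR_le (h : R) (B : nat -> R) (exc crowd : nat -> bool) J : 0 <= h -> h <= B 0%N ->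
  (forall j, (0 < j <= J)%N -> ~~ exc j -> ~~ crowd j -> h <= B j) ->
  h `^ k <= B J `^ k + \sum_(j < J) ((exc j.+1)%:R * B 0%N `^ k + (crowd j.+1)%:R * B j `^ k).
Proof.
move=> h0 hB0; have mono j : h <= B j -> h `^ k <= B j `^ k by apply: ler_powRl; rewrite ?(ltW k_gt0).
have sum_ge0 n : 0 <= \sum_(j < n) ((exc j.+1)%:R * B 0%N `^ k + (crowd j.+1)%:R * B j `^ k).
  by apply: sumr_ge0 => j _; rewrite addr_ge0 ?mulr_ge0 ?powR_ge0.
elim: J => [|J IH] hB; first by rewrite big_ord0 addr0; apply: mono.
have B_ge0 j : 0 <= B j `^ k by apply: powR_ge0.
rewrite big_ord_recr /=; case exc_J : (exc J.+1).
  have := mono _ hB0; have := B_ge0 J.+1; have := sum_ge0 J.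
  have : 0 <= (crowd J.+1)%:R * B J `^ k by rewrite mulr_ge0.
  by rewrite mul1r; lra.
case crowd_J : (crowd J.+1).
  have : h `^ k <= B J `^ k + \sum_(j < J) ((exc j.+1)%:R * B 0%N `^ k + (crowd j.+1)%:R * B j `^ k).
    by apply: IH => j /andP[j0 jJ]; apply: hB; rewrite j0 leqW.
  by have := B_ge0 J.+1; rewrite mul0r mul1r; lra.
have : h `^ k <= B J.+1 `^ k by apply: mono; apply: hB; rewrite ?exc_J ?crowd_J ?ltnS ?leqnn.
by have := sum_ge0 J; rewrite !mul0r; lra.
Qed.

Lemma near_block_moment_grid_le (zf : nat -> R) J e : zf 0%N = 0 -> (forall j, 0 < zf j.+1) -> 0 < e ->
  \forall D \near \oo, \sum_(d <- block D) (class_torsion g d)%:R `^ k <=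
    (size (block D))%:R * D%:R `^ (2^-1 - zf J + e) `^ k +
    \sum_(j < J) ((size (exceptional (zf j.+1) D))%:R * D%:R `^ (2^-1 + e) `^ k +
                  (size (crowded g (zf j.+1) D))%:R * D%:R `^ (2^-1 - zf j + e) `^ k).
Proof.
move=> zf0 zf_gt0 e0; near=> D.
have trivial_le : {in block D, forall d, (class_torsion g d)%:R <= D%:R `^ (2^-1 + e) :> R}.
  by near: D; apply: near_class_torsion_le.
have typical_le : forall j : 'I_J, {in block D, forall d, d \notin exceptional (zf j.+1) D ->
    d \notin crowded g (zf j.+1) D -> (class_torsion g d)%:R <= D%:R `^ (2^-1 - zf j.+1 + e)}.
  by near: D; apply: filter_forall => j; apply: near_class_torsion_typical_le.
have count_le (a : pred nat) : \sum_(d <- block D) (a d)%:R = (count a (block D))%:R :> R.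
  by rewrite -natr_sum sum_bool_count.
pose exc j d := d \in exceptional (zf j) D; pose crowd j d := d \in crowded g (zf j) D.
apply: (@le_trans _ _ (\sum_(d <- block D) (D%:R `^ (2^-1 - zf J + e) `^ k +
    \sum_(j < J) ((exc j.+1 d)%:R * D%:R `^ (2^-1 + e) `^ k +
                  (crowd j.+1 d)%:R * D%:R `^ (2^-1 - zf j + e) `^ k)))).
  rewrite big_seq [leRHS]big_seq; apply: ler_sum => d dB.
  have := @grid_powR_le (class_torsion g d)%:R (fun j => D%:R `^ (2^-1 - zf j + e))
    (exc^~ d) (crowd^~ d) J.
  rewrite zf0 subr0; apply=> //; first exact: trivial_le.
  by case=> // j jJ; apply: (typical_le (Ordinal jJ)).
rewrite big_split /= big_const_seq count_predT iter_addr_0 -[X in X + _]mulr_natl lerD2l exchange_big /=.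
have count_mem_le (s : seq nat) : (count [in s] (block D) <= size s)%N.
  rewrite -size_filter; apply: uniq_leq_size; first by rewrite filter_uniq ?block_uniq.
  by move=> d; rewrite mem_filter => /andP[].
apply: ler_sum => j _; rewrite big_split /=.
apply: lerD; rewrite -mulr_suml ler_wpM2r ?powR_ge0 // count_le ler_nat; apply: count_mem_le.
Unshelve. all: end_near. Qed.

Lemma near_crowded_term_le z step e : 0 < z <= top_scale R g -> 0 < e ->
  \forall D \near \oo,
    (size (crowded g z D))%:R * D%:R `^ (2^-1 - (z - step) + e) `^ k <=
      2 * D%:R `^ (moment_exponent g k + (k + 1) * e + k * step).
Proof.
move=> z_range e0; have /andP[z0 _] := z_range.
have [gz|gz] := ltP (2 * g%:R * z) 1.
  near=> D; rewrite (_ : crowded g z D = [::]) ?mul0r ?mulr_ge0 ?powR_ge0 //.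
  by near: D; apply: near_crowded_nil; rewrite // ltnW.
near=> D; have D_gt0 : (0 < D)%N by near: D; apply: nbhs_infty_ge.
have [D1 DR_gt0] : 1 <= D%:R :> R /\ 0 < D%:R :> R by rewrite ler1n ltr0n.
have crowded_le : (size (crowded g z D))%:R <=
    D%:R `^ (z + e) * (D%:R `^ 2^-1 + D%:R `^ (g%:R * z - 2^-1)) :> R.
  by near: D; apply: near_size_crowded_le; rewrite // ltnW.
apply: le_trans (ler_wpM2r (powR_ge0 _ _) crowded_le) _.
rewrite -powRrM mulrAC -powRD_gt0 // mulrDr -!powRD_gt0 //.
set T := D%:R `^ (_ + k * step); have -> : 2 * T = T + T by ring.
apply: lerD; rewrite ler_powR //.
  by have := crowded_exponent_mid_le g_gt1 k_ge1 gz; lra.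
by have := crowded_exponent_low_le k z_range; lra.
Unshelve. all: end_near. Qed.

Lemma generic_term_le D e : (0 < D)%N -> 0 <= e ->
  (size (block D))%:R * D%:R `^ (2^-1 - top_scale R g + e) `^ k <=
    D%:R `^ (moment_exponent g k + (k + 1) * e).
Proof.
move=> D_gt0 e0; have [D1 DR_gt0] : 1 <= D%:R :> R /\ 0 < D%:R :> R by rewrite ler1n ltr0n.
apply: (@le_trans _ _ (D%:R * D%:R `^ (2^-1 - top_scale R g + e) `^ k)).
  by rewrite ler_wpM2r ?powR_ge0 // ler_nat size_block_le.
rewrite -powRrM -{1}[D%:R]powRr1 // -powRD_gt0 // ler_powR //.
by have := generic_exponent_le g k; lra.
Qed.

Lemma near_exceptional_term_le z e : 0 < z -> 0 < e -> \forall D \near \oo,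
  (size (exceptional z D))%:R * D%:R `^ (2^-1 + e) `^ k <=
    D%:R `^ (moment_exponent g k + (k + 1) * e).
Proof.
move=> z0 e0; near=> D; have D_gt0 : (0 < D)%N by near: D; apply: nbhs_infty_ge.
have [D1 DR_gt0] : 1 <= D%:R :> R /\ 0 < D%:R :> R by rewrite ler1n ltr0n.
have exc_le : (size (exceptional z D))%:R <= D%:R `^ e.
  by near: D; apply: near_size_exceptional_le.
apply: le_trans (ler_wpM2r (powR_ge0 _ _) exc_le) _.
rewrite -powRrM -powRD_gt0 // ler_powR //.
by have [half_le _ _] := moment_exponent_ge g k; lra.
Unshelve. all: end_near. Qed.

Lemma near_block_moment_grid_size_le J e : (0 < J)%N -> 0 < e -> \forall D \near \oo,
  \sum_(d <- block D) (class_torsion g d)%:R `^ k <=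
    (1 + 3 * J%:R) * D%:R `^ (moment_exponent g k + (k + 1) * e + k * (top_scale R g / J%:R)).
Proof.
move=> J_gt0 e0; set A := moment_exponent g k; have top0 := top_scale_gt0 R g.
pose step := top_scale R g / J%:R; rewrite -/step; have J0 : 0 < J%:R :> R by rewrite ltr0n.
have step0 : 0 < step by rewrite divr_gt0.
pose zf j := j%:R * step; have zfJ : zf J = top_scale R g by rewrite /zf mulrC divfK // gt_eqF.
have zf_range (j : 'I_J) : 0 < zf j.+1 <= top_scale R g.
  by rewrite mulr_gt0 //= -zfJ ler_pM2r // ler_nat.
near=> D; have D_gt0 : (0 < D)%N by near: D; apply: nbhs_infty_ge.
have grid_le : \sum_(d <- block D) (class_torsion g d)%:R `^ k <=
    (size (block D))%:R * D%:R `^ (2^-1 - zf J + e) `^ k +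
    \sum_(j < J) ((size (exceptional (zf j.+1) D))%:R * D%:R `^ (2^-1 + e) `^ k +
                  (size (crowded g (zf j.+1) D))%:R * D%:R `^ (2^-1 - zf j + e) `^ k).
  near: D; apply: near_block_moment_grid_le => // [|j]; first by rewrite /zf mul0r.
  by rewrite mulr_gt0.
have exc_le : forall j : 'I_J, (size (exceptional (zf j.+1) D))%:R * D%:R `^ (2^-1 + e) `^ k <=
    D%:R `^ (A + (k + 1) * e).
  near: D; apply: filter_forall => j; apply: near_exceptional_term_le => //.
  by have /andP[] := zf_range j.
have crowd_le : forall j : 'I_J,
    (size (crowded g (zf j.+1) D))%:R * D%:R `^ (2^-1 - (zf j.+1 - step) + e) `^ k <=
      2 * D%:R `^ (A + (k + 1) * e + k * step).
  by near: D; apply: filter_forall => j; apply: near_crowded_term_le.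
have pow_le : D%:R `^ (A + (k + 1) * e) <= D%:R `^ (A + (k + 1) * e + k * step).
  by rewrite ler_powR ?ler1n // lerDl mulr_ge0 // ltW.
apply: le_trans grid_le _; rewrite zfJ mulrDl mul1r; apply: lerD.
  exact: le_trans (generic_term_le D_gt0 (ltW e0)) pow_le.
apply: (@le_trans _ _ (\sum_(j < J) 3 * D%:R `^ (A + (k + 1) * e + k * step))).
  apply: ler_sum => j _; have -> : zf j = zf j.+1 - step by rewrite /zf -natr1; ring.
  apply: le_trans (lerD (le_trans (exc_le j) pow_le) (crowd_le j)) _.
  by rewrite -[X in X + _]mul1r -mulrDl.
by rewrite sumr_const card_ord -[leLHS]mulr_natl mulrCA mulrA.
Unshelve. all: end_near. Qed.

Lemma near_block_moment_le del : 0 < del -> \forall D \near \oo,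
  \sum_(d <- block D) (class_torsion g d)%:R `^ k <= D%:R `^ (moment_exponent g k + del).
Proof.
move=> del0; pose J := (Num.truncn (4 * k * top_scale R g / del)).+1.
pose e := del / 4 / (k + 1); have e0 : 0 < e by rewrite !divr_gt0 // addr_gt0.
have ke : (k + 1) * e = del / 4 by rewrite mulrC divfK // gt_eqF // addr_gt0.
have kJ : k * (top_scale R g / J%:R) <= del / 4.
  have : 4 * k * top_scale R g / del < J%:R by apply: truncnS_gt.
  by rewrite ltr_pdivrMr // mulrA ler_pdivrMr ?ltr0n //; lra.
near=> D; have D_gt0 : (0 < D)%N by near: D; apply: nbhs_infty_ge.
apply: (@le_trans _ _ ((1 + 3 * J%:R) * D%:R `^ (moment_exponent g k + del / 2))); last first.
  by rewrite {2}[del]splitr addrA; near: D; apply: near_mul_powR_le; rewrite divr_gt0.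
apply: (@le_trans _ _ ((1 + 3 * J%:R) *
    D%:R `^ (moment_exponent g k + (k + 1) * e + k * (top_scale R g / J%:R)))).
  by near: D; apply: near_block_moment_grid_size_le.
rewrite ler_wpM2l ?addr_ge0 ?mulr_ge0 // ler_powR ?ler1n //.
by rewrite ke; lra.
Unshelve. all: end_near. Qed.
End BlockMoment.

(** * Summation over dyadic blocks *)

Lemma ler_sum_seq_subset (I : eqType) (R : numDomainType) (s t : seq I) (F : I -> R) :
  uniq s -> {subset s <= t} -> (forall x, 0 <= F x) -> \sum_(x <- s) F x <= \sum_(x <- t) F x.
Proof.
move=> + + F0; elim: s t => [|x s IH] t; first by rewrite big_nil => _ _; apply: sumr_ge0.
rewrite cons_uniq => /andP[x_s s_uniq] st; have xt : x \in t by apply: st; rewrite mem_head.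
rewrite (perm_big _ (perm_to_rem xt)) !big_cons lerD2l; apply: IH => // y ys.
have := st y; rewrite inE ys orbT => /(_ isT); rewrite (perm_mem (perm_to_rem xt)) inE.
by case/orP => // /eqP yx; rewrite -yx ys in x_s.
Qed.

Section DyadicSum.
Local Open Scope classical_set_scope.
Variable R : realType.
Implicit Types (k a X eps : R).

Lemma torsion_moment_le_dyadic g k X : 0 <= X ->
  torsion_moment g k X <= \sum_(0 <= n < (trunc_log 2 (Num.truncn X)).+1)
    \sum_(d <- block (2 ^ n)) (class_torsion g d)%:R `^ k.
Proof.
move=> X0; rewrite /torsion_moment; set A : set nat := (X in \sum_(d \in X) _).
have A_finite : finite_set A.
  apply: (@sub_finite_set _ _ [set` iota 0 (Num.truncn X).+1]); last exact: finite_seq.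
  move=> d [_ _ dX]; change (d \in iota 0 (Num.truncn X).+1).
  by rewrite mem_iota add0n ltnS truncn_ge_nat // ltW.
rewrite fsbig_finite //; set N := _.+1.
pose t := flatten [seq block (2 ^ n) | n <- index_iota 0 N].
have -> : \sum_(0 <= n < N) \sum_(d <- block (2 ^ n)) (class_torsion g d)%:R `^ k =
    \sum_(d <- t) (class_torsion g d)%:R `^ k by rewrite /t big_flatten big_map.
apply: ler_sum_seq_subset; [exact: finmap.fset_uniq| |by move=> d; apply: powR_ge0].
move=> d; rewrite in_fset_set // inE => -[d0 d_sqf dX].
apply/flatten_mapP; exists (trunc_log 2 d).
  rewrite mem_index_iota /N /= ltnS; apply: leq_trunc_log.
  by rewrite truncn_ge_nat // ltW.
rewrite mem_filter mem_index_iota; have := trunc_log_bounds (isT : 1 < 2)%N d0.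
by rewrite /= expnS => ->; rewrite andbT; apply/asboolP.
Qed.

Lemma sum_geometric_le (x : R) N : 1 < x -> \sum_(0 <= n < N.+1) x ^+ n <= x / (x - 1) * x ^+ N.
Proof.
move=> x1; have x1' : 0 < x - 1 by rewrite subr_gt0.
rewrite mulrAC ler_pdivlMr // mulrC big_mkord -subrX1 -exprS.
by rewrite lerBlDr lerDl.
Qed.

Lemma sum_dyadic_le (f : nat -> R) a : 0 < a -> (\forall D \near \oo, f D <= D%:R `^ a) ->
  exists2 C, 0 < C & forall N, \sum_(0 <= n < N.+1) f (2 ^ n)%N <= C * (2 ^ N)%:R `^ a.
Proof.
move=> a0 [n0 _ f_le]; pose r : R := 2 `^ a.
have r1 : 1 < r by have := gt0_ltr_powR a0 _ _ (ltr1n R 2); rewrite powR1; apply; rewrite nnegrE.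
have powE n : (2 ^ n)%:R `^ a = r ^+ n :> R.
  by rewrite natrX powR_natX -powR_mulrn // -powRrM mulrC.
pose S := 1 + \sum_(n < n0) `|f (2 ^ n)%N|.
have sum_ge0 : 0 <= \sum_(n < n0) `|f (2 ^ n)%N| by apply: sumr_ge0.
have term_le n : f (2 ^ n)%N <= S * r ^+ n.
  have rn1 : 1 <= r ^+ n by rewrite exprn_ege1 // ltW.
  have [n_lt|n_ge] := ltnP n n0.
    apply: (@le_trans _ _ S); last by rewrite ler_peMr // addr_ge0.
    rewrite /S (bigD1 (Ordinal n_lt)) //= addrCA; apply: le_trans (ler_norm _) _.
    by rewrite lerDl addr_ge0 // sumr_ge0.
  apply: le_trans (f_le _ _) _; first exact: leq_trans n_ge (ltnW (ltn_expl _ _)).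
  by rewrite powE ler_peMl ?exprn_ge0 ?powR_ge0 // /S lerDl.
exists (S * (r / (r - 1))).
  by rewrite mulr_gt0 ?ltr_pwDl // divr_gt0 ?subr_gt0 // (lt_trans ltr01).
move=> N; rewrite powE -mulrA.
apply: le_trans (ler_wpM2l _ (sum_geometric_le N r1)); last by rewrite /S addr_ge0.
by rewrite mulr_sumr; apply: ler_sum.
Qed.

Lemma torsion_moment_le g k eps : (1 < g)%N -> 1 <= k -> 0 < eps ->
  exists2 C, 0 < C & forall X, 2 <= X ->
    torsion_moment g k X <= C * X `^ (moment_exponent g k + eps).
Proof.
move=> g_gt1 k_ge1 eps0; have exponent_gt0 : 0 < moment_exponent g k + eps.
  by rewrite addr_gt0 // moment_exponent_gt0.
have [C C0 sum_le] := sum_dyadic_le exponent_gt0 (near_block_moment_le g_gt1 k_ge1 eps0).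
exists C => // X X2; have X0 : 0 <= X by apply: le_trans X2.
apply: le_trans (torsion_moment_le_dyadic g k X0) _; apply: le_trans (sum_le _) _.
rewrite ler_pM2l //; apply: ge0_ler_powR; rewrite ?nnegrE ?(ltW exponent_gt0) //.
apply: (@le_trans _ _ (Num.truncn X)%:R); last by rewrite truncn_le.
by rewrite ler_nat trunc_logP // truncn_gt0 (le_trans _ X2) // ler1n.
Qed.
End DyadicSum.

Theorem theorem3 (R : realType) (g : nat) (k eps : R) :
  prime g -> (5 <= g)%N -> 1 <= k -> 0 < eps ->
  exists2 C : R, 0 < C &
    forall X : R, 2 <= X ->
      [/\ 1 <= k <= (g%:R ^+ 2 - 1) / (2 * g%:R - 1) ->
            torsion_moment g k X <=
              C * X `^ (1 + k * ((g%:R - 2) / (2 * g%:R + 2)) + eps),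
          (g%:R ^+ 2 - 1) / (2 * g%:R - 1) <= k <= g%:R + 1 ->
            torsion_moment g k X <=
              C * X `^ (1 + k * ((g%:R - 1) / (2 * g%:R))
                          - (g%:R - 1) / (2 * g%:R) + eps)
        & g%:R + 1 <= k ->
            torsion_moment g k X <= C * X `^ (k / 2 + eps)].
Proof.
move=> _ g_ge5 k_ge1 eps0; have g_gt1 : (1 < g)%N by apply: leq_trans g_ge5.
have [C C0 moment_le] := torsion_moment_le g_gt1 k_ge1 eps0.
exists C => // X X2; split=> [/andP[_ k_le]|k_range|k_ge].
- by rewrite -/(exponent_low g k) -(moment_exponent_lowE g_gt1 k_le); apply: moment_le.
- by rewrite -/(exponent_mid g k) -(moment_exponent_midE g_gt1 k_range); apply: moment_le.
- by rewrite -(moment_exponent_halfE g_gt1 k_ge); apply: moment_le.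
Qed.
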